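(* Let $A$ and $B$ be unital C*-algebras, let $C$ be a C*-algebra and let $\Phi\in\mathrm{Mor}(A,C\otimes B)$. Define the operator system $S\subset B$ by $$S=\overline{\mathrm{span}}\{(\omega\otimes\mathrm{id})(\Phi(x)) : \omega\in C^*,\ x\in A\}.$$ If the C*-subalgebra of $B$ generated by $S$ equals $B$, then the embedding $S\subset B$ is hyperrigid and $B=C^*_{\mathrm{env}}(S)$. In particular, for any finite quantum space $\mathbb{P}$ and any compact quantum space $\mathbb{O}$ the embedding $\mathbb{S}_{\mathbb{P},\mathbb{O}}\subset C(\mathbb{M}_{\mathbb{P},\mathbb{O}})$ is hyperrigid and $C^*_{\mathrm{env}}(\mathbb{S}_{\mathbb{P},\mathbb{O}})=C(\mathbb{M}_{\mathbb{P},\mathbb{O}})$.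
   Context: For C*-algebras $A,B$, $\mathrm{Mor}(A,B)$ is the set of non-degenerate $*$-homomorphisms from $A$ to the multiplier algebra $M(B)$ (unital $*$-homomorphisms $A\to B$ if both are unital). $\otimes$ is the minimal tensor product. For $\omega\in C^*$ the slice map $\omega\otimes\mathrm{id}\colon C\otimes B\to B$ is extended (uniquely, by strict continuity) to $M(C\otimes B)\to M(B)=B$. Hyperrigidity: for a C*-algebra $B$ and an operator system $S\subset B$ the embedding $S\subset B$ is hyperrigid if, whenever $H$ is a Hilbert space, $\pi\colon B\to B(H)$ is a $*$-homomorphism and $\eta\colon B\to B(H)$ is a unital completely positive map with $\pi|_S=\eta|_S$, one has $\pi=\eta$. $C^*_{\mathrm{env}}(S)$ is the C*-envelope (in the sense of Hamana) of the operator system $S$; the equality $B=C^*_{\mathrm{env}}(S)$ means that the canonical surjection $B\to C^*_{\mathrm{env}}(S)$ which is the identity on $S$ is an isomorphism. A quantum space $\mathbb{X}$ is an object of the category dual to the category of C*-algebras; the corresponding C*-algebra is denoted $C_0(\mathbb{X})$, or $C(\mathbb{X})$ when it is unital. $\mathbb{X}$ is compact if $C(\mathbb{X})$ is unital and finite if $C(\mathbb{X})$ is finite-dimensional. For $\mathbb{P}$ finite and $\mathbb{O}$ compact, $(C(\mathbb{M}_{\mathbb{P},\mathbb{O}}),\boldsymbol{\Phi}_{\mathbb{P},\mathbb{O}})$ denotes the (existing, unique up to isomorphism) pair consisting of a unital C*-algebra and a unital $*$-homomorphism $\boldsymbol{\Phi}_{\mathbb{P},\mathbb{O}}\colon C(\mathbb{O})\to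 C(\mathbb{P})\otimes C(\mathbb{M}_{\mathbb{P},\mathbb{O}})$ with the universal property: for every quantum space $\mathbb{X}$ and every $\Psi\in\mathrm{Mor}(C(\mathbb{O}),C(\mathbb{P})\otimes C_0(\mathbb{X}))$ there is a unique $\Lambda\in\mathrm{Mor}(C(\mathbb{M}_{\mathbb{P},\mathbb{O}}),C_0(\mathbb{X}))$ with $\Psi=(\mathrm{id}\otimes\Lambda)\circ\boldsymbol{\Phi}_{\mathbb{P},\mathbb{O}}$. The C*-algebra $C(\mathbb{M}_{\mathbb{P},\mathbb{O}})$ is generated by the slices $(\omega\otimes\mathrm{id})\boldsymbol{\Phi}_{\mathbb{P},\mathbb{O}}(a)$, $a\in C(\mathbb{O})$, $\omega\in C(\mathbb{P})^*$, and $\mathbb{S}_{\mathbb{P},\mathbb{O}}\subset C(\mathbb{M}_{\mathbb{P},\mathbb{O}})$ is the closed linear span of these slices. *)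

(* Defs.v *)
From HB Require Import structures.
From mathcomp Require Import all_boot all_order all_algebra.
From mathcomp Require Import complex.
From mathcomp Require Import all_classical all_reals all_analysis.

Set Implicit Arguments.
Unset Strict Implicit.
Unset Printing Implicit Defensive.

Import Order.TTheory GRing.Theory Num.Theory.
Import numFieldNormedType.Exports.

Local Open Scope classical_set_scope.
Local Open Scope ring_scope.
Local Open Scope complex_scope.

(* The ring structures of MathComp are unital, so the product of a possibly
   non-unital C*-algebra is an operation of its own.  The zero algebra is a
   (unital) C*-algebra. *)
HB.mixin Record isCstarAlgebra (R : realType) A
    of CompleteNormedModule R[i] A := {
  amul : A -> A -> A ;
  star : A -> A ;
  amulA : associative amul ;
  amulPl : forall (a : R[i]) (x y z : A),
    amul (a *: x + y) z = a *: amul x z + amul y z ;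
  amulPr : forall (a : R[i]) (x y z : A),
    amul z (a *: x + y) = a *: amul z x + amul z y ;
  starP : forall (a : R[i]) (x y : A),
    star (a *: x + y) = Num.conj a *: star x + star y ;
  starK : involutive star ;
  starM : forall x y, star (amul x y) = amul (star y) (star x) ;
  norm_amul : forall x y : A, `|amul x y| <= `|x| * `|y| ;
  norm_star_amul : forall x : A, `|amul (star x) x| = `|x| ^+ 2
}.

#[short(type="cstarType")]
HB.structure Definition CstarAlgebra (R : realType) :=
  {A of CompleteNormedModule R[i] A & isCstarAlgebra R A}.

HB.mixin Record isUnitalCstar (R : realType) A of CstarAlgebra R A := {
  aone : A ;
  amul1a : left_id aone (amul : A -> A -> A) ;
  amula1 : right_id aone (amul : A -> A -> A)
}.

#[short(type="unitalCstarType")]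
HB.structure Definition UnitalCstarAlgebra (R : realType) :=
  {A of CstarAlgebra R A & isUnitalCstar R A}.

(* The inner product is linear in its first argument. *)
HB.mixin Record isHilbert (R : realType) H of CompleteNormedModule R[i] H := {
  hdot : {dot H for (@Num.conj R[i])} ;
  norm_hdot : forall x : H, `|x| ^+ 2 = hdot x x
}.

#[short(type="hilbertType")]
HB.structure Definition Hilbert (R : realType) :=
  {H of CompleteNormedModule R[i] H & isHilbert R H}.

Section Subspaces.
Context {R : realType}.

Definition lspan (V : lmodType R[i]) (X : set V) : set V :=
  [set v | exists n (a : 'I_n -> R[i]) (x : 'I_n -> V),
     (forall i, X (x i)) /\ v = \sum_i a i *: x i].

Definition closed_span (V : normedModType R[i]) (X : set V) : set V :=
  closure (lspan X).

Definition finite_dimensional (V : lmodType R[i]) :=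
  exists n (e : 'I_n -> V),
    forall v, exists a : 'I_n -> R[i], v = \sum_i a i *: e i.

Definition cstar_subalgebra (B : cstarType R) (D : set B) :=
  [/\ D 0,
      forall (a : R[i]) x y, D x -> D y -> D (a *: x + y),
      forall x y, D x -> D y -> D (amul x y),
      forall x, D x -> D (star x) &
      closed D].

Definition cstar_generated (B : cstarType R) (S : set B) : set B :=
  \bigcap_(D in [set D | cstar_subalgebra D /\ S `<=` D]) D.

Definition operator_system (B : unitalCstarType R) (S : set B) :=
  [/\ S aone,
      forall (a : R[i]) x y, S x -> S y -> S (a *: x + y) &
      forall x, S x -> S (star x)].

End Subspaces.

Section StarHomomorphisms.
Context {R : realType}.

Definition star_hom (A B : cstarType R) (f : A -> B) :=
  [/\ linear f,
      forall x y, f (amul x y) = amul (f x) (f y) &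
      forall x, f (star x) = star (f x)].

Definition unital_star_hom (A B : unitalCstarType R) (f : A -> B) :=
  star_hom f /\ f aone = aone.

(* B(H) is represented by the maps H -> H satisfying bounded_op. *)
Definition bounded_op (H : hilbertType R) (f : H -> H) :=
  linear f /\ continuous f.

(* A *-homomorphism B -> B(H), possibly degenerate or non-unital. *)
Definition representation (B : cstarType R) (H : hilbertType R)
    (pi : B -> H -> H) :=
  [/\ forall b, bounded_op (pi b),
      forall (a : R[i]) b c xi, pi (a *: b + c) xi = a *: pi b xi + pi c xi,
      forall b c xi, pi (amul b c) xi = pi b (pi c xi) &
      forall b xi zeta, hdot (pi (star b) xi) zeta = hdot xi (pi b zeta)].

End StarHomomorphisms.

Section MatrixOrder.
Context {R : realType}.

(* Positivity in the *-algebra M_n(B): X = Y^* Y. *)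
Definition mx_positive (B : cstarType R) n (X : 'M[B]_n) :=
  exists Y : 'M[B]_n,
    X = \matrix_(i, j) \sum_k amul (star (Y k i)) (Y k j).

(* The amplification of eta maps M_n(B) to M_n(B(H)) = B(H^n), where
   positivity is that of the quadratic form. *)
Definition unital_completely_positive (B : unitalCstarType R)
    (H : hilbertType R) (eta : B -> H -> H) :=
  [/\ forall b, bounded_op (eta b),
      forall (a : R[i]) b c xi,
        eta (a *: b + c) xi = a *: eta b xi + eta c xi,
      forall xi, eta aone xi = xi &
      forall n (X : 'M[B]_n), mx_positive X -> forall xi : 'I_n -> H,
        0 <= \sum_i \sum_j hdot (eta (X i j) (xi j)) (xi i)].

Definition hyperrigid (B : unitalCstarType R) (S : set B) :=
  forall (H : hilbertType R) (pi eta : B -> H -> H),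
    representation pi -> unital_completely_positive eta ->
    (forall s, S s -> pi s = eta s) -> pi = eta.

(* A C*-extension of S: a unital complete order embedding of S whose range
   generates.  Only the values of j on S matter. *)
Definition cstar_extension (B : unitalCstarType R) (S : set B)
    (D : unitalCstarType R) (j : B -> D) :=
  [/\ forall (a : R[i]) x y, S x -> S y -> j (a *: x + y) = a *: j x + j y,
      j aone = aone,
      forall n (X : 'M[B]_n), (forall i k, S (X i k)) ->
        (mx_positive X <-> mx_positive (map_mx j X)) &
      cstar_generated (j @` S) = setT].

(* Hamana: the C*-extension that is a quotient, compatibly with the
   embeddings of S, of every C*-extension. *)
Definition cstar_envelope (B : unitalCstarType R) (S : set B)
    (E : unitalCstarType R) (k : B -> E) :=
  cstar_extension S k /\
  forall (D : unitalCstarType R) (j : B -> D), cstar_extension S j ->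
    exists q : D -> E, [/\ unital_star_hom q, set_surj setT setT q &
      forall s, S s -> q (j s) = k s].

(* B = C*_env(S): the C*-envelope exists, and the canonical surjection of B
   onto it is an isomorphism. *)
Definition equals_cstar_envelope (B : unitalCstarType R) (S : set B) :=
  (exists (E : unitalCstarType R) (k : B -> E), cstar_envelope S k) /\
  forall (E : unitalCstarType R) (k : B -> E), cstar_envelope S k ->
    exists q : B -> E, [/\ unital_star_hom q,
      forall s, S s -> q s = k s & bijective q].

End MatrixOrder.

Section Multipliers.
Context {R : realType} (T : cstarType R).

(* The multiplier algebra M(T) as the algebra of double centralizers
   (Busby): mleft m is t |-> m t and mright m is t |-> t m.  Linearity and
   boundedness of both maps follow from the axiom. *)
Record multiplier := Multiplier {
  mleft : T -> T ;
  mright : T -> T ;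
  multiplierP : forall x y, amul x (mleft y) = amul (mright x) y
}.

Fact mlin_subproof (a : R[i]) (m n : multiplier) x y :
  amul x (a *: mleft m y + mleft n y) =
  amul (a *: mright m x + mright n x) y.
Proof. by rewrite amulPr amulPl !multiplierP. Qed.

Definition mlin (a : R[i]) (m n : multiplier) :=
  Multiplier (mlin_subproof a m n).

Fact mmul_subproof (m n : multiplier) x y :
  amul x (mleft m (mleft n y)) = amul (mright n (mright m x)) y.
Proof. by rewrite !multiplierP. Qed.

Definition mmul (m n : multiplier) := Multiplier (mmul_subproof m n).

Fact mstar_subproof (m : multiplier) x y :
  amul x (star (mright m (star y))) = amul (star (mleft m (star x))) y.
Proof. by rewrite -[x in LHS]starK -[y in RHS]starK -!starM multiplierP. Qed.

Definition mstar (m : multiplier) := Multiplier (mstar_subproof m).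

Definition in_multiplier (t : T) : multiplier :=
  Multiplier (fun x y => amulA x t y).

Definition strict_cvg (F : set_system multiplier) (m : multiplier) :=
  forall t, ((fun n => mleft n t) @ F --> mleft m t) /\
            ((fun n => mright n t) @ F --> mright m t).

Definition strictly_continuous (B : normedModType R[i])
    (f : multiplier -> B) :=
  forall (F : set_system multiplier) (m : multiplier),
    Filter F -> strict_cvg F m -> f @ F --> f m.

End Multipliers.

(* Phi \in Mor(A, T) *)
Definition cstar_Mor (R : realType) (A T : cstarType R)
    (Phi : A -> multiplier T) :=
  [/\ forall (a : R[i]) x y, Phi (a *: x + y) = mlin a (Phi x) (Phi y),
      forall x y, Phi (amul x y) = mmul (Phi x) (Phi y),
      forall x, Phi (star x) = mstar (Phi x) &
      closed_span [set u | exists x t, u = mleft (Phi x) t] = setT].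

Section MinimalTensor.
Context {R : realType}.

(* A sequence of pairs stands for the corresponding sum of elementary tensors
   in the algebraic tensor product of H and K (resp. of C and B).  tensor_dot
   is the inner product of the Hilbert space tensor product, and
   tensor_act pi rho z u is (\sum_k pi c_k (x) rho b_k) u. *)
Definition tensor_dot (H K : hilbertType R) (u v : seq (H * K)) : R[i] :=
  \sum_(p <- u) \sum_(q <- v) hdot p.1 q.1 * hdot p.2 q.2.

Definition tensor_act (C B : cstarType R) (H K : hilbertType R)
    (pi : C -> H -> H) (rho : B -> K -> K) (z : seq (C * B))
    (u : seq (H * K)) : seq (H * K) :=
  [seq (pi c.1 p.1, rho c.2 p.2) | c <- z, p <- u].

(* r bounds the operator norm of \sum_k pi c_k (x) rho b_k on the Hilbert
   space tensor product of H and K, for all representations pi and rho. *)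
Definition spatial_norm_le (C B : cstarType R) (z : seq (C * B)) (r : R) :=
  forall (H K : hilbertType R) (pi : C -> H -> H) (rho : B -> K -> K),
    representation pi -> representation rho ->
    forall u, tensor_dot (tensor_act pi rho z u) (tensor_act pi rho z u)
              <= (r%:C) ^+ 2 * tensor_dot u u.

(* The minimal tensor product: a completion of the algebraic tensor product
   in the spatial C*-norm.  It is determined up to isomorphism. *)
Record minTensor (C B : cstarType R) := MinTensor {
  tensor_alg :> cstarType R ;
  tens : C -> B -> tensor_alg ;
  tensPl : forall b, linear (tens^~ b) ;
  tensPr : forall c, linear (tens c) ;
  tensM : forall c c' b b',
    amul (tens c b) (tens c' b') = tens (amul c c') (amul b b') ;
  tens_star : forall c b, star (tens c b) = tens (star c) (star b) ;
  tens_dense : closed_span [set t | exists c b, t = tens c b] = setT ;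
  tens_norm : forall (z : seq (C * B)) (r : R), 0 <= r ->
    `|\sum_(p <- z) tens p.1 p.2| <= r%:C <-> spatial_norm_le z r
}.

Definition bounded_functional (C : cstarType R) (w : C -> R[i]^o) :=
  linear w /\ continuous w.

(* s is the slice map w (x) id on C (x) B *)
Definition slice_map (C B : cstarType R) (T : minTensor C B)
    (w : C -> R[i]^o) (s : T -> B) :=
  [/\ linear s, continuous s & forall c b, s (tens T c b) = w c *: b].

(* f is the strictly continuous extension M(C (x) B) -> M(B) = B of the slice
   map w (x) id; the strict topology of M(B) is the norm topology of B as B
   is unital. *)
Definition strict_slice_map (C : cstarType R) (B : unitalCstarType R)
    (T : minTensor C B) (w : C -> R[i]^o) (f : multiplier T -> B) :=
  strictly_continuous f /\
  exists s : T -> B, slice_map w s /\ forall t, f (in_multiplier t) = s t.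

Definition slice_space (A C : cstarType R) (B : unitalCstarType R)
    (T : minTensor C B) (Phi : A -> multiplier T) : set B :=
  closed_span [set y | exists (w : C -> R[i]^o) (f : multiplier T -> B) x,
    [/\ bounded_functional w, strict_slice_map w f & y = f (Phi x)]].

End MinimalTensor.

Section MappingSpace.
Context {R : realType}.

(* L' is id (x) L, as a morphism from P (x) M to P (x) X *)
Definition id_tensor (P M X : cstarType R) (T : minTensor P M)
    (T' : minTensor P X) (L : M -> multiplier X) (L' : T -> multiplier T') :=
  cstar_Mor L' /\
  forall p m q x,
    mleft (L' (tens T p m)) (tens T' q x) =
    tens T' (amul p q) (mleft (L m) x).

(* (M, Phi) is the universal pair (C(M_{P,O}), Phi_{P,O}); the algebras P, O
   and M are those of the corresponding quantum spaces. *)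
Definition mapping_space (P O M : unitalCstarType R) (T : minTensor P M)
    (Phi : O -> T) :=
  [/\ star_hom Phi, Phi aone = tens T aone aone &
      forall (X : cstarType R) (T' : minTensor P X)
             (Psi : O -> multiplier T'), cstar_Mor Psi ->
        exists! L : M -> multiplier X, cstar_Mor L /\
          exists L' : T -> multiplier T', id_tensor L L' /\
            forall a, Psi a = L' (Phi a)].

(* The operator system S_{P,O} *)
Definition mapping_slice_space (P O M : unitalCstarType R)
    (T : minTensor P M) (Phi : O -> T) : set M :=
  closed_span [set y | exists (w : P -> R[i]^o) (s : T -> M) a,
    [/\ bounded_functional w, slice_map w s & y = s (Phi a)]].

End MappingSpace.

(* Main.v *)
(* Let t = Phi(u)(c (x) 1), let sigma be a representation of C, x a vector, and s_i the slices of
   t by the functionals <sigma(.) x, e_i> for an orthonormal family (e_i).  The s_i lie in S and,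
   since t^* t = (c^* (x) 1) Phi(u^* u)(c (x) 1), so does the slice W of t^* t by
   <sigma(.) x, x>.  Moreover sum_i s_i^* s_i tends to W when (e_i) grows.  If eta is completely
   positive and agrees with a representation pi on S, the Schwarz inequality gives
   sum_i pi(s_i)^* pi(s_i) <= sum_i eta(s_i^* s_i) <= eta(W) = pi(W), so that equality holds and
   the s_i are in the multiplicative domain of eta.  These slices span a dense subspace of S, and
   S generates B, so pi = eta.  For the envelope, the same argument is applied to an extension to
   D of pi o j^-1, whence j(s) |-> s extends to a *-homomorphism from D onto B.  For mapping
   spaces, Phi corestricts to the tensor product of P with the algebra generated by the slices,
   and the uniqueness of factorizations through M shows that this algebra is M. *)
Require Import Defs.
From HB Require Import structures.
From mathcomp Require Import all_boot all_order all_algebra.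
From mathcomp Require Import complex.
From mathcomp Require Import all_classical all_reals all_analysis.
From mathcomp Require Import ring lra.

Set Implicit Arguments.
Unset Strict Implicit.
Unset Printing Implicit Defensive.

Import Order.TTheory GRing.Theory Num.Theory.
Import numFieldNormedType.Exports.
Local Open Scope classical_set_scope.
Local Open Scope ring_scope.
Local Open Scope complex_scope.

(** Everything rests on the C*-identity: square roots come from a contraction principle, norm bounds
    from writing a self-adjoint element as a mean of two unitaries, and positivity is a norm
    condition, so that no functional calculus enters. Three obstacles shape the rest. The algebra
    [C] need not have a unit, and its functionals are accessible only through representations;
    approximate units and a separation argument reduce all slices to vector slices of Phi(u)(c (x)
    1). Next, the sum of the s_i^* s_i is only close to W, and the error must be uniform over all
    representations: the orthonormal family is therefore read off from one finite sum approximating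
    t. Finally, the extension to D is built from its matrix coefficients ([cp_kernel]), as a
    positive functional on D-valued functions on H x H; and the homomorphism from D to B arises as a
    relation, shown to be single-valued by testing b in a representation that attains its norm. *)

Local Notation "x ^*" := (Num.conj x) : ring_scope.
Local Notation "x ^*" := (Num.conj x) : complex_scope.
Local Notation "x ** y" := (amul x y) (at level 40, left associativity).

(** * Linear identities *)

(* In the square-zero extension of [K] by [V], identities between linear combinations of vectors
   become identities of a commutative ring. *)
Section SquareZero.
Variables (K : comNzRingType) (V : lmodType K).

Definition sqz : Type := (K * V)%type.
HB.instance Definition _ := GRing.Zmodule.on sqz.

Definition sqz_mul (x y : sqz) : sqz := (x.1 * y.1, x.1 *: y.2 + y.1 *: x.2).

Fact sqz_mulA : associative sqz_mul.
Proof.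
move=> [a x] [b y] [c z]; rewrite /sqz_mul /= mulrA; congr pair.
by rewrite !scalerDr !scalerA addrA [c * b]mulrC [c * a]mulrC.
Qed.

Fact sqz_mulC : commutative sqz_mul.
Proof. by move=> [a x] [b y]; rewrite /sqz_mul /= mulrC addrC. Qed.

Fact sqz_mul1 : left_id ((1, 0) : sqz) sqz_mul.
Proof. by move=> [a x]; rewrite /sqz_mul /= mul1r scale1r scaler0 addr0. Qed.

Fact sqz_mulD : left_distributive sqz_mul +%R.
Proof.
move=> [a x] [b y] [c z]; rewrite /sqz_mul /= mulrDl; congr pair.
by rewrite scalerDl scalerDr addrACA.
Qed.

Fact sqz_neq0 : ((1, 0) : sqz) != 0.
Proof. by apply/eqP => -[/eqP]; rewrite oner_eq0. Qed.

HB.instance Definition _ := GRing.Zmodule_isComNzRing.Build sqz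
  sqz_mulA sqz_mulC sqz_mul1 sqz_mulD sqz_neq0.

Definition sqz_in (x : V) : sqz := (0, x).
Definition sqz_sc (a : K) : sqz := (a, 0).

Fact sqz_in_additive : zmod_morphism sqz_in.
Proof. by move=> x y; rewrite /sqz_in; congr pair; rewrite subr0. Qed.
HB.instance Definition _ := GRing.isZmodMorphism.Build V sqz sqz_in sqz_in_additive.

Fact sqz_sc_additive : zmod_morphism sqz_sc.
Proof. by move=> x y; rewrite /sqz_sc; congr pair; rewrite subr0. Qed.
HB.instance Definition _ := GRing.isZmodMorphism.Build K sqz sqz_sc sqz_sc_additive.

Fact sqz_sc_multiplicative : monoid_morphism sqz_sc.
Proof.
split=> // x y; rewrite /sqz_sc /=.
by congr pair; rewrite !scaler0 addr0.
Qed.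
HB.instance Definition _ := GRing.isMonoidMorphism.Build K sqz sqz_sc
  sqz_sc_multiplicative.

Lemma sqz_inZ a x : sqz_in (a *: x) = sqz_sc a * sqz_in x.
Proof. by congr pair; rewrite /= ?mulr0 // scale0r addr0. Qed.

Lemma sqz_inD x y : sqz_in (x + y) = sqz_in x + sqz_in y.
Proof. exact: raddfD. Qed.

Lemma sqz_inN x : sqz_in (- x) = - sqz_in x.
Proof. exact: raddfN. Qed.

Lemma sqz_in0 : sqz_in 0 = 0.
Proof. by []. Qed.

Lemma sqz_inMn x n : sqz_in (x *+ n) = sqz_in x *+ n.
Proof. exact: raddfMn. Qed.

Lemma sqz_inj : injective sqz_in.
Proof. by move=> x y []. Qed.
End SquareZero.

Ltac lmod := apply: sqz_inj; rewrite ?(sqz_inD, sqz_inN, sqz_in0, sqz_inMn, sqz_inZ); ring.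

(** * The real-valued norm *)

Section LinearFunctions.
Context {K : pzRingType} {U V : lmodType K} {f : U -> V} (lf : linear f).

Lemma lin0 : f 0 = 0.
Proof. by have := lf (-1) 0 0; rewrite scaleN1r oppr0 addr0 scaleN1r addNr. Qed.

Lemma linZ a x : f (a *: x) = a *: f x.
Proof. by rewrite -[a *: x]addr0 lf lin0 addr0. Qed.

Lemma linD x y : f (x + y) = f x + f y.
Proof. by rewrite -{1}[x]scale1r lf scale1r. Qed.

Lemma linN x : f (- x) = - f x.
Proof. by rewrite -scaleN1r linZ scaleN1r. Qed.

Lemma linB x y : f (x - y) = f x - f y.
Proof. by rewrite linD linN. Qed.

Lemma lin_sum I (r : seq I) (F : I -> U) :
  f (\sum_(i <- r) F i) = \sum_(i <- r) f (F i).
Proof.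
by elim: r => [|i r ih]; rewrite ?big_nil ?big_cons ?lin0 // linD ih.
Qed.

End LinearFunctions.

Section RealNorm.
Context {R : realType}.
Implicit Types (V W : normedModType R[i]).

(** Norms over [R[i]] have values in [R[i]]. Their real parts lose nothing and put every estimate in
    the ordered field [R]. *)
Definition rn (V : normedZmodType R[i]) (x : V) : R := complex.Re `|x|.

Lemma rnE (V : normedZmodType R[i]) (x : V) : `|x| = (rn x)%:C.
Proof.
have := normr_ge0 x; rewrite /rn lecE => /andP[/eqP /= h _].
by case: `|x| h => a b /= ->.
Qed.

Lemma rn_le (V : normedZmodType R[i]) (x : V) (r : R) :
  (`|x| <= r%:C) = (rn x <= r).
Proof. by rewrite rnE lecR. Qed.

Lemma rn_ge0 (V : normedZmodType R[i]) (x : V) : 0 <= rn x.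
Proof. by rewrite -lecR -rnE normr_ge0. Qed.

Lemma rn_eq0 (V : normedZmodType R[i]) (x : V) : rn x = 0 -> x = 0.
Proof. by move=> h; apply/eqP; rewrite -normr_eq0 rnE h. Qed.

Lemma rn0 (V : normedZmodType R[i]) : rn (0 : V) = 0.
Proof. by rewrite /rn normr0. Qed.

Lemma rn_gt0 (V : normedZmodType R[i]) (x : V) : x <> 0 -> 0 < rn x.
Proof. by move=> h; rewrite lt_neqAle rn_ge0 andbT eq_sym; apply/eqP => /rn_eq0. Qed.

Lemma rnN (V : normedZmodType R[i]) (x : V) : rn (- x) = rn x.
Proof. by rewrite /rn normrN. Qed.

Lemma rnD (V : normedZmodType R[i]) (x y : V) : rn (x + y) <= rn x + rn y.
Proof. by rewrite -lecR rmorphD /= -!rnE ler_normD. Qed.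

Lemma rnB (V : normedZmodType R[i]) (x y : V) : rn (x - y) <= rn x + rn y.
Proof. by rewrite -(rnN y) rnD. Qed.

Lemma rn_distC (V : normedZmodType R[i]) (x y : V) : rn (x - y) = rn (y - x).
Proof. by rewrite -rnN opprB. Qed.

Lemma rn_tri (V : normedZmodType R[i]) (y x z : V) :
  rn (x - z) <= rn (x - y) + rn (y - z).
Proof. by apply: le_trans (rnD _ _); rewrite addrA subrK. Qed.

Lemma rn_sub (V : normedZmodType R[i]) (x y : V) : rn x <= rn y + rn (x - y).
Proof. by apply: le_trans (rnD _ _); rewrite addrC subrK. Qed.

Lemma rn_sum (V : normedZmodType R[i]) I (r : seq I) (F : I -> V) :
  rn (\sum_(i <- r) F i) <= \sum_(i <- r) rn (F i).
Proof.
elim: r => [|i r ih]; first by rewrite !big_nil rn0.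
by rewrite !big_cons (le_trans (rnD _ _)) // lerD2l.
Qed.

Lemma rnZ V (a : R[i]) (x : V) : rn (a *: x) = rn a * rn x.
Proof. by apply: (@complexI R); rewrite rmorphM /= -!rnE normrZ. Qed.

Lemma rnM (a b : R[i]) : rn (a * b) = rn a * rn b.
Proof. by apply: (@complexI R); rewrite rmorphM /= -!rnE normrM. Qed.

Lemma rn_real (r : R) : rn r%:C = `|r|.
Proof. by rewrite /rn normc_def /= expr0n addr0 sqrtr_sqr. Qed.

Lemma rnZr V (r : R) (x : V) : rn (r%:C *: x) = `|r| * rn x.
Proof. by rewrite rnZ rn_real. Qed.

Lemma rn_conj (a : R[i]) : rn a^* = rn a.
Proof. by rewrite /rn norm_conjC. Qed.

Lemma rn_i : rn ('i : R[i]) = 1.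
Proof. by rewrite /rn normCi. Qed.

Lemma rnMn V (x : V) n : rn (x *+ n) = rn x *+ n.
Proof. by rewrite /rn normrMn raddfMn. Qed.

Lemma Re_rn (a : R[i]) : `|complex.Re a| <= rn a.
Proof. by rewrite -lecR -rnE normc_ge_Re. Qed.

Lemma Re_le_rn (a : R[i]) : complex.Re a <= rn a.
Proof. exact: le_trans (ler_norm _) (Re_rn a). Qed.

Lemma Im_rn (a : R[i]) : `|complex.Im a| <= rn a.
Proof.
rewrite /rn normc_def /= -sqrtr_sqr ler_wsqrtr // lerDr sqr_ge0 //.
Qed.

Lemma rn_ReIm (a : R[i]) : rn a <= `|complex.Re a| + `|complex.Im a|.
Proof.
rewrite /rn normc_def /= -[leRHS]ger0_norm ?addr_ge0 // -sqrtr_sqr ler_wsqrtr //.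
rewrite sqrrD !real_normK ?num_real // -addrA addrCA lerDr.
by rewrite mulrn_wge0 // mulr_ge0.
Qed.

Lemma mul_conj (a : R[i]) : a * a^* = (rn a ^+ 2)%:C.
Proof. by rewrite -normCK rnE rmorphXn. Qed.

Lemma conj_realC (r : R) : (r%:C)^* = r%:C :> R[i].
Proof. by rewrite -[LHS]/(conjc _) /conjc /= oppr0. Qed.

Lemma sqr_i : ('i : R[i]) ^+ 2 = -1.
Proof. exact: sqrCi. Qed.

Lemma conj_i : ('i : R[i])^* = - 'i.
Proof. exact: conjCi. Qed.

Lemma cRe_conj (a : R[i]) : complex.Re a^* = complex.Re a.
Proof. by case: a. Qed.

Lemma Re_realM (r : R) (a : R[i]) : complex.Re (r%:C * a) = r * complex.Re a.
Proof. by case: a => u v /=; rewrite mul0r subr0. Qed.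

Lemma Re_iM (a : R[i]) : complex.Re ('i * a) = - complex.Im a.
Proof. by case: a => u v /=; rewrite mul0r sub0r mul1r. Qed.

Lemma ReP (a : R[i]) : (0 <= a) -> a = (complex.Re a)%:C.
Proof. by rewrite lecE => /andP[/eqP]; case: a => u v /= ->. Qed.

Lemma ReD (a b : R[i]) : complex.Re (a + b) = complex.Re a + complex.Re b.
Proof. exact: raddfD. Qed.

Lemma ReN (a : R[i]) : complex.Re (- a) = - complex.Re a.
Proof. exact: raddfN. Qed.

Lemma Re_ge0 (a : R[i]) : 0 <= a -> 0 <= complex.Re a.
Proof. by rewrite lecE => /andP[]. Qed.

Lemma small_eq0 (r : R) : (forall e, 0 < e -> r <= e) -> r <= 0.
Proof. by move=> h; apply/ler_addgt0Pl => e /h; rewrite addr0. Qed.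

(** Most density and limit arguments below end here: the vector in question is bounded by a fixed
    multiple of every [e > 0]. *)
Lemma rn_small V (x : V) (K : R) : (forall e, 0 < e -> rn x <= K * e) -> x = 0.
Proof.
move=> h; apply: rn_eq0; apply/eqP; rewrite eq_le rn_ge0 andbT.
have K1 : 0 < `|K| + 1 by rewrite ltr_wpDl.
apply: small_eq0 => e e0; apply: le_trans (h (e / (`|K| + 1)) _) _.
  by rewrite divr_gt0.
rewrite mulrA ler_pdivrMr // mulrC ler_pM2l //.
by rewrite (le_trans (ler_norm K)) // lerDl.
Qed.

Lemma nbhs_rn V (x : V) (A : set V) :
  nbhs x A <-> exists e : R, 0 < e /\ forall y, rn (x - y) < e -> A y.
Proof.
rewrite -nbhs_ballE; split.
  move=> [e /= e0 h]; exists (complex.Re e); split.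
    by move: e0; rewrite ltcE => /andP[].
  move=> y hy; apply: h; rewrite -ball_normE /ball_ /= rnE.
  move: e0; rewrite ltcE => /andP[/eqP /= ei _].
  by rewrite ltcE /= ei eqxx.
move=> [e [e0 h]]; exists e%:C; first by rewrite /= ltcE /= eqxx.
by move=> y; rewrite -ball_normE /ball_ /= rnE ltcR; exact: h.
Qed.

Lemma closure_rn V (X : set V) v :
  closure X v <-> forall e : R, 0 < e -> exists2 x, X x & rn (v - x) < e.
Proof.
split.
  move=> h e e0; have /h [x [Xx vx]] : nbhs v [set y | rn (v - y) < e].
    by apply/nbhs_rn; exists e.
  by exists x.
move=> h A /nbhs_rn [e [/h [x Xx vx] hA]].
by exists x; split => //; exact: hA.
Qed.

Lemma closed_rn V (X : set V) : closed X <->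
  (forall v, (forall e : R, 0 < e -> exists2 x, X x & rn (v - x) < e) -> X v).
Proof.
split; first by move=> h v /closure_rn /h.
by move=> h v /closure_rn /h.
Qed.

Lemma cvg_rn V T (F : set_system T) (FF : Filter F) (f : T -> V) l :
  f @ F --> l <-> forall e : R, 0 < e -> F [set t | rn (l - f t) < e].
Proof.
split.
  by move=> h e e0; apply: (h [set y | rn (l - y) < e]); apply/nbhs_rn; exists e.
move=> h A /nbhs_rn [e [e0 hA]]; rewrite /fmap /=.
by apply: filterS (h e e0) => t; exact: hA.
Qed.

Lemma cvgrn_seq V (u : nat -> V) l : u @ \oo --> l <->
  forall e : R, 0 < e -> exists N, forall n, (N <= n)%N -> rn (l - u n) < e.
Proof.
rewrite cvg_rn; split=> h e /h [].
  by move=> N _ hN; exists N => n; exact: hN.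
by move=> N hN; exists N.
Qed.

Lemma cauchy_rn (V : completeNormedModType R[i]) (u : nat -> V) :
  (forall e : R, 0 < e -> exists N, forall m n, (N <= m)%N -> (N <= n)%N ->
     rn (u m - u n) < e) ->
  exists l, forall e : R, 0 < e -> exists N, forall n, (N <= n)%N ->
     rn (l - u n) < e.
Proof.
move=> h; suff [l hl] : exists l : V, u @ \oo --> l.
  by exists l; exact/cvgrn_seq.
suff /cauchy_cvgP /cvg_ex [l hl] : cauchy (u @ \oo) by exists l.
apply: cauchy_exP => e e0.
have e0' : 0 < complex.Re e by move: e0; rewrite ltcE => /andP[].
have [N hN] := h _ e0'.
exists (u N), N => // n Nn; rewrite -ball_normE /ball_ /= rnE.
move: e0; rewrite ltcE => /andP[/eqP /= ei _].
by rewrite ltcE /= ei eqxx hN /=.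
Qed.

Lemma bounded_continuous V W (f : V -> W) (K : R) : linear f ->
  (forall x, rn (f x) <= K * rn x) -> continuous f.
Proof.
move=> lf h x; apply/cvg_rn => e e0; apply/nbhs_rn.
have K1 : 0 < `|K| + 1 by rewrite ltr_wpDl.
exists (e / (`|K| + 1)); split; first by rewrite divr_gt0.
move=> y hy /=; rewrite -(linB lf).
apply: le_lt_trans (h _) _; apply: le_lt_trans (_ : _ <= (`|K| + 1) * rn (x - y)) _.
  by apply: ler_wpM2r; rewrite ?rn_ge0 // (le_trans (ler_norm K)) // lerDl.
by rewrite mulrC -ltr_pdivlMr.
Qed.

Lemma continuous_bounded V W (f : V -> W) : linear f -> continuous f ->
  exists2 K : R, 0 < K & forall x, rn (f x) <= K * rn x.
Proof.
move=> lf cf; have /cvg_rn /(_ 1 ltr01) /nbhs_rn [e [e0 h]] := cf 0.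
exists (2 / e); first by rewrite divr_gt0.
move=> x; have [->|/eqP /rn_gt0 x0] := eqVneq x 0.
  by rewrite (lin0 lf) !rn0 mulr0.
pose t := e / (2 * rn x); have t0 : 0 < t by rewrite divr_gt0 // mulr_gt0.
have /h : rn (0 - t%:C *: x) < e.
  rewrite sub0r rnN rnZr gtr0_norm // /t invfM mulrA mulfVK ?gt_eqF //.
  by rewrite ltr_pdivrMr // ltr_pMr // ltr1n.
rewrite /= (lin0 lf) sub0r rnN (linZ lf) rnZr gtr0_norm // => /ltW.
rewrite -ler_pdivlMl // mulr1 /t invf_div => /le_trans; apply.
by rewrite mulrAC.
Qed.

End RealNorm.

(** * C*-algebra basics *)

Section CompleteFixpoint.
Context {R : realType}.

Lemma geom_small (r K e : R) : 0 <= r -> r < 1 -> 0 < e ->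
  exists N, forall n, (N <= n)%N -> K * r ^+ n < e.
Proof.
move=> r0 r1 e0.
have K1 : 0 < `|K| + 1 by rewrite ltr_wpDl.
have /cvgrPdist_lt /(_ (e / (`|K| + 1)) _) [|N _ hN] :
    (fun n => r ^+ n) @ \oo --> (0 : R).
- by apply: cvg_expr; rewrite ger0_norm.
- by rewrite divr_gt0.
exists N => n /hN /=; rewrite sub0r normrN ger0_norm ?exprn_ge0 //.
rewrite ltr_pdivlMr // => h; apply: le_lt_trans h.
rewrite mulrC ler_wpM2l ?exprn_ge0 // (le_trans (ler_norm K)) // lerDl //.
Qed.

Lemma geom_cauchy (V : completeNormedModType R[i]) (u : nat -> V) (K r : R) :
  0 <= r -> r < 1 -> (forall n, rn (u n.+1 - u n) <= K * r ^+ n) ->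
  exists l, (forall e : R, 0 < e -> exists N, forall n, (N <= n)%N ->
     rn (l - u n) < e) /\ rn (l - u 0) <= K / (1 - r).
Proof.
move=> r0 r1 h.
have K0 : 0 <= K.
  by have := h 0%N; rewrite expr0 mulr1; apply: le_trans; exact: rn_ge0.
have r1' : 0 < 1 - r by rewrite subr_gt0.
have step n p : rn (u (n + p)%N - u n) <= K * r ^+ n * ((1 - r ^+ p) / (1 - r)).
  elim: p => [|p ih]; first by rewrite addn0 subrr rn0 expr0 subrr mul0r mulr0.
  rewrite addnS; apply: le_trans (rn_tri (u (n + p)%N) _ _) _.
  apply: le_trans (lerD (h _) ih) _; rewrite exprD exprS le_eqVlt; apply/orP; left.
  by apply/eqP; field; rewrite gt_eqF.
have bnd n p : rn (u (n + p)%N - u n) <= K / (1 - r) * r ^+ n.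
  apply: le_trans (step n p) _.
  rewrite [leRHS]mulrAC ler_wpM2l ?mulr_ge0 ?exprn_ge0 //.
  by rewrite -[leRHS]mul1r ler_pM2r ?invr_gt0 // lerBlDr lerDl exprn_ge0.
have [e e0|l hl] := @cauchy_rn R V u.
  have e2 : 0 < e / 2 by rewrite divr_gt0.
  have [N hN] := geom_small (K / (1 - r)) r0 r1 e2.
  exists N => m n Nm Nn; apply: le_lt_trans (rn_tri (u N) _ _) _.
  have lt2 k : (N <= k)%N -> rn (u k - u N) < e / 2.
    by move=> Nk; rewrite -(subnKC Nk); apply: le_lt_trans (bnd _ _) (hN _ _).
  by rewrite [e]splitr ltrD ?lt2 // rn_distC lt2.
exists l; split => //; apply/ler_addgt0Pr => e e0; have [N hN] := hl e e0.
apply: le_trans (rn_tri (u N) _ _) _; rewrite addrC lerD //.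
  by apply: le_trans (bnd 0%N N) _; rewrite expr0 mulr1.
by apply: ltW; apply: hN.
Qed.

(** The last clause does the work of uniqueness: self-adjointness and commutation relations of the
    fixed point are read off from it, with [D'] the closed set of elements having the property. *)
Lemma banach_fix (V : completeNormedModType R[i]) (F : V -> V) (D : set V)
    (x0 : V) (r : R) : closed D -> D x0 -> (forall x, D x -> D (F x)) ->
  0 <= r -> r < 1 ->
  (forall x y, D x -> D y -> rn (F x - F y) <= r * rn (x - y)) ->
  exists l, [/\ D l, F l = l &
    forall D', closed D' -> D' x0 -> (forall x, D' x -> D' (F x)) -> D' l].
Proof.
move=> cD Dx0 DF r0 r1 lip; pose u n := iter n F x0.
have Du n : D (u n) by elim: n => //= n; apply: DF.
have h n : rn (u n.+1 - u n) <= rn (F x0 - x0) * r ^+ n.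
  elim: n => [|n ih]; first by rewrite mulr1.
  apply: le_trans (lip (u n.+1) (u n) (Du _) (Du _)) _.
  by rewrite exprS mulrCA ler_wpM2l.
have [l [hl _]] := geom_cauchy r0 r1 h.
have lim D' : closed D' -> D' x0 -> (forall x, D' x -> D' (F x)) -> D' l.
  move=> cD' D'0 D'F.
  apply: (proj1 (closed_rn _) cD') => e /hl [N hN].
  exists (u N); last exact: hN.
  by elim: (N) => //= n; apply: D'F.
have Dl : D l by apply: lim.
exists l; split => //; apply/eqP; rewrite -subr_eq0; apply/eqP.
apply: (@rn_small R _ _ 2) => e /hl [N hN].
apply: le_trans (rn_tri (u N.+1) _ _) _.
rewrite mulr_natl mulr2n; apply: lerD.
  apply: le_trans (lip _ _ Dl (Du N)) _; apply: le_trans (_ : 1 * rn (l - u N) <= _).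
    by rewrite ler_wpM2r ?rn_ge0 // ltW.
  by rewrite mul1r ltW // hN.
by rewrite rn_distC ltW // hN.
Qed.

Lemma closed_lip (V W : normedModType R[i]) (L : V -> W) (c : W) (K : R) :
  (forall x y, rn (L x - L y) <= K * rn (x - y)) -> closed [set x | L x = c].
Proof.
move=> h; apply/closed_rn => v hv /=; apply/eqP; rewrite -subr_eq0; apply/eqP.
apply: (@rn_small R _ _ `|K|) => e /hv [x /= <- vx].
apply: le_trans (h _ _) _; apply: le_trans (_ : `|K| * rn (v - x) <= _).
  by rewrite ler_wpM2r ?rn_ge0 // ler_norm.
by rewrite ler_wpM2l // ltW.
Qed.

Lemma closed_rn_le (V W : normedModType R[i]) (L : V -> W) (c K : R) :
  (forall x y, rn (L x - L y) <= K * rn (x - y)) -> closed [set x | rn (L x) <= c].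
Proof.
move=> h; apply/closed_rn => v hv /=; apply/ler_addgt0Pr => e e0.
have K1 : 0 < `|K| + 1 by rewrite ltr_wpDl.
have [|x /= xc vx] := hv (e / (`|K| + 1)); first by rewrite divr_gt0.
apply: le_trans (rn_sub _ (L x)) _; apply: lerD => //.
apply: le_trans (h _ _) _; apply: le_trans (_ : (`|K| + 1) * rn (v - x) <= _).
  by rewrite ler_wpM2r ?rn_ge0 // (le_trans (ler_norm K)) // lerDl.
by rewrite mulrC -ler_pdivlMr // ltW.
Qed.

End CompleteFixpoint.

Section CstarBasics.
Context {R : realType}.
Implicit Types A : cstarType R.

Section Arith.
Variable A : cstarType R.
Implicit Types (x y z : A) (a : R[i]).

Fact amul_linl z : linear (fun x => x ** z). Proof. by move=> a x y; apply: amulPl. Qed.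
Fact amul_linr z : linear (fun x => z ** x). Proof. by move=> a x y; apply: amulPr. Qed.

Lemma amulDl x y z : (x + y) ** z = x ** z + y ** z. Proof. exact: (linD (amul_linl z)). Qed.
Lemma amulDr x y z : x ** (y + z) = x ** y + x ** z. Proof. exact: (linD (amul_linr x)). Qed.
Lemma amulZl a x y : (a *: x) ** y = a *: (x ** y). Proof. exact: (linZ (amul_linl y)). Qed.
Lemma amulZr a x y : x ** (a *: y) = a *: (x ** y). Proof. exact: (linZ (amul_linr x)). Qed.
Lemma amulNl x y : (- x) ** y = - (x ** y). Proof. exact: (linN (amul_linl y)). Qed.
Lemma amulNr x y : x ** (- y) = - (x ** y). Proof. exact: (linN (amul_linr x)). Qed.
Lemma amul0l x : 0 ** x = 0. Proof. exact: (lin0 (amul_linl x)). Qed.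
Lemma amul0r x : x ** 0 = 0. Proof. exact: (lin0 (amul_linr x)). Qed.
Lemma amulBl x y z : (x - y) ** z = x ** z - y ** z. Proof. exact: (linB (amul_linl z)). Qed.
Lemma amulBr x y z : x ** (y - z) = x ** y - x ** z. Proof. exact: (linB (amul_linr x)). Qed.

Lemma amul_suml I (r : seq I) (F : I -> A) y :
  (\sum_(i <- r) F i) ** y = \sum_(i <- r) F i ** y.
Proof. exact: (lin_sum (amul_linl y)). Qed.
Lemma amul_sumr I (r : seq I) (F : I -> A) y :
  y ** (\sum_(i <- r) F i) = \sum_(i <- r) y ** F i.
Proof. exact: (lin_sum (amul_linr y)). Qed.

Lemma star0 : star (0 : A) = 0.
Proof. by have := starP (-1) (0 : A) 0; rewrite scaler0 addr0 rmorphN1 scaleN1r addNr. Qed.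
Lemma starD x y : star (x + y) = star x + star y.
Proof. by have := starP 1 x y; rewrite rmorph1 !scale1r. Qed.
Lemma starZ a x : star (a *: x) = a^* *: star x.
Proof. by have := starP a x 0; rewrite star0 !addr0. Qed.
Lemma starN x : star (- x) = - star x.
Proof. by rewrite -scaleN1r starZ rmorphN1 scaleN1r. Qed.
Lemma starB x y : star (x - y) = star x - star y.
Proof. by rewrite starD starN. Qed.
Lemma starZr (r : R) x : star (r%:C *: x) = r%:C *: star x.
Proof. by rewrite starZ; congr (_ *: _); apply: conj_realC. Qed.
Lemma star_sum I (r : seq I) (F : I -> A) :
  star (\sum_(i <- r) F i) = \sum_(i <- r) star (F i).
Proof. by elim: r => [|i r ih]; rewrite ?big_nil ?big_cons ?star0 // starD ih. Qed.

Lemma rn_amul x y : rn (x ** y) <= rn x * rn y.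
Proof. by rewrite -lecR rmorphM /= -!rnE norm_amul. Qed.

Lemma rn_star_amul x : rn (star x ** x) = rn x ^+ 2.
Proof. by apply: (@complexI R); rewrite rmorphXn /= -!rnE norm_star_amul. Qed.

Lemma rn_star x : rn (star x) = rn x.
Proof.
suff h y : rn y <= rn (star y) by apply/eqP; rewrite eq_le h -{2}[x]starK h.
have [->|/eqP /rn_gt0 y0] := eqVneq y 0; first by rewrite star0.
by rewrite -(ler_pM2r y0) -expr2 -rn_star_amul rn_amul.
Qed.

Lemma rn_amul_star x : rn (x ** star x) = rn x ^+ 2.
Proof. by rewrite -{1}[x]starK rn_star_amul rn_star. Qed.

Definition amulE := (amulDl, amulDr, amulNl, amulNr, amulZl, amulZr, @amulA R A).
End Arith.

Section Unital.
Variable A : unitalCstarType R.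
Implicit Types x y : A.

Lemma star1 : star (aone : A) = aone.
Proof. by rewrite -[LHS]amula1 -{2}[aone]starK -starM amula1 starK. Qed.

Lemma rn_aone : rn (aone : A) <= 1.
Proof.
have := rn_star_amul (aone : A); rewrite star1 amul1a => h.
have [->|/eqP /rn_gt0 y0] := eqVneq (aone : A) 0; first by rewrite rn0.
by rewrite -(ler_pM2r y0) -expr2 -h mul1r.
Qed.

End Unital.

(** [g] is 1 - sqrt(1 - h), written without a unit: 2g - g^2 = h makes [g] a fixed point of x |-> (h
    + x^2)/2, a contraction of the ball of radius |h| < 1. The clause on [D] lets [g] inherit closed
    properties of the iterates. *)
Lemma sqrt_cstar A (h : A) : star h = h -> rn h < 1 ->
  exists g : A, [/\ star g = g, g + g - g ** g = h, rn g <= rn h &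
    forall D : set A, closed D -> D 0 ->
      (forall x, D x -> D (2^-1 *: (h + x ** x))) -> D g].
Proof.
move=> hs h1; pose F x : A := 2^-1 *: (h + x ** x).
have n2 : rn (2^-1 : R[i]) = 2^-1.
  have -> : 2^-1 = (2^-1 : R)%:C by rewrite fmorphV rmorphMn.
  by rewrite rn_real ger0_norm.
have h0 := rn_ge0 h.
have [||x|x y|g [gh Fg gD]] :=
  @banach_fix R A F [set x | rn x <= rn h] 0 (rn h) _ _ _ h0 h1.
- by apply: (@closed_rn_le R A A id _ 1) => x y; rewrite mul1r.
- by rewrite /= rn0.
- rewrite /= => xh; rewrite rnZ n2 ler_pdivrMl //.
  apply: le_trans (rnD _ _) _; rewrite mulr2n mulrDl mul1r lerD2l.
  apply: le_trans (rn_amul _ _) _; apply: le_trans (_ : 1 * rn h <= _); last by rewrite mul1r.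
  by apply: ler_pM; rewrite ?rn_ge0 // (le_trans xh) // ltW.
- rewrite /= => xh yh; rewrite /F -scalerBr rnZ n2 ler_pdivrMl //.
  have -> : h + x ** x - (h + y ** y) = x ** (x - y) + (x - y) ** y.
    by rewrite !amulE; lmod.
  apply: le_trans (rnD _ _) _; rewrite mulrA mulr2n mulrDl mul1r mulrDl.
  apply: lerD; apply: le_trans (rn_amul _ _) _; first by rewrite ler_wpM2r ?rn_ge0.
  by rewrite mulrC ler_wpM2r ?rn_ge0.
exists g; split => //.
- apply: (gD [set x | star x = x]).
  + rewrite (_ : mkset _ = [set x : A | x - star x = 0]); last first.
      by apply/seteqP; split => x /= => [->|/eqP]; rewrite ?subrr // subr_eq0 => /eqP <-.
    apply: (@closed_lip R A A _ 0 2) => x y.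
    have -> : x - star x - (y - star y) = (x - y) - star (x - y) by rewrite starB; lmod.
    by apply: le_trans (rnB _ _) _; rewrite rn_star mulr_natl mulr2n.
  + exact: star0.
  + move=> x /= xs; rewrite starZ starD starM xs hs fmorphV rmorph_nat //.
- have /eqP : g + g = h + g ** g.
    transitivity (F g + F g); first by rewrite Fg.
    have e : 2^-1 + 2^-1 = 1 :> R[i] by rewrite -div1r -splitr.
    by rewrite /F -scalerDl e scale1r.
  by move/eqP => e; rewrite e addrK.
Qed.

End CstarBasics.

(* V = p + i q is unitary for the A-valued inner product (x, y) |-> x^* y. *)
Section AdjointableOperators.
Context {R : realType} (A : cstarType R) (p q : A -> A).
Hypotheses (lp : linear p) (lq : linear q).
Hypotheses (ps : forall x y, star (p x) ** y = star x ** p y)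
           (qs : forall x y, star (q x) ** y = star x ** q y).
Hypotheses (pq : forall x, p (q x) = q (p x))
           (pq1 : forall x, p (p x) + q (q x) = x).

Let V (s : R[i]) x := p x + s *: q x.

Let VV (s t : R[i]) x : V s (V t x) = p (p x) + (s * t) *: q (q x) + (s + t) *: q (p x).
Proof. by rewrite /V (linD lp) (linD lq) (linZ lp) (linZ lq) pq; lmod. Qed.

Let rnV (s : R[i]) x : s ^+ 2 = -1 -> s^* = - s -> rn (V s x) = rn x.
Proof.
move=> s2 sc; apply/eqP; rewrite -(@eqrXn2 _ 2) ?rn_ge0 // -!rn_star_amul.
have -> : star (V s x) ** V s x = star x ** V (- s) (V s x).
  rewrite /V starD starZ sc amulDl amulZl ps qs.
  by rewrite (linD lp) (linD lq) (linZ lp) (linZ lq) !amulE; rewrite ?amulDr ?amulZr; lmod.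
rewrite VV addNr scale0r addr0 mulNr -expr2 s2 opprK scale1r pq1 //.
Qed.

Let mi2 : (- 'i : R[i]) ^+ 2 = -1. Proof. by rewrite sqrrN sqr_i. Qed.
Let mic : (- 'i : R[i])^* = - - 'i. Proof. by rewrite rmorphN /= conj_i. Qed.

(** [V 'i] and [V (- 'i)] are isometric and adjoint to each other; p is half their sum, and p^2 -
    q^2 in the next lemma is half the sum of their squares. *)
Lemma adjointable_contraction x : rn (p x) <= rn x.
Proof.
suff : rn (p x *+ 2) <= rn x *+ 2 by rewrite rnMn ler_pMn2r.
have -> : p x *+ 2 = V 'i x + V (- 'i) x by rewrite /V; lmod.
by apply: le_trans (rnD _ _) _; rewrite !rnV // ?sqr_i ?conj_i.
Qed.

Lemma adjointable_reflection x : rn (p (p x) - q (q x)) <= rn x.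
Proof.
suff : rn ((p (p x) - q (q x)) *+ 2) <= rn x *+ 2 by rewrite rnMn ler_pMn2r.
have -> : (p (p x) - q (q x)) *+ 2 = V 'i (V 'i x) + V (- 'i) (V (- 'i) x).
  by rewrite !VV mulrNN -expr2 sqr_i; lmod.
by apply: le_trans (rnD _ _) _; rewrite !rnV // ?sqr_i ?conj_i.
Qed.

End AdjointableOperators.

(** * Norm bounds for functions of a self-adjoint element *)

Section UnitaryTrick.
Context {R : realType}.

Lemma rn_self_sqr (A : cstarType R) (a : A) : star a = a -> rn (a ** a) = rn a ^+ 2.
Proof. by move=> sa; rewrite -{1}sa rn_star_amul. Qed.

(** The hypotheses on [D] in [sqrt_cstar], for the commutant of [y]: what commutes with [h] commutes
    with the root. *)
Lemma commute_closed (A : cstarType R) (y h : A) : y ** h = h ** y ->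
  let D := [set x | y ** x = x ** y] in
  [/\ closed D, D 0 & forall x, D x -> D (2^-1 *: (h + x ** x))].
Proof.
move=> yh D; split.
- rewrite (_ : D = [set x | y ** x - x ** y = 0]); last first.
    by apply/seteqP; split => x /= => [->|/eqP]; rewrite ?subrr // subr_eq0 => /eqP.
  apply: (@closed_lip R A A _ 0 (rn y + rn y)) => x z.
  have -> : y ** x - x ** y - (y ** z - z ** y) = y ** (x - z) - (x - z) ** y.
    by rewrite amulBl amulBr; lmod.
  apply: le_trans (rnB _ _) _; rewrite mulrDl lerD ?rn_amul // mulrC rn_amul //.
- by rewrite /D /= amul0l amul0r.
- move=> x; rewrite /D /= => yx; rewrite amulZl amulZr amulDl amulDr yh.
  by rewrite amulA yx -amulA yx amulA.
Qed.

(** Here p = 1 - g = sqrt(1 - a^2) and q = a, so p^2 - q^2 = 1 - 2a^2. This inequality supplies what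
    the spectral theorem would: resolvents of a^2 in an algebra without unit, and positivity of
    squares. *)
Lemma rn_sub_sqr (A : cstarType R) (a x : A) : star a = a -> rn a < 1 ->
  rn (x - (a ** a ** x) *+ 2) <= rn x.
Proof.
move=> sa a1.
have [||g [sg gE _ gD]] := @sqrt_cstar R A (a ** a).
- by rewrite starM sa.
- by rewrite rn_self_sqr // expr_lt1 ?rn_ge0.
have ag : a ** g = g ** a.
  have [|c1 c2 c3] := @commute_closed A a (a ** a); first by rewrite amulA.
  exact: (gD _ c1 c2 c3).
pose p (x : A) := x - g ** x; pose q x := a ** x.
have -> : x - (a ** a ** x) *+ 2 = p (p x) - q (q x).
  have : (g + g - g ** g) ** x = a ** a ** x by rewrite gE.
  rewrite /p /q !amulE => <-; lmod.
apply: adjointable_reflection.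
- by move=> b y z; rewrite /p amulDr amulZr; lmod.
- by move=> b y z; rewrite /q amulDr amulZr.
- by move=> y z; rewrite /p starB starM sg amulBl amulBr amulA.
- by move=> y z; rewrite /q starM sa amulA.
- by move=> y; rewrite /p /q amulBr !amulA ag.
- move=> y; have : (g + g - g ** g) ** y = a ** a ** y by rewrite gE.
  by rewrite /p /q !amulE => <-; lmod.
Qed.

End UnitaryTrick.

(** * Approximate units *)

Lemma mulr2_inj (R : realType) (V : lmodType R[i]) (x y : V) :
  x *+ 2 = y *+ 2 -> x = y.
Proof.
move=> /(congr1 (fun z => (2^-1 : R[i]) *: z)).
have e : 2^-1 + 2^-1 = 1 :> R[i] by rewrite -div1r -splitr.
by rewrite !mulr2n !scalerDr -!scalerDl e !scale1r.
Qed.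

Section ApproximateUnit.
Context {R : realType} (A : cstarType R).
Implicit Types (x y c e k : A).

Lemma closed_sa : closed [set x : A | star x = x].
Proof.
rewrite (_ : mkset _ = [set x : A | x - star x = 0]); last first.
  by apply/seteqP; split => x /= => [->|/eqP]; rewrite ?subrr // subr_eq0 => /eqP <-.
apply: (@closed_lip R A A _ 0 2) => x y.
have -> : x - star x - (y - star y) = (x - y) - star (x - y) by rewrite starB; lmod.
by apply: le_trans (rnB _ _) _; rewrite rn_star mulr_natl mulr2n.
Qed.

(* With [a = c c^*] suitably scaled and [k = a^2], this is [e = k / (eps + k)]. *)
Lemma left_unit1 (c : A) (eta : R) : 0 < eta ->
  exists e, [/\ star e = e, forall x, rn (x - e ** x) <= rn x &
    rn (c - e ** c) <= eta].
Proof.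
move=> eta0.
(* [d] scales c c^* to norm below 1, as [rn_sub_sqr] requires. *)
pose d : R := (rn c ^+ 2 + 1)^-1.
have d0 : 0 < d by rewrite invr_gt0 ltr_wpDl ?sqr_ge0.
pose h := c ** star c; pose a := d%:C *: h; pose k := a ** a.
have sa : star a = a by rewrite /a starZr /h starM starK.
have sk : star k = k by rewrite /k starM sa.
have kE : k = a ** a by [].
have a1 : rn a < 1.
  rewrite /a rnZr gtr0_norm // /h rn_amul_star /d mulrC ltr_pdivrMr ?mul1r ?ltrDl //.
  by rewrite ltr_wpDl ?sqr_ge0.
(* [t] and [eps] are dictated by the final estimate, which uses [sq] twice: |a - e a|^2 <= 3 |k - e
   k| = 3 eps |e| <= 6 eps = t^2, and then |c - e c|^2 <= 3 |h - e h| <= 3 t / d = eta^2. *)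
pose t : R := eta ^+ 2 * d / 3.
have t0 : 0 < t by rewrite divr_gt0 // mulr_gt0 // exprn_gt0.
pose eps : R := t ^+ 2 / 6.
have e0 : 0 < eps by rewrite divr_gt0 // exprn_gt0.
have e1 : 0 < 1 + 2 * eps by rewrite ltr_wpDl // mulr_gt0.
have epsE : eps = t ^+ 2 / 6 by [].
clearbody eps.
have W x : rn (x - x ** k *+ 2) <= rn x.
  rewrite -rn_star -[leRHS]rn_star starB -scaler_nat starZ starM sk rmorph_nat scaler_nat.
  exact: rn_sub_sqr.
clearbody k.
(* A fixed point of [F] satisfies eps e = k - e k. By [W] the map x |-> x - 2 x k has norm at most
   1, which leaves the contraction factor 1 / (1 + 2 eps). *)
pose F x : A := ((1 + 2 * eps)^-1)%:C *: (x - x ** k *+ 2 + k *+ 2).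
have [|//|//||||e [_ Fe eD]] :=
    @banach_fix R A F setT 0 ((1 + 2 * eps)^-1).
- exact: closedT.
- by rewrite invr_ge0 ltW.
- by rewrite invf_lt1 // ltrDl mulr_gt0.
- move=> x y _ _; rewrite /F -scalerBr rnZr gtr0_norm ?invr_gt0 // ler_pM2l ?invr_gt0 //.
  apply: le_trans (W (x - y)); rewrite le_eqVlt; apply/orP; left; apply/eqP; congr rn.
  by rewrite amulBl; lmod.
have [kc k0 kF] := @commute_closed R A k k erefl.
have [sea ke] : star e = e /\ k ** e = e ** k.
  apply: (eD [set x | star x = x /\ k ** x = x ** k]).
  - by rewrite (_ : mkset _ = [set x | star x = x] `&` [set x | k ** x = x ** k]) //;
      apply: closedI => //; exact: closed_sa.
  - by split; rewrite ?star0 ?amul0l ?amul0r.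
  - move=> x [sx kx]; split; rewrite /F.
      rewrite starZr; congr (_ *: _).
      by rewrite !mulr2n !(starD, starN) starM sk sx kx.
    rewrite amulZl amulZr; congr (_ *: _).
    by rewrite !mulr2n !(amulDl, amulDr, amulNl, amulNr) !amulA kx.
have eE : eps%:C *: e = k - e ** k.
  have : (1 + 2 * eps)%:C *: e = e - e ** k *+ 2 + k *+ 2.
    by rewrite -{1}Fe /F scalerA -rmorphM /= mulfV ?gt_eqF // scale1r.
  have -> : (1 + 2 * eps)%:C *: e = e + (eps%:C *: e) *+ 2.
    by rewrite rmorphD rmorphM rmorph1 rmorph_nat; lmod.
  move=> E; have : (eps%:C *: e) *+ 2 = (k - e ** k) *+ 2.
    by apply: (addrI e); rewrite E; lmod.
  exact: mulr2_inj.
have cr x : rn (x - x ** e) <= rn x.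
  have E : (1 + 2 * eps)%:C *: (x - x ** e) =
      (2 * eps)%:C *: x + ((x - x ** e) - (x - x ** e) ** k *+ 2).
    have : x ** (eps%:C *: e) = x ** (k - e ** k) by rewrite eE.
    rewrite !amulE rmorphD !rmorphM rmorph1 rmorph_nat => E.
    transitivity (x + (2%:R * eps%:C) *: x - x ** e - (eps%:C *: (x ** e)) *+ 2).
      by lmod.
    by rewrite E; lmod.
  have := congr1 (@rn R A) E; rewrite rnZr gtr0_norm // => E'.
  have hh : (1 + 2 * eps) * rn (x - x ** e) <= 2 * eps * rn x + rn (x - x ** e).
    rewrite E'; apply: le_trans (rnD _ _) _; rewrite rnZr gtr0_norm ?mulr_gt0 //.
    by rewrite lerD2l W.
  by move: hh; move: (rn _) (rn _) => u v; nra.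
have cl x : rn (x - e ** x) <= rn x.
  by have := cr (star x); rewrite -{1}sea -starM -starB !rn_star.
have e2 : rn e <= 2.
  have [->|/eqP /rn_gt0 p] := eqVneq e 0; first by rewrite rn0.
  rewrite -(ler_pM2r p) -expr2 -rn_star_amul.
  apply: le_trans (rn_sub _ (star e)) _.
  rewrite rn_distC; have := cr (star e); rewrite !rn_star; lra.
(* The square of |(1 - e) y| is the norm of (1 - e) y y^* (1 - e); the last factor costs 1 + |e| <=
   3. *)
have sq y : rn (y - e ** y) ^+ 2 <= 3 * rn (y ** star y - e ** (y ** star y)).
  rewrite -rn_amul_star starB starM sea.
  have -> : (y - e ** y) ** (star y - star y ** e) =
    (y ** star y - e ** (y ** star y)) - (y ** star y - e ** (y ** star y)) ** e.
    by rewrite !amulE; lmod.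
  apply: le_trans (rnB _ _) _.
  have := rn_amul (y ** star y - e ** (y ** star y)) e.
  have := rn_ge0 (y ** star y - e ** (y ** star y)).
  move: (rn _) (rn (_ ** e)) (rn e) e2 => u v w; nra.
exists e; split => //.
have /= h1 := sq a.
have : rn (a - e ** a) ^+ 2 <= t ^+ 2.
  apply: le_trans h1 _; rewrite sa -kE -eE rnZr gtr0_norm // epsE.
  move: e2 (sqr_ge0 t); move: (rn e) (t ^+ 2) => u v; nra.
rewrite ler_pXn2r ?nnegrE ?rn_ge0 ?(ltW t0) // => h2.
rewrite -(@ler_pXn2r _ 2) ?nnegrE ?rn_ge0 ?(ltW eta0) //.
apply: le_trans (sq c) _; rewrite -/h.
have : rn (a - e ** a) = d * rn (h - e ** h).
  by rewrite /a amulZr -scalerBr rnZr gtr0_norm.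
move=> h3; move: h2; rewrite h3 /t => h2.
rewrite -(ler_pM2l d0); move: (rn _) (eta ^+ 2) h2 => u v; nra.
Qed.

(** Since 1 - (f + e - f e) = (1 - f)(1 - e), an [f] made for c - e c adds [c] to the list, and 1 -
    f being a contraction keeps the earlier elements. *)
Lemma left_units (s : seq A) (eta : R) : 0 < eta ->
  exists e, [/\ forall x, rn (x - e ** x) <= rn x,
    forall x, rn (x - x ** e) <= rn x &
    forall c, c \in s -> rn (c - e ** c) <= eta].
Proof.
move=> eta0; elim: s => [|c s [e [el er es]]].
  by exists 0; split => // x; rewrite ?amul0l ?amul0r subr0.
have [f [sf fl fc]] := left_unit1 (c - e ** c) eta0.
have fr x : rn (x - x ** f) <= rn x.
  by have := fl (star x); rewrite -{1}sf -starM -starB !rn_star.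
have E x : x - (f + e - f ** e) ** x = (x - e ** x) - f ** (x - e ** x).
  by rewrite !amulE; lmod.
have E' x : x - x ** (f + e - f ** e) = (x - x ** f) - (x - x ** f) ** e.
  by rewrite !amulE; lmod.
exists (f + e - f ** e); split=> [x|x|x].
- by rewrite E; apply: le_trans (fl _) (el _).
- by rewrite E'; apply: le_trans (er _) (fr _).
- rewrite inE E => /orP[/eqP -> //|xs].
  by apply: le_trans (fl _) (es _ xs).
Qed.

(** The same product (1 - star f)(1 - e), with [e] a left unit for [s] and [f] one for the adjoints
    of [s]. The bound 2 comes from |g|^2 = |g g^*| <= |g^*| + |g^* - g g^*| <= 2 |g|. *)
Lemma approximate_unit (s : seq A) (eta : R) : 0 < eta ->
  exists e, rn e <= 2 /\
    forall c, c \in s -> rn (c - e ** c) <= eta /\ rn (c - c ** e) <= eta.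
Proof.
move=> eta0; have [e [el er es]] := left_units s eta0.
have [f [fl fr fs]] := left_units (map star s) eta0.
pose f' := star f.
have E x : x - (f' + e - f' ** e) ** x = (x - e ** x) - f' ** (x - e ** x).
  by rewrite !amulE; lmod.
have E' x : x - x ** (f' + e - f' ** e) = (x - x ** f') - (x - x ** f') ** e.
  by rewrite !amulE; lmod.
have starf x : rn (x - f' ** x) = rn (star x - star x ** f).
  by rewrite -rn_star starB starM starK.
pose g := f' + e - f' ** e; have gl x : rn (x - g ** x) <= rn x.
  by rewrite E starf; apply: le_trans (fr _) _; rewrite rn_star.
have g2 : rn g ^+ 2 <= 2 * rn g.
  rewrite -rn_amul_star; apply: le_trans (rn_sub _ (star g)) _.
  by rewrite rn_distC rn_star mulr_natl mulr2n lerD2l -[leRHS]rn_star.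
exists g; split.
  have [->|/eqP /rn_gt0 g0] := eqVneq g 0; first by rewrite rn0.
  by rewrite -(ler_pM2r g0) -expr2.
move=> c cs; split; rewrite ?E ?E'.
  by rewrite starf; apply: le_trans (fr _) _; rewrite rn_star es.
apply: le_trans (er _) _.
by rewrite -rn_star starB starM starK; apply/fs/map_f.
Qed.

End ApproximateUnit.

(** * Positivity *)

Section Positivity.
Context {R : realType} (A : unitalCstarType R).
Implicit Types (a b x y z k h : A) (r s t l : R).

Definition sc r : A := r%:C *: aone.

Lemma sc_mull r x : sc r ** x = r%:C *: x.
Proof. by rewrite /sc amulZl amul1a. Qed.

Lemma sc_mulr r x : x ** sc r = r%:C *: x.
Proof. by rewrite /sc amulZr amula1. Qed.

Lemma star_sc r : star (sc r) = sc r.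
Proof. by rewrite /sc starZr star1. Qed.

Lemma scD r s : sc (r + s) = sc r + sc s.
Proof. by rewrite /sc; lmod. Qed.

Lemma rn_sc r : rn (sc r) <= `|r|.
Proof. by rewrite /sc rnZr ler_piMr // rn_aone. Qed.

Lemma rn_sc0 r : 0 <= r -> rn (sc r) <= r.
Proof. by move=> r0; apply: le_trans (rn_sc r) _; rewrite ger0_norm. Qed.

(** The norm form of positivity: the spectrum lies in [0, 2l]. Sums are immediate with it, whereas
    positivity of x^* x becomes a theorem, [nonneg_star_mul]. *)
Definition nonneg a := star a = a /\ exists2 l, 0 <= l & rn (sc l - a) <= l.

Definition inverses a z := a ** z = aone /\ z ** a = aone.

Lemma inverse_uniq a z z' : z ** a = aone -> a ** z' = aone -> z = z'.
Proof. by move=> h h'; rewrite -[z]amula1 -h' amulA h amul1a. Qed.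

Lemma inverse_sa a z : star a = a -> inverses a z -> star z = z.
Proof.
move=> sa [az za]; apply: (@inverse_uniq a); last exact: az.
by rewrite -{1}sa -starM az star1.
Qed.

Lemma inverse_comm a z y : inverses a z -> y ** a = a ** y -> y ** z = z ** y.
Proof.
move=> [az za] ya; rewrite -[y ** z]amul1a -za -[z ** a ** (y ** z)]amulA.
by rewrite [a ** (y ** z)]amulA -ya -[y ** a ** z]amulA az amula1.
Qed.

Lemma neumann m : rn m < 1 ->
  exists z, inverses (aone - m) z /\ rn z <= (1 - rn m)^-1.
Proof.
move=> m1; have m0 := rn_ge0 m; have m1' : 0 < 1 - rn m by rewrite subr_gt0.
have [|||x y _ _|z [_ Fz zD]] := @banach_fix R A (fun z => aone + m ** z) setT 0
  (rn m) _ _ _ m0 m1.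
- exact: closedT.
- by [].
- by [].
- have -> : aone + m ** x - (aone + m ** y) = m ** (x - y).
    by rewrite amulBr; lmod.
  exact: rn_amul.
have zm : m ** z = z ** m.
  have [cm m00 _] := @commute_closed R A m m erefl.
  apply: (zD [set x | m ** x = x ** m] cm m00) => x /= xm.
  by rewrite amulDr amulDl amula1 amul1a -amulA -xm.
exists z; split.
  by split; rewrite !amulE ?amul1a ?amula1 -?zm -{1}Fz addrK.
rewrite -[leRHS]mul1r ler_pdivlMr // mulrBr mulr1 lerBlDr.
rewrite -{1}Fz; apply: le_trans (rnD _ _) _; rewrite mulrC lerD ?rn_aone ?rn_amul //.
Qed.

Lemma nonnegD a b : nonneg a -> nonneg b -> nonneg (a + b).
Proof.
move=> [sa [l l0 la]] [sb [m m0 mb]]; split; first by rewrite starD sa sb.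
exists (l + m); first exact: addr_ge0.
have -> : sc (l + m) - (a + b) = (sc l - a) + (sc m - b) by rewrite scD; lmod.
by apply: le_trans (rnD _ _) _; rewrite lerD.
Qed.

Lemma nonnegZ r a : 0 <= r -> nonneg a -> nonneg (r%:C *: a).
Proof.
move=> r0 [sa [l l0 la]]; split; first by rewrite starZr sa.
exists (r * l); first exact: mulr_ge0.
have -> : sc (r * l) - r%:C *: a = r%:C *: (sc l - a).
  by rewrite /sc rmorphM /=; lmod.
by rewrite rnZr ger0_norm // ler_wpM2l.
Qed.

Lemma nonneg_near r a : star a = a -> rn a <= r -> nonneg (sc r + a).
Proof.
move=> sa ar; have r0 : 0 <= r by apply: le_trans ar; exact: rn_ge0.
split; first by rewrite starD star_sc sa.
by exists r => //; rewrite opprD addNKr rnN.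
Qed.

Lemma nonneg_sc r : 0 <= r -> nonneg (sc r).
Proof.
by move=> r0; rewrite -[sc r]addr0; apply: nonneg_near; rewrite ?star0 ?rn0.
Qed.

Lemma nonneg_sqr a : star a = a -> nonneg (a ** a).
Proof.
move=> sa; pose c := rn a + 1; have c0 : 0 < c by rewrite ltr_wpDl ?rn_ge0.
pose b := (c^-1)%:C *: a; have sb : star b = b by rewrite starZr sa.
have b1 : rn b < 1.
  by rewrite rnZr gtr0_norm ?invr_gt0 // mulrC ltr_pdivrMr // mul1r ltrDl.
have aE : a ** a = (c ^+ 2 * 2^-1)%:C *: ((b ** b) *+ 2).
  transitivity (((c ^+ 2 * 2^-1) * (c^-1 * c^-1) * 2)%:C *: (a ** a)).
    rewrite (_ : _ * _ * 2 = 1) ?rmorph1 ?scale1r //.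
    by field; rewrite gt_eqF.
  by rewrite /b amulZl amulZr; lmod.
rewrite aE; apply: nonnegZ; first by rewrite mulr_ge0 ?sqr_ge0.
split; first by rewrite mulr2n starD starM sb.
(* [rn_sub_sqr] at the unit: |1 - 2 b^2| <= 1. *)
exists 1 => //; have := @rn_sub_sqr R A b aone sb b1.
by rewrite amula1 /sc rmorph1 scale1r => /le_trans; apply; exact: rn_aone.
Qed.

(** With k = (l - a)/(l + r), of norm below 1 thanks to the margin [r], the root is sqrt(l + r)(1 -
    g), where (1 - g)^2 = 1 - k. *)
Lemma nonneg_sqrt a r : nonneg a -> 0 < r -> exists b, [/\ star b = b,
  b ** b = sc r + a & forall y, y ** a = a ** y -> y ** b = b ** y].
Proof.
move=> [sa [l l0 la]] r0; have lr : 0 < l + r by rewrite ltr_wpDl.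
pose k := ((l + r)^-1)%:C *: (sc l - a).
have sk : star k = k by rewrite starZr starB star_sc sa.
have kE : (l + r)%:C *: k = sc l - a.
  by rewrite scalerA -rmorphM /= mulfV ?gt_eqF // scale1r.
have [//||g [sg gE _ gD]] := @sqrt_cstar R A k.
  rewrite /k rnZr gtr0_norm ?invr_gt0 // mulrC ltr_pdivrMr // mul1r.
  by apply: le_lt_trans la _; rewrite ltrDl.
exists ((Num.sqrt (l + r))%:C *: (aone - g)); split.
- by rewrite starZr starB star1 sg.
- rewrite amulZl amulZr scalerA -rmorphM /= -expr2 sqr_sqrtr ?(ltW lr) //.
  rewrite !amulE amul1a amula1 amul1a.
  transitivity ((l + r)%:C *: aone - (l + r)%:C *: k).
    by rewrite -gE; lmod.
  by rewrite kE -/(sc _) scD; lmod.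
- move=> y ya; have yk : y ** k = k ** y.
    by rewrite /k amulZl amulZr amulBl amulBr ya sc_mull sc_mulr.
  have [c1 c2 c3] := commute_closed yk.
  have yg := gD _ c1 c2 c3; rewrite /= in yg.
  by rewrite amulZl amulZr amulBl amulBr amul1a amula1 yg.
Qed.

(** Let b^2 = d + r + a and c^2 = d + r - a. The multiples p, q of [b], [c] with p^2 + q^2 = 1
    satisfy p^2 - q^2 = a/(r + d), so [adjointable_reflection] at the unit gives |a| <= r + d. *)
Lemma nonneg_bound a r : star a = a -> nonneg (sc r + a) -> nonneg (sc r - a) ->
  0 <= r -> rn a <= r.
Proof.
move=> sa p1 p2 r0; apply/ler_addgt0Pr => d d0.
have [b [sb bE bC]] := nonneg_sqrt p1 d0.
have [c [sc' cE cC]] := nonneg_sqrt p2 d0.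
have rd : 0 < (r + d) * 2 by rewrite mulr_gt0 // ltr_wpDl.
pose s := (Num.sqrt ((r + d) * 2))^-1.
have ss : s ^+ 2 * ((r + d) * 2) = 1.
  by rewrite exprVn sqr_sqrtr ?(ltW rd) // mulVf // gt_eqF.
have cb : c ** b = b ** c.
  apply: bC; rewrite amulDl amulDr sc_mull sc_mulr; congr (_ + _).
  by symmetry; apply: cC; rewrite amulBl amulBr sc_mull sc_mulr.
pose P x := s%:C *: (b ** x); pose Q x := s%:C *: (c ** x).
have : rn (P (P aone) - Q (Q aone)) <= rn (aone : A).
  apply: adjointable_reflection; rewrite /P /Q.
  - by move=> t x y; rewrite amulDr amulZr; lmod.
  - by move=> t x y; rewrite amulDr amulZr; lmod.
  - by move=> x y; rewrite starZr starM sb amulZl amulZr amulA.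
  - by move=> x y; rewrite starZr starM sc' amulZl amulZr amulA.
  - by move=> x; rewrite !amulZr !amulA cb.
  - move=> x; rewrite !amulZr !amulA bE cE !(amulBl, amulDl, sc_mull).
    transitivity ((s ^+ 2 * ((r + d) * 2))%:C *: x); last by rewrite ss scale1r.
    by lmod.
rewrite /P /Q !amulZr !amulA bE cE !amula1.
have -> : s%:C *: (s%:C *: (sc d + (sc r + a))) - s%:C *: (s%:C *: (sc d + (sc r - a))) =
   (s ^+ 2 * 2)%:C *: a by lmod.
have s2 : 0 <= s ^+ 2 * 2 by apply: mulr_ge0; rewrite ?sqr_ge0.
rewrite rnZr ger0_norm // => /le_trans /(_ (rn_aone _)).
rewrite -(ler_pM2l rd) mulr1 => h.
have : (r + d) * 2 * (s ^+ 2 * 2 * rn a) = (s ^+ 2 * ((r + d) * 2)) * (rn a * 2) by ring.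
rewrite ss mul1r => E; move: h; rewrite E ler_pM2r //.
Qed.

(** Half of any bound on the norm is a witness for [nonneg]. Passing to limits requires such a
    uniform choice. *)
Lemma nonneg_half a l : nonneg a -> rn a <= l -> rn (sc (l / 2) - a) <= l / 2.
Proof.
move=> na al; have [sa _] := na; have l0 : 0 <= l by apply: le_trans al; exact: rn_ge0.
have E : sc (l / 2) + sc (l / 2) = sc l by rewrite -scD -splitr.
apply: nonneg_bound; rewrite ?divr_ge0 //.
- by rewrite starB star_sc sa.
- rewrite addrA E -[- a]/(- a); apply: nonneg_near; rewrite ?starN ?sa ?rnN //.
- by rewrite opprB addrC subrK.
Qed.

Lemma nonneg_closure a : star a = a -> (forall e, 0 < e -> nonneg (sc e + a)) -> nonneg a.
Proof.
move=> sa h; split => //; pose l := rn a + 1.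
have l0 : 0 <= l by rewrite addr_ge0 ?rn_ge0.
exists (l / 2); rewrite ?divr_ge0 //.
apply/ler_addgt0Pr => e e0; pose d := Num.min e 1.
have d0 : 0 < d by rewrite lt_min e0 ltr01.
have [d1 de] : d <= 1 /\ d <= e by rewrite !ge_min !lexx orbT.
have h1 : rn (sc (l / 2) - (sc d + a)) <= l / 2.
  apply: nonneg_half; first exact: h.
  apply: le_trans (rnD _ _) _; rewrite addrC lerD2l //.
  by apply: le_trans (rn_sc0 (ltW d0)) _.
apply: le_trans (rn_tri (sc d + a) _ _) _.
apply: lerD => //; rewrite addrK; apply: le_trans (rn_sc0 (ltW d0)) _ => //.
Qed.

(** q = e (e + k)^-1, by a Neumann series; with the factor [e] its norm is at most 1 for every
    [e]. *)
Lemma nonneg_resolvent k e : nonneg k -> 0 < e -> exists q, [/\ rn q <= 1,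
  inverses (sc e + k) ((e^-1)%:C *: q), star q = q & k ** q = q ** k].
Proof.
move=> [sk [l l0 lk]] e0; have le : 0 < l + e by rewrite ltr_wpDl.
pose m := ((l + e)^-1)%:C *: (sc l - k).
have rm : rn m <= l / (l + e).
  by rewrite /m rnZr gtr0_norm ?invr_gt0 // mulrC ler_pM2r ?invr_gt0.
have [|z [[z1 z2] zn]] := @neumann m.
  by apply: le_lt_trans rm _; rewrite ltr_pdivrMr // mul1r ltrDl.
have kE : sc e + k = (l + e)%:C *: (aone - m).
  rewrite /m scalerBr scalerA -rmorphM /= mulfV ?gt_eqF // scale1r.
  by rewrite /sc; lmod.
have ki : inverses (sc e + k) ((e^-1)%:C *: ((e / (l + e))%:C *: z)).
  have -> : (e^-1)%:C *: ((e / (l + e))%:C *: z) = ((l + e)^-1)%:C *: z.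
    by rewrite scalerA -rmorphM /=; congr (_%:C *: _); field; rewrite !gt_eqF.
  rewrite kE; split; rewrite amulZl amulZr ?z1 ?z2 scalerA -rmorphM /=.
    by rewrite mulfV ?gt_eqF // scale1r.
  by rewrite mulVf ?gt_eqF // scale1r.
exists ((e / (l + e))%:C *: z); split => //.
- rewrite rnZr gtr0_norm ?divr_gt0 // mulrC -ler_pdivlMr ?divr_gt0 // mul1r invf_div.
  apply: le_trans zn _; rewrite -[leRHS]invrK lef_pV2 ?posrE ?invr_gt0 ?divr_gt0 //.
    rewrite invf_div; apply: le_trans (_ : 1 - l / (l + e) <= _).
      by rewrite le_eqVlt; apply/orP; left; apply/eqP; field; rewrite gt_eqF.
    by rewrite lerD2l lerN2.
  rewrite subr_gt0; apply: le_lt_trans rm _; rewrite ltr_pdivrMr // mul1r ltrDl //.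
- have := inverse_sa _ ki; rewrite starD star_sc sk starZr => /(_ erefl).
  by apply: scalerI; rewrite (inj_eq (@complexI R) _ 0) invr_eq0 gt_eqF.
- have := @inverse_comm _ _ k ki; rewrite amulDl amulDr sc_mull sc_mulr => /(_ erefl).
  rewrite amulZl amulZr; apply: scalerI.
  by rewrite (inj_eq (@complexI R) _ 0) invr_eq0 gt_eqF.
Qed.

(** With y = (d + a)^-1 one has a - d = (d + a)(1 - 2d y), the square of b (1 - g) where b^2 = d + a
    and (1 - g)^2 = 1 - 2d y. The choice d = 1/(4N) gives |y| <= 2 |z|, hence 2d |y| < 1 and the
    root exists. *)
Lemma nonneg_dec a z : nonneg a -> inverses a z ->
  (forall t, 0 < t -> exists z', inverses (sc t + a) z') ->
  exists2 d, 0 < d & nonneg (a - sc d).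
Proof.
move=> na az inv; have [sa _] := na.
pose N := rn z + 1; have N0 : 0 < N by rewrite ltr_wpDl ?rn_ge0.
pose d := (N * 4)^-1; have d0 : 0 < d by rewrite invr_gt0 mulr_gt0.
have [y ay] := inv d d0; exists d => //.
have dN : d * N = 1 / 4 by rewrite /d; field; rewrite gt_eqF.
have dz : d * rn z <= 1 / 4.
  by rewrite -dN ler_wpM2l ?(ltW d0) // lerDl.
have yz : rn y <= rn z * 2.
  have E : y = z - d%:C *: (z ** y).
    have [_ za] := az; have [ay1 _] := ay.
    rewrite -{1}[y]amul1a -za -amulA.
    have -> : a ** y = aone - d%:C *: y by rewrite -ay1 amulDl sc_mull; lmod.
    by rewrite amulBr amula1 amulZr.
  have : rn y <= rn z + d * (rn z * rn y).
    rewrite {1}E; apply: le_trans (rnB _ _) _; rewrite lerD2l rnZr gtr0_norm //.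
    by rewrite ler_wpM2l ?(ltW d0) ?rn_amul.
  move: (rn_ge0 y) dz; move: (rn y) (rn z) => u v; nra.
have dy : rn ((d * 2)%:C *: y) < 1.
  rewrite rnZr gtr0_norm ?mulr_gt0 //.
  have : d * 2 * rn y <= d * 2 * (rn z * 2) by rewrite ler_wpM2l // mulr_ge0 // ltW.
  have : d * 4 = N^-1 by rewrite /d invfM -mulrA mulVf ?mulr1.
  have : rn z * N^-1 < 1 by rewrite ltr_pdivrMr // mul1r ltrDl.
  move: (N^-1) (rn z) (rn y) => u v w h1 h2 h3; nra.
have ya : a ** y = y ** a.
  by apply: (inverse_comm ay); rewrite amulDl amulDr sc_mull sc_mulr.
have sy : star y = y by apply: (inverse_sa _ ay); rewrite starD star_sc sa.
have [b [sb bE bC]] := nonneg_sqrt na d0.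
have by' : b ** y = y ** b by symmetry; apply: bC; rewrite ya.
have [||g [sg gE _ gD]] := @sqrt_cstar R A ((d * 2)%:C *: y).
- by rewrite starZr sy.
- exact: dy.
have bg : b ** g = g ** b.
  have [|c1 c2 c3] := @commute_closed R A b ((d * 2)%:C *: y).
    by rewrite amulZl amulZr by'.
  exact: (gD _ c1 c2 c3).
have -> : a - sc d = (b ** (aone - g)) ** (b ** (aone - g)).
  have E : (aone - g) ** (aone - g) = aone - (d * 2)%:C *: y.
    by rewrite -gE !amulE amul1a amula1 amul1a; lmod.
  have E' : (aone - g) ** b = b ** (aone - g).
    by rewrite amulBl amulBr bg amul1a amula1.
  rewrite -amulA [(aone - g) ** _]amulA E' -[b ** _ ** (aone - g)]amulA E amulA bE.
  have [ay1 _] := ay.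
  rewrite amulBr amula1 amulZr ay1 rmorphM /= /sc; lmod.
apply: nonneg_sqr; rewrite starM starB star1 sg sb.
by rewrite amulBl amulBr bg amul1a amula1.
Qed.

(** Take the infimum t of the t >= 0 with t + h positive; it is attained. If t > 0 and t + h were
    invertible, [nonneg_dec] would give a smaller one. Failure of positivity thus shows as a
    negative spectral value. *)
Lemma nonneg_or_noninvertible h : star h = h -> nonneg h \/
  exists t, [/\ 0 < t, nonneg (sc t + h) & ~ exists z, inverses (sc t + h) z].
Proof.
move=> sh; pose T := [set t | 0 <= t /\ nonneg (sc t + h)].
have T0 : T (rn h) by split; rewrite ?rn_ge0 //; apply: nonneg_near.
have T1 : has_inf T by split; [exists (rn h)|exists 0 => t []].
pose t := inf T; have t0 : 0 <= t by apply: lb_le_inf => [|x []]; first by exists (rn h).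
have up e : 0 < e -> nonneg (sc (t + e) + h).
  move=> e0; have [s [s0 ns] se] := inf_adherent e0 T1.
  have -> : sc (t + e) + h = sc (t + e - s) + (sc s + h) by rewrite addrA -scD subrK.
  by apply: nonnegD => //; apply: nonneg_sc; rewrite subr_ge0 ltW.
have nt : nonneg (sc t + h).
  apply: nonneg_closure; first by rewrite starD star_sc sh.
  by move=> e /up; rewrite addrA -scD addrC [e + t]addrC addrC.
have [t1|] := ltP 0 t; last first.
  move=> t1; left; have E : t = 0 by apply/eqP; rewrite eq_le t1.
  by move: nt; rewrite E /sc scale0r add0r.
right; exists t; split => // -[z zE].
have [e e0|d d0 nd] := nonneg_dec nt zE.
  have [//|q [q1 q2]] := @nonneg_resolvent (sc t + h) e nt.
  by exists ((e^-1)%:C *: q); case: q2.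
have [dt|dt] := leP d t.
  have : t <= t - d.
    apply: ge_inf; first by exists 0 => x [].
    split; first by rewrite subr_ge0.
    by rewrite (_ : sc (t - d) + h = sc t + h - sc d) // /sc; lmod.
  by rewrite lerBrDr gerDl leNgt d0.
have : t <= 0.
  apply: ge_inf; first by exists 0 => x [].
  split => //; rewrite (_ : sc 0 + h = (sc t + h - sc d) + sc (d - t)).
    by apply: nonnegD => //; apply: nonneg_sc; rewrite subr_ge0 ltW.
  by rewrite /sc; lmod.
by rewrite leNgt t1.
Qed.

(** [a] and [b] are the real and imaginary parts of [y]. *)
Lemma re_im_sqr y : let a := (2^-1)%:C *: (y + star y) in
  let b := (2^-1)%:C *: ('i *: (star y - y)) in
  (a ** a + b ** b) *+ 2 = y ** star y + star y ** y.
Proof.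
move=> a b; have -> : b ** b =
    (2^-1 * 2^-1)%:C *: (- ((star y - y) ** (star y - y))).
  rewrite /b !(amulZl, amulZr) !scalerA scalerN -scaleNr; congr (_ *: _).
  transitivity ((2^-1)%:C * (2^-1)%:C * ('i : R[i]) ^+ 2); first by ring.
  by rewrite sqr_i rmorphM; ring.
transitivity ((2^-1 * 2^-1 * 2 * 2)%:C *: (y ** star y + star y ** y)).
  by rewrite /a !(amulE, amulDr, amulZr); lmod.
by rewrite (_ : _ * 2 = 1) ?rmorph1 ?scale1r //; field.
Qed.

(** The algebraic reason why x y and y x have the same nonzero spectral values. *)
Lemma inverse_swap l x y u : 0 < l -> inverses (sc l + x ** y) u ->
  inverses (sc l + y ** x) ((l^-1)%:C *: (aone - y ** u ** x)).
Proof.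
move=> l0 [u1 u2].
have E1 : x ** y ** u = aone - l%:C *: u by rewrite -u1 amulDl sc_mull; lmod.
have E2 : u ** (x ** y) = aone - l%:C *: u by rewrite -u2 amulDr sc_mulr; lmod.
have lE (v : A) : v = l%:C *: aone -> (l^-1)%:C *: v = aone.
  by move=> ->; rewrite scalerA -rmorphM /= mulVf ?gt_eqF // scale1r.
split; rewrite ?amulZl ?amulZr; apply: lE.
  have F : y ** x ** (y ** u ** x) = y ** x - l%:C *: (y ** u ** x).
    transitivity (y ** (x ** y ** u) ** x); first by rewrite !amulA.
    by rewrite E1 !amulE amula1.
  by rewrite amulBr amula1 amulDl sc_mull F /sc; lmod.
have F : y ** u ** x ** (y ** x) = y ** x - l%:C *: (y ** u ** x).
  transitivity (y ** (u ** (x ** y)) ** x); first by rewrite !amulA.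
  by rewrite E2 !amulE amula1.
by rewrite amulBl amul1a amulDr sc_mulr F /sc; lmod.
Qed.

(** Otherwise k = t + h is positive and singular for some t > 0, and q = e (e + k)^-1 acts as an
    approximate spectral projection of h at -t, with |q| >= 1 because k is singular. For y = x q,
    y^* y = q k q - t q^2 <= 2e, so y y^* = 2(a^2 + b^2) - y^* y >= -2e; exchanging the factors, y^*
    y >= -2e as well, whence |y^* y| <= 2e. Then t <= t |q|^2 <= 4e, and e = t/8 is a
    contradiction. *)
Lemma nonneg_star_mul x : nonneg (star x ** x).
Proof.
pose h := star x ** x; have sh : star h = h by rewrite /h starM starK.
have [//|[t [t0 nk sing]]] := nonneg_or_noninvertible sh.
pose k := sc t + h; pose e := t / 8; have e0 : 0 < e by rewrite divr_gt0.
have [q [q1 [E1 E2] sq qk]] := nonneg_resolvent nk e0.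
have kq : k ** q = e%:C *: (aone - q).
  have : e%:C *: ((sc e + k) ** ((e^-1)%:C *: q)) = e%:C *: aone by rewrite E1.
  rewrite amulZr scalerA -rmorphM /= mulfV ?gt_eqF // scale1r amulDl sc_mull.
  by move=> E; apply: (addrI (e%:C *: q)); rewrite E; lmod.
have qge : 1 <= rn q.
  rewrite leNgt; apply/negP => /neumann [z [[z1 z2] _]]; apply: sing.
  have kz : k ** z = z ** k.
    by apply: (inverse_comm (conj z1 z2)); rewrite amulBl amulBr amul1a amula1 qk.
  have kqz : k ** ((e^-1)%:C *: (q ** z)) = aone.
    rewrite amulZr amulA kq amulZl z1 scalerA -rmorphM /= mulVf ?gt_eqF //.
    by rewrite scale1r.
  exists ((e^-1)%:C *: (q ** z)); split => //.
  by rewrite -[RHS]kqz amulZl amulZr -amulA -kz !amulA qk.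
pose E := q ** k ** q; have sE : star E = E.
  by rewrite /E !starM sq starD star_sc sh amulA.
have rE : rn E <= e * 2.
  rewrite /E -amulA kq amulZr rnZr gtr0_norm // ler_wpM2l ?(ltW e0) //.
  apply: le_trans (rn_amul _ _) _; rewrite -[2]mul1r ler_pM ?rn_ge0 //.
  by apply: le_trans (rnB _ _) _; rewrite -[2]/(1 + 1) lerD ?rn_aone.
pose y := x ** q.
have yy : star y ** y = E - t%:C *: (q ** q).
  rewrite /y starM sq /E /k amulDr amulDl sc_mulr amulZl !amulA addrAC subrr add0r //.
have nq : nonneg (t%:C *: (q ** q)) by apply: nonnegZ (ltW t0) (nonneg_sqr sq).
have nE : nonneg (sc (e * 2) - E) by apply: nonneg_near; rewrite ?starN ?sE ?rnN.
have nyy : nonneg (sc (e * 2) + y ** star y).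
  pose a := (2^-1)%:C *: (y + star y).
  pose b := (2^-1)%:C *: ('i *: (star y - y)).
  have sa : star a = a by rewrite /a starZr starD starK addrC.
  have sb : star b = b.
    by rewrite /b starZr starZ starB starK conj_i scaleNr -scalerN opprB.
  have -> : sc (e * 2) + y ** star y =
    (a ** a + b ** b) *+ 2 + t%:C *: (q ** q) + (sc (e * 2) - E).
    by rewrite re_im_sqr yy; lmod.
  apply: nonnegD => //; apply: nonnegD => //.
  by rewrite mulr2n; do 2!apply: nonnegD; exact: nonneg_sqr.
have ny : nonneg (sc (e * 2) + star y ** y).
  have [|//|[s [s0 ns]]] := @nonneg_or_noninvertible (sc (e * 2) + star y ** y).
    by rewrite starD star_sc starM starK.
  case.
  have [u [_ uE _ _]] := nonneg_resolvent nyy s0.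
  move: uE; rewrite addrA -scD => uE; exists ((s + e * 2)^-1%:C *:
    (aone - star y ** ((s^-1)%:C *: u) ** y)).
  by rewrite addrA -scD; apply: inverse_swap uE; rewrite addr_gt0 ?mulr_gt0.
have ny' : nonneg (sc (e * 2) - star y ** y).
  by rewrite yy opprB addrCA addrC; apply: nonnegD.
have ry : rn (star y ** y) <= e * 2.
  by apply: nonneg_bound => //; rewrite ?starM ?starK // mulr_ge0 // ltW.
have : t * rn q ^+ 2 <= e * 4.
  rewrite -rn_self_sqr // -[t]gtr0_norm // -rnZr.
  have -> : t%:C *: (q ** q) = E - star y ** y by rewrite yy; lmod.
  apply: le_trans (rnB _ _) _; lra.
have : t <= t * rn q ^+ 2 by rewrite ler_pMr // expr_ge1 // rn_ge0.
rewrite /e; lra.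
Qed.

End Positivity.

(** * The Riesz extension theorem *)

Section RieszExtension.
Context {R : realType} (V : lmodType R[i]).
Implicit Types (x y e : V) (r s t : R).
Variables (W P : set V) (G0 : V -> R -> Prop).
Hypotheses (W0 : W 0) (WD : forall x y, W x -> W y -> W (x + y))
  (WZ : forall r x, W x -> W (r%:C *: x)).
Hypotheses (P0 : P 0) (PD : forall x y, P x -> P y -> P (x + y))
  (PZ : forall r x, 0 <= r -> P x -> P (r%:C *: x)).
Hypotheses (G00 : G0 0 0)
  (G0D : forall x y r s, G0 x r -> G0 y s -> G0 (x + y) (r + s))
  (G0Z : forall t x r, G0 x r -> G0 (t%:C *: x) (t * r))
  (G0P : forall x r, G0 x r -> P x -> 0 <= r)
  (G0W : forall x r, G0 x r -> W x)
  (cofinal : forall x, W x -> exists e r, G0 e r /\ P (e - x)).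

(** Partial functionals as graphs. The alternative [A = set0] is there for the empty chain, whose
    union Zorn's lemma also asks about. That a graph is single-valued follows from positivity at
    0. *)
Let good (A : set (V * R)) :=
  [/\ A = set0 \/ (forall x r, G0 x r -> A (x, r)),
     forall x y r s, A (x, r) -> A (y, s) -> A (x + y, r + s),
     forall t x r, A (x, r) -> A (t%:C *: x, t * r),
     forall x r, A (x, r) -> P x -> 0 <= r &
     forall x r, A (x, r) -> W x].

Let good_chain (F : set (set (V * R))) :
  F `<=` good -> total_on F subset -> good (\bigcup_(X in F) X).
Proof.
move=> Fg Ft; split.
- have [[X [FX X0]]|h] := pselect (exists X, F X /\ X <> set0).
    right=> x r xr; exists X => //; have [[//|G _ _ _ _]] := Fg _ FX.
    exact: G.
  left; apply/seteqP; split => // p [X FX Xp]; apply: h; exists X; split => //.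
  by move=> X0; rewrite X0 in Xp.
- move=> x y r s [X FX Xx] [Y FY Yy].
  have [_ XD _ _ _] := Fg _ FX; have [_ YD _ _ _] := Fg _ FY.
  have [XY|YX] := Ft _ _ FX FY.
    by exists Y => //; apply: YD => //; exact: XY.
  by exists X => //; apply: XD => //; exact: YX.
- by move=> t x r [X FX Xx]; exists X => //; have [_ _ XZ _ _] := Fg _ FX; exact: XZ.
- by move=> x r [X FX Xx]; have [_ _ _ XP _] := Fg _ FX; exact: XP Xx.
- by move=> x r [X FX Xx]; have [_ _ _ _ XW] := Fg _ FX; exact: XW Xx.
Qed.

Theorem riesz_extension : exists f : V -> R,
  [/\ forall x y, W x -> W y -> f (x + y) = f x + f y,
      forall r x, W x -> f (r%:C *: x) = r * f x,
      forall x r, G0 x r -> f x = r &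
      forall x, W x -> P x -> 0 <= f x].
Proof.
have [A [Ag Amax]] := Zorn_bigcup good_chain.
have AG x r : G0 x r -> A (x, r).
  have [[A0|h] _ _ _ _] := Ag; last exact: h.
  (* An empty maximal graph would be enlarged by the graph [G0]. *)
  exfalso.
  apply: (Amax [set p | G0 p.1 p.2]); last by split => //; right.
  split; first by rewrite A0.
  by move=> /(_ (0, 0) G00); rewrite A0.
have [_ AD AZ AP AW] := Ag.
have A00 := AG _ _ G00.
have AN x r : A (x, r) -> A (- x, - r).
  by move=> /(AZ (-1)); rewrite rmorphN1 scaleN1r mulN1r.
have Auniq x r s : A (x, r) -> A (x, s) -> r = s.
  have le u v : A (x, u) -> A (x, v) -> v <= u.
    move=> xu /AN xv; have := AD _ _ _ _ xu xv; rewrite subrr => /AP /(_ P0).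
    by rewrite subr_ge0.
  by move=> xr xs; apply/eqP; rewrite eq_le !le.
have Atot x : W x -> exists r, A (x, r).
  move=> Wx; apply: contrapT => nx.
  pose L := [set r | exists2 e, A (e, r) & P (x - e)].
  have ub e u : A (e, u) -> P (e - x) -> ubound L u.
    move=> eu Pex r [e' er' Pxe].
    have := AP _ _ (AD _ _ _ _ eu (AN _ _ er')); rewrite subr_ge0; apply.
    by have := PD Pex Pxe; rewrite addrA subrK.
  have L0 : L !=set0.
    have [|e [r [er Pe]]] := @cofinal (- x).
      by have := WZ (-1) Wx; rewrite rmorphN1 scaleN1r.
    exists (- r), (- e); first exact/AN/AG.
    by rewrite opprK addrC -[x]opprK.
  have [e0 [u0 [/AG eu0 Pe0]]] := cofinal Wx.
  have LS : has_sup L by split => //; exists u0; exact: ub eu0 Pe0.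
  (* [c] lies above every value taken below [x] and, by [ub], below every value taken above [x].
     Scaling by 1/|t| reduces positivity at e + t x to one of these two bounds. *)
  pose c := sup L.
  pose B := [set p : V * R | exists e r t,
    [/\ A (e, r), p.1 = e + t%:C *: x & p.2 = r + t * c]].
  apply: (Amax B).
    split.
      move=> [e r] er; exists e, r, 0.
      by rewrite /= scale0r mul0r !addr0.
    move=> BA; apply: nx; exists c; apply: BA; exists 0, 0, 1.
    by rewrite /= scale1r mul1r !add0r.
  split.
  - right=> y r /AG yr; exists y, r, 0.
    by rewrite /= scale0r mul0r !addr0.
  - move=> y z r s [e [u [t [eu /= -> ->]]]] [e' [u' [t' [eu' /= -> ->]]]].
    exists (e + e'), (u + u'), (t + t'); split; first exact: AD.
      by rewrite /= rmorphD scalerDl addrACA.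
    by rewrite /= mulrDl addrACA.
  - move=> k y r [e [u [t [eu /= -> ->]]]].
    exists (k%:C *: e), (k * u), (k * t); split; first exact: AZ.
      by rewrite /= scalerDr scalerA rmorphM.
    by rewrite /= mulrDr mulrA.
  - move=> y r [e [u [t [eu /= -> ->]]]] Py.
    have [t0|t0|t0] := ltgtP t 0.
    + pose k := (- t)^-1; have k0 : 0 < k by rewrite invr_gt0 oppr_gt0.
      have kt : k * t = -1 by rewrite /k invrN mulNr mulVf // lt_eqF.
      have /(ub _ _ (AZ k _ _ eu)) : P (k%:C *: e - x).
        have := PZ (ltW k0) Py.
        by rewrite scalerDr scalerA -rmorphM /= kt rmorphN1 scaleN1r.
      move=> /(sup_le_ub L0) h.
      rewrite -(pmulr_rge0 _ k0) mulrDr mulrA kt mulN1r subr_ge0 //.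
    + pose k := t^-1; have k0 : 0 < k by rewrite invr_gt0.
      have kt : k * t = 1 by rewrite mulVf // gt_eqF.
      have h : L (- (k * u)).
        exists (- (k%:C *: e)); first exact/AN/AZ.
        have := PZ (ltW k0) Py.
        by rewrite scalerDr scalerA -rmorphM /= kt scale1r opprK addrC.
      have : - (k * u) <= c by apply: ub_le_sup h; case: LS.
      by rewrite -(pmulr_rge0 _ k0) mulrDr mulrA kt mul1r addrC -lerBlDr sub0r.
    + move: Py; rewrite t0 scale0r mul0r !addr0; exact: AP.
  - by move=> y r [e [u [t [eu /= -> _]]]]; apply: WD; [exact: AW eu|exact: WZ].
pose f x := xget 0 [set r | A (x, r)].
have fA x : W x -> A (x, f x).
  by move=> /Atot [r xr]; rewrite /f; case: xgetP => [s -> //|/(_ r)].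
exists f; split.
- move=> x y Wx Wy; apply: (@Auniq (x + y)); first exact/fA/WD.
  by apply: AD; exact: fA.
- move=> r x Wx; apply: (@Auniq (r%:C *: x)); first exact/fA/WZ.
  by apply: AZ; exact: fA.
- move=> x r xr; apply: (@Auniq x); last exact: AG.
  by apply: fA; exact: G0W xr.
- by move=> x Wx; apply: AP; exact: fA.
Qed.

End RieszExtension.

(** * Semi-inner products *)

Section SemiInnerProducts.
Context {R : realType}.

(** Null vectors are allowed: the forms of a state, of a kernel and of the slicing defect may be
    degenerate, and the equality case of the Schwarz inequality is a statement about null
    vectors. *)
Record semiInner (E : lmodType R[i]) := SemiInner {
  sdot :> E -> E -> R[i] ;
  sdotPl : forall a x y z, sdot (a *: x + y) z = a * sdot x z + sdot y z ;
  sdotC : forall x y, sdot y x = (sdot x y)^* ;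
  sdot_ge0 : forall x, 0 <= sdot x x
}.

Section Theory.
Variables (E : lmodType R[i]) (g : semiInner E).
Implicit Types (x y z : E) (a : R[i]).

Lemma sdotDl x y z : g (x + y) z = g x z + g y z.
Proof. by have := sdotPl g 1 x y z; rewrite scale1r mul1r. Qed.
Lemma sdot0l z : g 0 z = 0.
Proof. by apply: (addrI (g 0 z)); rewrite -sdotDl !addr0. Qed.
Lemma sdotZl a x z : g (a *: x) z = a * g x z.
Proof. by have := sdotPl g a x 0 z; rewrite sdot0l !addr0. Qed.
Lemma sdotNl x z : g (- x) z = - g x z.
Proof. by rewrite -scaleN1r sdotZl mulN1r. Qed.
Lemma sdotBl x y z : g (x - y) z = g x z - g y z.
Proof. by rewrite sdotDl sdotNl. Qed.
Lemma sdotDr x y z : g z (x + y) = g z x + g z y.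
Proof. by rewrite sdotC sdotDl rmorphD /= -!sdotC. Qed.
Lemma sdotZr a x z : g z (a *: x) = a^* * g z x.
Proof. by rewrite sdotC sdotZl rmorphM /= -sdotC. Qed.
Lemma sdot0r z : g z 0 = 0.
Proof. by rewrite sdotC sdot0l rmorph0. Qed.
Lemma sdotNr x z : g z (- x) = - g z x.
Proof. by rewrite sdotC sdotNl rmorphN /= -sdotC. Qed.
Lemma sdotBr x y z : g z (x - y) = g z x - g z y.
Proof. by rewrite sdotDr sdotNr. Qed.
Lemma sdot_suml I (r : seq I) (F : I -> E) z :
  g (\sum_(i <- r) F i) z = \sum_(i <- r) g (F i) z.
Proof. by elim: r => [|i r ih]; rewrite ?big_nil ?big_cons ?sdot0l // sdotDl ih. Qed.
Lemma sdot_sumr I (r : seq I) (F : I -> E) z :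
  g z (\sum_(i <- r) F i) = \sum_(i <- r) g z (F i).
Proof. by elim: r => [|i r ih]; rewrite ?big_nil ?big_cons ?sdot0r // sdotDr ih. Qed.

Definition sn x : R := Num.sqrt (complex.Re (g x x)).

Lemma sn_ge0 x : 0 <= sn x. Proof. exact: sqrtr_ge0. Qed.

Lemma sn_sqr x : sn x ^+ 2 = complex.Re (g x x).
Proof. by rewrite sqr_sqrtr // Re_ge0 // sdot_ge0. Qed.

Lemma sdotE x : g x x = (sn x ^+ 2)%:C.
Proof. by rewrite sn_sqr; apply: ReP; exact: sdot_ge0. Qed.

Lemma snZ a x : sn (a *: x) = rn a * sn x.
Proof.
apply/eqP; rewrite -(@eqrXn2 _ 2) ?mulr_ge0 ?sn_ge0 ?rn_ge0 // sn_sqr exprMn.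
by rewrite sdotZl sdotZr mulrA mul_conj sdotE -rmorphM.
Qed.

Lemma snN x : sn (- x) = sn x.
Proof. by rewrite /sn sdotNl sdotNr opprK. Qed.

Lemma sn_sqrD x y : sn (x + y) ^+ 2 = sn x ^+ 2 + sn y ^+ 2 + complex.Re (g x y) *+ 2.
Proof.
rewrite !sn_sqr sdotDl !sdotDr !ReD (sdotC g x y) cRe_conj; ring.
Qed.

Lemma cauchy_schwarz x y : rn (g x y) <= sn x * sn y.
Proof.
have h s : 0 <= sn x ^+ 2 - rn (g x y) ^+ 2 * s *+ 2 +
    s ^+ 2 * rn (g x y) ^+ 2 * sn y ^+ 2.
  have := sqr_ge0 (sn (x - (s%:C * g x y) *: y)).
  rewrite sn_sqrD snN snZ sdotNr sdotZr rmorphM /= conj_realC ReN -mulrA Re_realM.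
  rewrite [X in complex.Re X]mulrC mul_conj /= rnM rn_real !exprMn real_normK ?num_real //.
  by rewrite !mulr2n => /le_trans; apply; rewrite le_eqVlt; apply/orP; left; apply/eqP; ring.
rewrite -(@ler_pXn2r _ 2) ?nnegrE ?mulr_ge0 ?sn_ge0 ?rn_ge0 // exprMn.
move: (rn _ ^+ 2) (sn x ^+ 2) (sn y ^+ 2) (sqr_ge0 (rn (g x y))) (sqr_ge0 (sn x))
  (sqr_ge0 (sn y)) h => m a b m0 a0 b0 h.
(* At s = 1/b the inequality [h] is the claim; for b = 0 it is affine in [s], which forces m = 0. *)
have [b1|b1] := ltP 0 b.
  have := h b^-1; have -> : a - m / b *+ 2 + b^-1 ^+ 2 * m * b = a - m / b.
    by field; rewrite gt_eqF.
  by rewrite subr_ge0 ler_pdivrMr.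
have -> : b = 0 by apply/eqP; rewrite eq_le b1.
rewrite mulr0 leNgt; apply/negP => m1.
have := h ((a + 1) / m); have -> : b = 0 by apply/eqP; rewrite eq_le b1.
rewrite mulr0 addr0 mulrCA mulfV ?gt_eqF // mulr1; lra.
Qed.

Lemma snD x y : sn (x + y) <= sn x + sn y.
Proof.
rewrite -(@ler_pXn2r _ 2) ?nnegrE ?addr_ge0 ?sn_ge0 // sn_sqrD sqrrD.
rewrite [leRHS]addrAC lerD2l lerMn2r /=.
by apply: le_trans (Re_le_rn _) _; exact: cauchy_schwarz.
Qed.

End Theory.
End SemiInnerProducts.

Section HilbertDot.
Context {R : realType} (H : hilbertType R).
Implicit Types (x y z : H).

Fact hdot_linear a x y z : hdot (a *: x + y) z = a * hdot x z + hdot y z.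
Proof. by rewrite linearPl. Qed.
Fact hdotC x y : hdot y x = (hdot x y)^*.
Proof. by rewrite hermC /= expr0 mul1r. Qed.
Fact hdot_ge0 x : 0 <= hdot x x.
Proof. by rewrite -norm_hdot exprn_ge0. Qed.

Definition hd : semiInner H := SemiInner hdot_linear hdotC hdot_ge0.

Lemma hdotE x y : hdot x y = hd x y. Proof. by []. Qed.

Lemma sn_hd x : sn hd x = rn x.
Proof.
by rewrite /sn -hdotE -norm_hdot rnE -rmorphXn /= sqrtr_sqr ger0_norm // rn_ge0.
Qed.

Lemma hd_eq0 x : hd x x = 0 -> x = 0.
Proof.
by move=> h; apply: rn_eq0; rewrite -sn_hd /sn h sqrtr0.
Qed.

End HilbertDot.
Section ComplexLimits.
Context {R : realType}.

Lemma cauchy_complex (u : nat -> R[i]) :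
  (forall e : R, 0 < e -> exists N, forall m n, (N <= m)%N -> (N <= n)%N ->
     rn (u m - u n) <= e) ->
  exists l, forall e : R, 0 < e -> exists N, forall n, (N <= n)%N ->
     rn (l - u n) <= e.
Proof.
move=> h.
have real (v : nat -> R) : (forall m n, `|v m - v n| <= rn (u m - u n)) ->
    exists l, forall e : R, 0 < e -> exists N, forall n, (N <= n)%N -> `|l - v n| < e.
  move=> vu; suff [l hl] : exists l : R, v @ \oo --> l.
    exists l => e e0; have /cvgrPdist_lt /(_ e e0) [N _ hN] := hl.
    by exists N => n; exact: hN.
  suff /cauchy_cvgP /cvg_ex [l hl] : cauchy (v @ \oo) by exists l.
  apply: cauchy_exP => e e0; have e2 : 0 < e / 2 by rewrite divr_gt0.
  have [N hN] := h _ e2; exists (v N), N => // n Nn; rewrite /ball /=.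
  apply: le_lt_trans (vu _ _) _; apply: le_lt_trans (hN _ _ _ Nn) _ => //.
  by rewrite ltr_pdivrMr // ltr_pMr // ltr1n.
have [|a ha] := real (fun n => complex.Re (u n)).
  by move=> m n; rewrite -ReN -ReD Re_rn.
have [|b hb] := real (fun n => complex.Im (u n)).
  by move=> m n; have := Im_rn (u m - u n); rewrite raddfB.
exists (a +i* b) => e e0; have e2 : 0 < e / 2 by rewrite divr_gt0.
have [N1 h1] := ha _ e2; have [N2 h2] := hb _ e2.
exists (maxn N1 N2) => n; rewrite geq_max => /andP[/h1 k1 /h2 k2].
apply: le_trans (rn_ReIm _) _; rewrite ReD ReN raddfB /= [e]splitr.
by rewrite lerD // ltW.
Qed.

End ComplexLimits.

(** * Hilbert completion *)

(** A Cauchy filter contains balls of radius 1/(n+1); their centres form a Cauchy sequence, and its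
    limit is a limit of the filter. *)
Lemma seq_complete (R : realType) (V : normedModType R[i]) (F : set_system V) :
  (forall u : nat -> V, (forall e : R, 0 < e -> exists N, forall m n,
     (N <= m)%N -> (N <= n)%N -> rn (u m - u n) < e) ->
   exists l, forall e : R, 0 < e -> exists N, forall n, (N <= n)%N -> rn (l - u n) < e) ->
  ProperFilter F -> cauchy F -> cvg F.
Proof.
move=> sc FF /cauchyP cF.
have pos n : 0 < (n.+1%:R : R)^-1 by rewrite invr_gt0.
have small e : 0 < e -> exists N, forall n, (N <= n)%N -> (n.+1%:R : R)^-1 < e.
  move=> e0; exists (Num.truncn e^-1) => n hn.
  rewrite -[ltRHS]invrK ltf_pV2 ?posrE ?invr_gt0 //.
  apply: lt_le_trans (truncnS_gt _) _; by rewrite ler_nat ltnS.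
have /choice [u hu] : forall n : nat, exists f : V, F [set h | rn (f - h) < n.+1%:R^-1].
  move=> n; have [|x hx] := cF (n.+1%:R^-1)%:C.
    by rewrite ltcE /= eqxx pos.
  exists x; apply: filterS hx => y; rewrite -ball_normE /ball_ /= rnE ltcR //.
have huu m n : rn (u m - u n) < m.+1%:R^-1 + n.+1%:R^-1.
  have [h [/= h1 h2]] := filter_ex (filterI (hu m) (hu n)).
  by apply: le_lt_trans (rn_tri h _ _) _; rewrite ltrD // rn_distC.
have [e e0|l hl] := sc u.
  have e2 : 0 < e / 2 by rewrite divr_gt0.
  have [N hN] := small _ e2; exists N => m n Nm Nn.
  by apply: lt_trans (huu m n) _; rewrite [ltRHS]splitr ltrD // hN.
apply/cvg_ex; exists l => A /nbhs_rn [e [e0 hA]].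
have e2 : 0 < e / 2 by rewrite divr_gt0.
have [N1 h1] := small _ e2; have [N2 h2] := hl _ e2.
apply: filterS (hu (maxn N1 N2)) => y /= hy; apply: hA.
apply: le_lt_trans (rn_tri (u (maxn N1 N2)) _ _) _; rewrite [e]splitr ltrD //.
  by rewrite h2 // leq_maxr.
by apply: lt_trans hy _; rewrite h1 // leq_maxl.
Qed.

Section HilbertCompletion.
Context {R : realType} {E : lmodType R[i]} (g : semiInner E).
Implicit Types (x y z : E) (d e : R) (phi psi : E -> R[i]^o).

(** [g y] is the antilinear functional x |-> <y, x>; [phi] is within [e] of it in the dual norm. *)
Definition approximates phi y e := forall x, rn (phi x - g y x : R[i]) <= e * sn g x.

Lemma approx_lin a phi psi y z d e : approximates phi y d -> approximates psi z e ->
  approximates (a *: phi + psi) (a *: y + z) (rn a * d + e).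
Proof.
move=> h k x; have -> : (a *: phi + psi) x - g (a *: y + z) x =
    a * (phi x - g y x) + (psi x - g z x) :> R[i].
  rewrite sdotPl; change (a * phi x + psi x - (a * g y x + g z x) =
    a * (phi x - g y x) + (psi x - g z x) :> R[i]); ring.
apply: le_trans (rnD _ _) _; rewrite rnM mulrDl lerD // -mulrA.
by rewrite ler_wpM2l ?rn_ge0.
Qed.

Lemma approx_diff phi y z d e : 0 <= d -> 0 <= e ->
  approximates phi y d -> approximates phi z e -> sn g (y - z) <= d + e.
Proof.
move=> d0 e0 h k; have [->|p] := eqVneq (sn g (y - z)) 0; first exact: addr_ge0.
have p0 : 0 < sn g (y - z) by rewrite lt_neqAle eq_sym p sn_ge0.
rewrite -(ler_pM2r p0) -expr2 mulrDl.
have -> : sn g (y - z) ^+ 2 = rn (g (y - z) (y - z)).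
  by rewrite sdotE rn_real ger0_norm // sqr_ge0.
have -> : g (y - z) (y - z) = (phi (y - z) - g z (y - z)) - (phi (y - z) - g y (y - z)).
  by rewrite sdotBl; ring.
by apply: le_trans (rnB _ _) _; rewrite addrC lerD.
Qed.

Definition hcomp_pred : {pred (E -> R[i]^o)} :=
  fun phi => `[< forall e, 0 < e -> exists y, approximates phi y e >].

(* The completion of (E, g), realized inside the antilinear functionals by
   [y |-> g y]. *)
Record hcomp := HComp { hval :> E -> R[i]^o ; hvalP : hval \in hcomp_pred }.

HB.instance Definition _ := [isSub for hval].
HB.instance Definition _ := [Choice of hcomp by <:].

Lemma hcompP (phi : E -> R[i]^o) : reflect (forall e, 0 < e -> exists y, approximates phi y e)
  (phi \in hcomp_pred).
Proof. exact: asboolP. Qed.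

Fact hcomp_submod : submod_closed hcomp_pred.
Proof.
split.
  apply/hcompP => e e0; exists 0 => x; rewrite sdot0l subr0.
  by rewrite [X in rn X](_ : _ = 0) // rn0 mulr_ge0 ?sn_ge0 // ltW.
move=> a phi psi /hcompP h /hcompP k; apply/hcompP => e e0.
have a0 : 0 < rn a + 1 by rewrite ltr_wpDl ?rn_ge0.
have [|y hy] := h (e / (rn a + 1)); first by rewrite divr_gt0.
have [|z hz] := k (e / (rn a + 1)); first by rewrite divr_gt0.
exists (a *: y + z); have -> : e = rn a * (e / (rn a + 1)) + e / (rn a + 1).
  by field; rewrite gt_eqF.
exact: approx_lin.
Qed.
HB.instance Definition _ := GRing.isSubmodClosed.Build R[i] (E -> R[i]^o) hcomp_pred
  hcomp_submod.
HB.instance Definition _ := [SubChoice_isSubLmodule of hcomp by <:].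

Implicit Types (f h k : hcomp).

Lemma approx_ex f e : 0 < e -> exists y, approximates f y e.
Proof. by move: e; apply/hcompP; apply: hvalP. Qed.

Lemma sn_approx (D : R) f : 0 <= D -> exists2 M, 0 <= M & forall e y,
  0 <= e -> e <= D -> approximates f y e -> sn g y <= M.
Proof.
move=> D0; have [y0 h0] := approx_ex f ltr01.
exists (sn g y0 + (D + 1)); first by rewrite addr_ge0 ?sn_ge0 // addr_ge0.
move=> e y e0 eD hy; have -> : y = y0 + (y - y0) by rewrite addrC subrK.
apply: le_trans (snD _ _ _) _; rewrite lerD2l.
by apply: le_trans (approx_diff e0 ler01 hy h0) _; rewrite lerD2r.
Qed.

Lemma sdot_approx D f h : 0 <= D -> exists2 K, 0 <= K & forall d e y z y' z',
  0 <= d -> d <= D -> 0 <= e -> e <= D ->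
  approximates f y d -> approximates h z d ->
  approximates f y' e -> approximates h z' e ->
  rn (g y z - g y' z') <= K * (d + e).
Proof.
move=> D0; have [M M0 hM] := sn_approx f D0; have [N N0 hN] := sn_approx h D0.
exists (M + N); first exact: addr_ge0.
move=> d e y z y' z' d0 dD e0 eD fy hz fy' hz'.
have -> : g y z - g y' z' = g (y - y') z + g y' (z - z').
  by rewrite sdotBl sdotBr; ring.
apply: le_trans (rnD _ _) _; rewrite mulrDl addrC lerD //.
  apply: le_trans (cauchy_schwarz _ _ _) _.
  by rewrite ler_pM ?sn_ge0 ?(hM e) // (approx_diff d0 e0 hz hz').
apply: le_trans (cauchy_schwarz _ _ _) _; rewrite mulrC.
by rewrite ler_pM ?sn_ge0 ?(hN d) // (approx_diff d0 e0 fy fy').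
Qed.

(** The limit of <y, z> over approximants of [f] and [h]. The error is linear in [e] only while the
    norms of the approximants stay bounded, hence a constant [K] for each bound [D] on [e], with [c]
    independent of [D]. *)
Lemma hdotc_ex f h : exists c : R[i], forall D, 0 <= D -> exists2 K, 0 <= K &
  forall e y z, 0 <= e -> e <= D -> approximates f y e -> approximates h z e ->
  rn (c - g y z) <= K * e.
Proof.
have pos n : 0 < (n.+1%:R : R)^-1 by rewrite invr_gt0.
have /choice [y hy] : forall n : nat, exists y, approximates f y (n.+1%:R^-1).
  by move=> n; apply: approx_ex.
have /choice [z hz] : forall n : nat, exists z, approximates h z (n.+1%:R^-1).
  by move=> n; apply: approx_ex.
have small e : 0 < e -> exists N, forall n, (N <= n)%N -> (n.+1%:R : R)^-1 <= e.
  move=> e0; exists (Num.truncn e^-1) => n hn.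
  rewrite -[leRHS]invrK lef_pV2 ?posrE ?invr_gt0 //.
  apply: ltW; apply: lt_le_trans (truncnS_gt _) _.
  by rewrite ler_nat ltnS.
have le1 n : (n.+1%:R : R)^-1 <= 1 by rewrite invf_le1 // ler1n.
have [|c hc] := @cauchy_complex R (fun n => g (y n) (z n)).
  have [K K0 hK] := sdot_approx f h ler01.
  move=> e e0; have [|N hN] := small (e / (K + 1) / 2).
    by rewrite !divr_gt0 // ltr_wpDl.
  exists N => m n Nm Nn; apply: le_trans (hK _ _ _ _ _ _ _ _ _ _ (hy m) (hz m) (hy n) (hz n)) _.
  - exact/ltW/pos. - exact: le1. - exact/ltW/pos. - exact: le1.
  apply: le_trans (_ : K * (e / (K + 1)) <= _).
    by rewrite ler_wpM2l // [leRHS]splitr lerD // hN.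
  have K1 : 0 < K + 1 by rewrite ltr_wpDl.
  rewrite mulrA ler_pdivrMr // mulrC ler_wpM2l ?(ltW e0) // lerDl //.
exists c => D D0; have D1 : 0 <= D + 1 by rewrite addr_ge0.
have [K K0 hK] := sdot_approx f h D1; exists K => // e y' z' e0 eD fy hz'.
apply/ler_addgt0Pr => d d0; have d2 : 0 < d / 2 by rewrite divr_gt0.
have K1 : 0 < K + 1 by rewrite ltr_wpDl.
have [N1 h1] := hc _ d2; have [|N2 h2] := small (d / 2 / (K + 1)).
  by rewrite divr_gt0.
pose n := maxn N1 N2.
apply: le_trans (rn_tri (g (y n) (z n)) _ _) _.
have b1 := h1 n (leq_maxl _ _).
have b2 : rn (g (y n) (z n) - g y' z') <= K * (n.+1%:R^-1 + e).
  apply: hK => //; first by apply: le_trans (le1 n) _; rewrite lerDr.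
  by apply: le_trans eD _; rewrite lerDl.
have b3 : K * n.+1%:R^-1 <= d / 2.
  apply: le_trans (_ : K * (d / 2 / (K + 1)) <= _).
    by rewrite ler_wpM2l // h2 // leq_maxr.
  by rewrite mulrA ler_pdivrMr // mulrC ler_wpM2l ?(ltW d2) // lerDl.
apply: le_trans (lerD b1 b2) _.
by rewrite mulrDr addrA [leRHS]addrC lerD2r [leRHS]splitr lerD.
Qed.

Definition hdotc f h : R[i] := sval (cid (hdotc_ex f h)).

Lemma hdotcP f h D : 0 <= D -> exists2 K, 0 <= K &
  forall e y z, 0 <= e -> e <= D -> approximates f y e -> approximates h z e ->
  rn (hdotc f h - g y z) <= K * e.
Proof. by rewrite /hdotc; case: cid => c /= hc D0; exact: hc. Qed.

Lemma hdotc_linear a f h k : hdotc (a *: f + h) k = a * hdotc f k + hdotc h k.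
Proof.
have D0 : 0 <= rn a + 1 by rewrite addr_ge0 ?rn_ge0.
have [K1 K10 h1] := hdotcP (a *: f + h) k D0.
have [K2 K20 h2] := hdotcP f k D0; have [K3 K30 h3] := hdotcP h k D0.
apply/eqP; rewrite -subr_eq0; apply/eqP.
have D1 : 1 <= rn a + 1 by rewrite lerDr rn_ge0.
have Da : 0 < rn a + 1 by apply: lt_le_trans D1.
apply: (@rn_small R R[i]^o _ (K1 * (rn a + 1) + rn a * K2 + K3)) => e e0.
pose t := Num.min e 1; have t0 : 0 < t by rewrite lt_min e0 ltr01.
have t1 : t <= 1 by rewrite ge_min lexx orbT.
have te : t <= e by rewrite ge_min lexx.
have [y fy] := approx_ex f t0; have [z hz] := approx_ex h t0.
have [w kw] := approx_ex k t0.
have := approx_lin a fy hz; rewrite -{2}[t]mul1r -mulrDl => L.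
have tD : t <= rn a + 1 by apply: le_trans t1 D1.
have b1 : rn (hdotc (a *: f + h) k - g (a *: y + z) w) <= K1 * ((rn a + 1) * t).
  apply: h1 => //; first by rewrite mulr_ge0 // ltW.
    by rewrite ler_piMr // ltW.
  move=> x; apply: le_trans (kw x) _; rewrite ler_wpM2r ?sn_ge0 //.
  by rewrite ler_peMl // ltW.
have b2 := h2 _ _ _ (ltW t0) tD fy kw; have b3 := h3 _ _ _ (ltW t0) tD hz kw.
apply: le_trans (_ : _ <= (K1 * (rn a + 1) + rn a * K2 + K3) * t) _; last first.
  by rewrite ler_wpM2l // !addr_ge0 // mulr_ge0 // rn_ge0.
have -> : hdotc (a *: f + h) k - (a * hdotc f k + hdotc h k) =
  (hdotc (a *: f + h) k - g (a *: y + z) w) - (a * (hdotc f k - g y w) + (hdotc h k - g z w)).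
  by rewrite sdotPl; ring.
apply: le_trans (rnB _ _) _; rewrite !mulrDl -addrA; apply: lerD.
  by rewrite -mulrA.
apply: le_trans (rnD _ _) _; apply: lerD => //.
by rewrite rnM -mulrA ler_wpM2l ?rn_ge0.
Qed.

Lemma hdotcC f h : hdotc h f = (hdotc f h)^*.
Proof.
have [K1 K10 h1] := hdotcP f h ler01; have [K2 K20 h2] := hdotcP h f ler01.
apply/eqP; rewrite -subr_eq0; apply/eqP.
apply: (@rn_small R R[i]^o _ (K2 + K1)) => e e0.
pose t := Num.min e 1; have t0 : 0 < t by rewrite lt_min e0 ltr01.
have t1 : t <= 1 by rewrite ge_min lexx orbT.
have te : t <= e by rewrite ge_min lexx.
have [y fy] := approx_ex f t0; have [z hz] := approx_ex h t0.
have b1 := h1 _ _ _ (ltW t0) t1 fy hz; have b2 := h2 _ _ _ (ltW t0) t1 hz fy.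
have -> : hdotc h f - (hdotc f h)^* = (hdotc h f - g z y) - (hdotc f h - g y z)^*.
  by rewrite rmorphB /= -sdotC; ring.
apply: le_trans (rnB _ _) _; rewrite rn_conj.
apply: le_trans (lerD b2 b1) _; rewrite -mulrDl ler_wpM2l // addr_ge0 //.
Qed.

Lemma hdotc_ge0 f : 0 <= hdotc f f.
Proof.
have [K K0 hK] := hdotcP f f ler01.
rewrite lecE /=; apply/andP; split.
  have := hdotcC f f; case: (hdotc f f) => a b [] /= => /eqP.
  by rewrite -addr_eq0 -mulr2n mulrn_eq0 /=.
rewrite leNgt; apply/negP => n0.
pose e := Num.min 1 (- complex.Re (hdotc f f) / (K + 1) / 2).
have K1 : 0 < K + 1 by rewrite ltr_wpDl.
have e0 : 0 < e by rewrite lt_min ltr01 /= !divr_gt0 // oppr_gt0.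
have e1 : e <= 1 by rewrite ge_min lexx.
have e2 : e <= - complex.Re (hdotc f f) / (K + 1) / 2 by rewrite ge_min lexx orbT.
have [y fy] := approx_ex f e0; have := hK _ _ _ (ltW e0) e1 fy fy.
have := Re_rn (hdotc f f - g y y); rewrite ReD ReN -sn_sqr.
rewrite ler_norml => /andP[lo _]; have s0 := sqr_ge0 (sn g y).
move: e2; rewrite -mulrA -invfM ler_pdivlMr ?mulr_gt0 //.
move: (complex.Re _) (sn g y ^+ 2) (rn _) n0 lo s0 => u v w; nra.
Qed.

Definition hcdot : semiInner hcomp := SemiInner hdotc_linear hdotcC hdotc_ge0.

Fact hcomp_in_subproof y : (g y : E -> R[i]^o) \in hcomp_pred.
Proof.
apply/hcompP => e e0; exists y => x.
by rewrite subrr rn0 mulr_ge0 ?sn_ge0 // ltW.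
Qed.

Definition hcomp_in y := HComp (hcomp_in_subproof y).

(** Evaluation at [y] is the inner product with the image of [y]. The norm is therefore the dual
    norm ([rn_hval], [sn_hcomp_le]), and limits in the completion can be taken pointwise. *)
Lemma hdotc_in f y : hdotc f (hcomp_in y) = f y.
Proof.
have [K K0 hK] := hdotcP f (hcomp_in y) ler01.
apply/eqP; rewrite -subr_eq0; apply/eqP.
apply: (@rn_small R R[i]^o _ (K + sn g y)) => e e0.
pose t := Num.min e 1; have t0 : 0 < t by rewrite lt_min e0 ltr01.
have t1 : t <= 1 by rewrite ge_min lexx orbT.
have te : t <= e by rewrite ge_min lexx.
have [z fz] := approx_ex f t0.
have yy : approximates (hcomp_in y) y t.
  by move=> x; rewrite subrr rn0 mulr_ge0 ?sn_ge0 // ltW.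
have b := hK _ _ _ (ltW t0) t1 fz yy.
apply: le_trans (rn_tri (g z y : R[i]^o) _ _) _.
apply: le_trans (lerD b (_ : _ <= sn g y * t)) _.
  by rewrite rn_distC mulrC; exact: fz.
by rewrite -mulrDl ler_wpM2l // addr_ge0 ?sn_ge0.
Qed.

Lemma sn_hcomp_in y : sn hcdot (hcomp_in y) = sn g y.
Proof. by rewrite /sn /= hdotc_in. Qed.

Lemma rn_hval f y : rn (f y : R[i]) <= sn hcdot f * sn g y.
Proof.
by rewrite -hdotc_in -sn_hcomp_in; exact: (cauchy_schwarz hcdot f (hcomp_in y)).
Qed.

Lemma sn_hcomp_le f e : 0 <= e -> (forall y, rn (f y : R[i]) <= e * sn g y) ->
  sn hcdot f <= e.
Proof.
move=> e0 h.
have [K K0 hK] := hdotcP f f ler01.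
rewrite -(@ler_pXn2r _ 2) ?nnegrE ?sn_ge0 // sn_sqr /=.
apply/ler_addgt0Pr => d d0; pose t := Num.min 1 (d / (K + e *+ 2 + 1)).
have k0 : 0 < K + e *+ 2 + 1 by rewrite ltr_wpDl // addr_ge0 // mulrn_wge0.
have t0 : 0 < t by rewrite lt_min ltr01 /= divr_gt0.
have t1 : t <= 1 by rewrite ge_min lexx.
have t2 : t * (K + e *+ 2 + 1) <= d by rewrite -ler_pdivlMr // ge_min lexx orbT.
have [y fy] := approx_ex f t0.
have b := hK _ _ _ (ltW t0) t1 fy fy.
have s0 := sn_ge0 g y.
have sy : sn g y <= e + t.
  have [->|p] := eqVneq (sn g y) 0; first by rewrite addr_ge0 // ltW.
  have p0 : 0 < sn g y by rewrite lt_neqAle eq_sym p.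
  rewrite -(ler_pM2r p0) -expr2 mulrDl.
  have -> : sn g y ^+ 2 = rn (g y y) by rewrite sdotE rn_real ger0_norm // sqr_ge0.
  have -> : g y y = f y - (f y - g y y) by ring.
  by apply: le_trans (rnB _ _) _; rewrite lerD.
have := Re_rn (hdotc f f - g y y); rewrite ReD ReN -sn_sqr ler_norml => /andP[_ hi].
move: (complex.Re _) (sn g y) (rn _) s0 sy b hi => u v w; rewrite !mulr2n in t2 *; nra.
Qed.

Fact hcnormD f h : (sn hcdot (f + h))%:C <= (sn hcdot f)%:C + (sn hcdot h)%:C :> R[i].
Proof. by rewrite -rmorphD lecR snD. Qed.
Fact hcnormZ (l : R[i]) f : (sn hcdot (l *: f))%:C = `|l| * (sn hcdot f)%:C :> R[i].
Proof. by rewrite snZ rmorphM /= -rnE. Qed.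
Fact hcnorm_eq0 f : (sn hcdot f)%:C = 0 :> R[i] -> f = 0.
Proof.
move=> /(@complexI R _ 0) s0; apply/val_inj/funext => y /=.
by apply: (@rn_eq0 _ R[i]); apply/eqP; rewrite eq_le rn_ge0 andbT;
  apply: le_trans (rn_hval f y) _; rewrite s0 mul0r.
Qed.

HB.instance Definition _ := Lmodule_isNormed.Build R[i] hcomp hcnormD hcnormZ hcnorm_eq0.

Lemma rn_hcomp f : rn f = sn hcdot f.
Proof. by []. Qed.

Fact hcomp_complete (F : set_system hcomp) : ProperFilter F -> cauchy F -> cvg F.
Proof.
move=> FF cF; apply: seq_complete => // u hu.
have hux m n y : rn (u m y - u n y : R[i]) <= rn (u m - u n) * sn g y.
  by have := rn_hval (u m - u n) y; rewrite -rn_hcomp.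
have /choice [phi hphi] : forall y, exists l : R[i], forall e : R, 0 < e ->
    exists N, forall n, (N <= n)%N -> rn (l - u n y) <= e.
  move=> y; apply: cauchy_complex => e e0.
  have s1 : 0 < sn g y + 1 by rewrite ltr_wpDl ?sn_ge0.
  have [|N hN] := hu (e / (sn g y + 1)); first by rewrite divr_gt0.
  exists N => m n Nm Nn; apply: le_trans (hux m n y) _.
  apply: le_trans (_ : e / (sn g y + 1) * sn g y <= _).
    by rewrite ler_wpM2r ?sn_ge0 // ltW // hN.
  by rewrite mulrAC ler_pdivrMr // ler_wpM2l ?(ltW e0) // lerDl.
have phi_le e N : 0 < e ->
    (forall m n, (N <= m)%N -> (N <= n)%N -> rn (u m - u n) < e) ->
    forall y n, (N <= n)%N -> rn (phi y - u n y : R[i]) <= e * sn g y.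
  move=> e0 hN y n Nn; apply/ler_addgt0Pr => d d0.
  have [N' hN'] := hphi y d d0; pose k := maxn N N'.
  apply: le_trans (rn_tri (u k y : R[i]^o) _ _) _; rewrite addrC lerD //.
    apply: le_trans (hux _ _ _) _; rewrite ler_wpM2r ?sn_ge0 // ltW // hN //.
    exact: leq_maxl.
  by apply: hN'; exact: leq_maxr.
have phiP : (phi : E -> R[i]^o) \in hcomp_pred.
  apply/hcompP => e e0; have e2 : 0 < e / 2 by rewrite divr_gt0.
  have [N hN] := hu _ e2; have [y hy] := approx_ex (u N) e2; exists y => x.
  apply: le_trans (rn_tri (u N x : R[i]^o) _ _) _.
  by rewrite [e]splitr mulrDl lerD // (phi_le _ _ e2 hN).
exists (HComp phiP) => e e0; have e2 : 0 < e / 2 by rewrite divr_gt0.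
have [N hN] := hu _ e2; exists N => n Nn.
apply: le_lt_trans (_ : _ <= e / 2) _; last by rewrite ltr_pdivrMr // ltr_pMr // ltr1n.
rewrite rn_hcomp; apply: sn_hcomp_le; first exact: ltW.
by move=> y; exact: (phi_le _ _ e2 hN).
Qed.
HB.instance Definition _ := Uniform_isComplete.Build hcomp hcomp_complete.

Fact hdotc_bilinear : bilinear_for ( *%R ) (Num.conj \; *%R) (hdotc : hcomp -> hcomp -> R[i]).
Proof.
split=> [k a f h|f a h k]; first exact: hdotc_linear.
by rewrite hdotcC hdotc_linear rmorphD rmorphM /= -!hdotcC.
Qed.
HB.instance Definition _ := bilinear_isBilinear.Build R[i] hcomp hcomp R[i]
  ( *%R ) (Num.conj \; *%R) hdotc hdotc_bilinear.

Fact hdotc_hermitian f h : hdotc f h = (-1) ^+ false * (hdotc h f)^*.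
Proof. by rewrite expr0 mul1r -hdotcC. Qed.
HB.instance Definition _ := isHermitianSesquilinear.Build R[i] hcomp false
  (@Num.conj R[i]) hdotc hdotc_hermitian.

Fact hdotc_gt0 f : f != 0 -> 0 < hdotc f f.
Proof.
move=> f0; rewrite lt_neqAle hdotc_ge0 andbT eq_sym; apply: contraNneq f0 => h.
by apply/eqP/hcnorm_eq0; rewrite /sn /= h sqrtr0.
Qed.
HB.instance Definition _ := isDotProduct.Build R[i] hcomp hdotc hdotc_gt0.

Fact norm_hdotc f : `|f| ^+ 2 = hdotc f f.
Proof. by rewrite rnE rn_hcomp -rmorphXn /= sn_sqr /=; symmetry; apply/ReP/hdotc_ge0. Qed.
HB.instance Definition _ := isHilbert.Build R hcomp norm_hdotc.
End HilbertCompletion.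

(** * States and the Gelfand-Naimark theorem *)

Section Complexify.
Context {R : realType} (V : lmodType R[i]) (W : set V) (f : V -> R).
Hypotheses (WD : forall x y, W x -> W y -> W (x + y))
  (WZ : forall a x, W x -> W (a *: x)).
Hypotheses (fD : forall x y, W x -> W y -> f (x + y) = f x + f y)
  (fZ : forall r x, W x -> f (r%:C *: x) = r * f x).

Definition complexify (x : V) : R[i] := (f x)%:C - 'i * (f ('i *: x))%:C.

Lemma Re_complexify x : complex.Re (complexify x) = f x.
Proof. by rewrite /complexify ReD ReN Re_iM /= oppr0 oppr0 addr0. Qed.

Lemma complexifyD x y : W x -> W y -> complexify (x + y) = complexify x + complexify y.
Proof.
move=> Wx Wy; rewrite /complexify scalerDr !fD ?rmorphD //=; try exact: WZ.
by rewrite mulrDr; ring.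
Qed.

Lemma complexifyZ a x : W x -> complexify (a *: x) = a * complexify x.
Proof.
move=> Wx; have i2 : ('i : R[i]) * 'i = -1 by rewrite -expr2 sqr_i.
have fN y : W y -> f (- y) = - f y.
  by move=> Wy; have := fZ (-1) Wy; rewrite rmorphN1 scaleN1r mulN1r.
have real (r : R) y : W y -> complexify (r%:C *: y) = r%:C * complexify y.
  move=> Wy; have e : 'i *: (r%:C *: y) = r%:C *: ('i *: y) by rewrite !scalerA mulrC.
  rewrite /complexify e !fZ ?rmorphM //=; [by ring|exact: WZ].
have imag y : W y -> complexify ('i *: y) = 'i * complexify y.
  move=> Wy; rewrite /complexify scalerA i2 scaleN1r fN // rmorphN /= mulrN opprK.
  by rewrite mulrBr mulrA i2 mulN1r opprK addrC.
have -> : a = (complex.Re a)%:C + 'i * (complex.Im a)%:C by rewrite -complexE; case: a.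
rewrite scalerDl complexifyD ?real //; try (by apply: WZ); rewrite mulrDl; congr (_ + _).
rewrite -scalerA imag ?real ?mulrA //; exact: WZ.
Qed.

End Complexify.

(** * Separation of a point from a subspace *)

Section HahnBanach.
Context {R : realType} (V : normedModType R[i]) (S : set V).
Hypotheses (S0 : S 0) (SL : forall a x y, S x -> S y -> S (a *: x + y)).

(** The Riesz theorem on V x C, for the cone of pairs (v, a) with |v - s| <= Re a for some s in [S]:
    positivity of F there says that f(v) = - F(v, 0) is at most |v - s| for all s in [S]. On the
    span of (y, 0) and the second axis, F is prescribed so that f(y) = d. *)
Lemma hahn_banach_separation (y : V) : ~ closure S y ->
  exists th : V -> R[i]^o, [/\ linear th, forall x, S x -> th x = 0, th y <> 0 &
    exists2 K, 0 < K & forall x, rn (th x : R[i]) <= K * rn x].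
Proof.
move=> nc; have [d d0 hd] : exists2 d : R, 0 < d & forall s, S s -> d <= rn (y - s).
  apply: contrapT => h; apply: nc; apply/closure_rn => e e0.
  apply: contrapT => k; apply: h; exists e => // s Ss; rewrite leNgt; apply/negP => l.
  by apply: k; exists s.
have SD x z : S x -> S z -> S (x + z) by move=> Sx Sz; rewrite -[x]scale1r; exact: SL.
have SZ a x : S x -> S (a *: x) by move=> Sx; rewrite -[_ *: _]addr0; exact: SL.
(* [riesz_extension] lives in a complex space, so the additional real axis becomes a copy of C of
   which only the real part counts. *)
pose VR : lmodType R[i] := (V * R[i]^o)%type.
pose P : set VR := [set p | exists2 s, S s & rn (p.1 - s) <= complex.Re (p.2 : R[i])].
pose G0 (p : VR) r := exists t : R, p.1 = t%:C *: y /\ r = complex.Re (p.2 : R[i]) - t * d.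
have VR2 (p q : VR) : (p + q).2 = p.2 + q.2 :> R[i] by [].
have [F [FD FZ FG FP]] : exists f : VR -> R,
  [/\ forall x y, setT x -> setT y -> f (x + y) = f x + f y,
      forall r x, setT x -> f (r%:C *: x) = r * f x,
      forall x r, G0 x r -> f x = r & forall x, setT x -> P x -> 0 <= f x].
  apply: riesz_extension => //.
  - by exists 0; rewrite // subr0 rn0.
  - move=> p q [s Ss ps] [t St qt]; exists (s + t); first exact: SD.
    rewrite VR2 ReD; apply: le_trans (lerD ps qt); apply: le_trans (rnD _ _).
    by rewrite opprD addrACA.
  - move=> r p r0 [s Ss ps]; exists (r%:C *: s); first exact: SZ.
    have -> : (r%:C *: p).2 = r%:C * p.2 :> R[i] by [].
    by rewrite /= -scalerBr rnZr ger0_norm // Re_realM ler_wpM2l.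
  - by exists 0; rewrite /= scale0r mul0r subr0.
  - move=> p q r u [t [pt ->]] [t' [qt ->]]; exists (t + t'); split.
      by rewrite /= pt qt rmorphD scalerDl.
    by rewrite VR2 ReD; ring.
  - move=> t p r [u [pu ->]]; exists (t * u); split.
      by rewrite /= pu scalerA rmorphM.
    have -> : (t%:C *: p).2 = t%:C * p.2 :> R[i] by [].
    by rewrite Re_realM; ring.
  - move=> p r [t [pt ->]] [s Ss]; rewrite pt => h.
    rewrite subr_ge0; apply: le_trans h; apply: le_trans (_ : `|t| * d <= _).
      by rewrite ler_wpM2r ?(ltW d0) // ler_norm.
    have [->|t0] := eqVneq t 0; first by rewrite normr0 mul0r rn_ge0.
    have -> : t%:C *: y - s = t%:C *: (y - (t^-1)%:C *: s).
      by rewrite scalerBr scalerA -rmorphM /= mulfV // scale1r.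
    by rewrite rnZr ler_wpM2l // hd //; exact: SZ.
  - move=> [v a] _; exists ((0, (rn v + complex.Re a)%:C) : VR), (rn v + complex.Re a).
    split; first by exists 0; rewrite /= scale0r mul0r subr0.
    exists 0 => //=; rewrite sub0r subr0 rnN ReD ReN /=; lra.
pose f (v : V) := - F ((v, 0) : VR).
have fD x z : setT x -> setT z -> f (x + z) = f x + f z.
  move=> _ _; rewrite /f -opprD -FD //; congr (- F _).
  by congr pair; rewrite addr0.
have fZ r x : setT x -> f (r%:C *: x) = r * f x.
  move=> _; rewrite /f mulrN -FZ //; congr (- F _).
  by congr pair; rewrite scaler0.
have F1 (r : R) : F ((0, r%:C) : VR) = r.
  by apply: FG; exists 0; rewrite /= scale0r mul0r subr0.
have fb s v : S s -> f v <= rn (v - s).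
  move=> Ss; have : P ((v, (rn (v - s))%:C) : VR) by exists s.
  move=> /(FP _ I).
  have -> : ((v, (rn (v - s))%:C) : VR) = ((v, 0) : VR) + ((0, (rn (v - s))%:C) : VR).
    by congr pair; rewrite ?addr0 ?add0r.
  by rewrite FD // F1 /f; lra.
have fy : f y = d.
  rewrite /f (FG _ (- d)) ?opprK //; exists 1.
  by rewrite /= scale1r mul1r sub0r.
have fN v : f (- v) = - f v.
  by have := fZ (-1) v I; rewrite rmorphN1 scaleN1r mulN1r.
have fS s : S s -> f s = 0.
  move=> Ss; have := fb s s Ss; have Ns : S (- s) by rewrite -scaleN1r; exact: SZ.
  have := fb _ (- s) Ns; rewrite fN !subrr rn0; lra.
have fn v : `|f v| <= rn v.
  rewrite ler_norml; have := fb 0 v S0; have := fb 0 (- v) S0.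
  by rewrite !subr0 rnN fN; lra.
pose th := complexify f; exists (th : V -> R[i]^o); split.
- move=> a x z; rewrite /th (@complexifyD _ _ setT) //.
  by rewrite (@complexifyZ _ _ setT).
- by move=> x Sx; rewrite /th /complexify !fS ?mulr0 ?subr0 //; exact: SZ.
- move=> /(congr1 (@complex.Re R)); rewrite /th Re_complexify fy /= => d1.
  by rewrite d1 ltxx in d0.
- exists 2 => // x; rewrite /th /complexify; apply: le_trans (rnB _ _) _.
  rewrite rnM rn_i mul1r !rn_real mulr_natl mulr2n lerD //.
  by apply: le_trans (fn _) _; rewrite rnZ rn_i mul1r.
Qed.
End HahnBanach.

Section States.
Context {R : realType} (A : unitalCstarType R).
Implicit Types (x y : A).

Lemma nonneg_scN (s : R) : (aone : A) <> 0 -> nonneg (sc A s) -> 0 <= s.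
Proof.
move=> n1 [_ [l l0]]; rewrite /sc -scalerBl -rmorphB rnZr /= => h.
have r1 : rn (aone : A) = 1.
  have := rn_star_amul (aone : A); rewrite star1 amul1a expr2 => e.
  by apply: (mulfI (_ : rn (aone : A) != 0)); rewrite ?gt_eqF ?rn_gt0 // mulr1 -e.
move: h; rewrite r1 mulr1 ler_norml => /andP[_]; lra.
Qed.

(** Makes al + be x^* x |-> al + be |x|^2 a positive functional, the one that is extended to a
    state. For be < 0 it amounts to |be| |x^* x| <= al, by [nonneg_bound]. *)
Lemma star_mul_bound (al be : R) x : (aone : A) <> 0 ->
  nonneg (sc A al + be%:C *: (star x ** x)) -> 0 <= al + be * rn x ^+ 2.
Proof.
move=> n1 h; have sh : star (star x ** x) = star x ** x by rewrite starM starK.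
have ph := nonneg_star_mul x; rewrite -rn_star_amul.
have [b0|b0] := leP 0 be.
  apply: nonneg_scN => //.
  have -> : sc A (al + be * rn (star x ** x)) = (sc A al + be%:C *: (star x ** x)) +
      be%:C *: (sc A (rn (star x ** x)) - star x ** x).
    by rewrite /sc; lmod.
  apply: nonnegD => //; apply: nonnegZ => //; apply: nonneg_near; last by rewrite rnN.
  by rewrite starN sh.
have nb : nonneg ((- be)%:C *: (star x ** x)) by apply: nonnegZ => //; rewrite oppr_ge0 ltW.
have al0 : 0 <= al.
  apply: nonneg_scN => //; have := nonnegD h nb.
  by rewrite -addrA -scalerDl -rmorphD addrN scale0r addr0.
have : rn ((- be)%:C *: (star x ** x)) <= al.
  apply: nonneg_bound => //.
  - by rewrite starZr sh.
  - by apply: nonnegD => //; exact: nonneg_sc.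
  - by rewrite rmorphN scaleNr opprK.
by rewrite rnZr ger0_norm ?oppr_ge0 ?(ltW b0) // mulNr; lra.
Qed.

(** The cone consists of all y with y + y^* positive. It contains the skew elements with both signs,
    so the extension vanishes on them and its complexification is real on self-adjoint elements. *)
Lemma state_exists x : (aone : A) <> 0 -> exists F : A -> R[i],
  [/\ forall a y z, F (a *: y + z) = a * F y + F z, forall y, 0 <= F (star y ** y),
      F aone = 1 & F (star x ** x) = (rn x ^+ 2)%:C].
Proof.
move=> n1; pose P : set A := [set y | nonneg (y + star y)].
pose h := star x ** x; have sh : star h = h by rewrite starM starK.
pose G0 (y : A) r := exists al be : R, y = sc A al + be%:C *: h /\ r = al + be * rn x ^+ 2.
have [f [fD fZ fG fP]] : exists f : A -> R,
  [/\ forall x y, setT x -> setT y -> f (x + y) = f x + f y,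
      forall r x, setT x -> f (r%:C *: x) = r * f x,
      forall x r, G0 x r -> f x = r & forall x, setT x -> P x -> 0 <= f x].
  apply: riesz_extension => //.
  - by rewrite /P /= star0 addr0 -[0](scale0r aone); apply: nonneg_sc.
  - by move=> y z py pz; rewrite /P /= starD addrACA; apply: nonnegD.
  - by move=> r y r0 py; rewrite /P /= starZr -scalerDr; apply: nonnegZ.
  - by exists 0, 0; split; rewrite /sc ?mul0r ?scale0r addr0.
  - move=> y z r s [al [be [-> ->]]] [al' [be' [-> ->]]]; exists (al + al'), (be + be').
    by split; [rewrite /sc; lmod|ring].
  - move=> t y r [al [be [-> ->]]]; exists (t * al), (t * be).
    by split; [rewrite /sc; lmod|ring].
  - move=> y r [al [be [-> ->]]] py; apply: star_mul_bound => //.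
    have := nonnegZ (_ : 0 <= 2^-1 :> R) py.
    rewrite starD star_sc starZr sh => /(_ _).
    have -> : (2^-1 : R)%:C *: (sc A al + be%:C *: h + (sc A al + be%:C *: h)) =
       sc A al + be%:C *: h.
      have e : (2^-1 + 2^-1 : R) = 1 by rewrite -div1r -splitr.
      by rewrite scalerDr -scalerDl -rmorphD /= e scale1r.
    by apply; rewrite invr_ge0.
  - move=> y _; exists (sc A (rn y)), (rn y); split.
      by exists (rn y), 0; rewrite mul0r scale0r !addr0.
    rewrite /P /= starB star_sc.
    have -> : sc A (rn y) - y + (sc A (rn y) - star y) = sc A (rn y *+ 2) - (y + star y).
      by rewrite /sc; lmod.
    apply: nonneg_near; first by rewrite starN starD starK addrC.
    by rewrite rnN; apply: le_trans (rnD _ _) _; rewrite rn_star mulr2n.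
have f0 y : star y = - y -> f y = 0.
  move=> sy; have p0 (z : A) : star z = - z -> P z.
    by move=> sz; rewrite /P /= sz subrr -[0](scale0r aone); apply: nonneg_sc.
  have fN : f (- y) = - f y by have := fZ (-1) y I; rewrite rmorphN1 scaleN1r mulN1r.
  have := fP _ I (p0 _ sy); have := fP (- y) I (p0 _ _).
  by rewrite starN sy fN => /(_ erefl); lra.
have f2 y : 0 <= f (star y ** y).
  apply: fP => //; rewrite /P /= starM starK.
  by apply: nonnegD; exact: nonneg_star_mul.
have F0 y : star y = y -> complexify f y = (f y)%:C.
  by move=> sy; rewrite /complexify (f0 ('i *: y)) ?mulr0 ?subr0 // starZ conj_i sy scaleNr.
exists (complexify f); split.
- move=> a y z; rewrite (@complexifyD _ _ setT) //.
  by rewrite (@complexifyZ _ _ setT).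
- by move=> y; rewrite F0 ?starM ?starK // lecR.
- rewrite F0 ?star1 // (fG _ 1) ?rmorph1 //; exists 1, 0.
  by rewrite mul0r addr0 /sc scale1r scale0r addr0.
- rewrite F0 // (fG _ (rn x ^+ 2)) //; exists 0, 1.
  by rewrite mul1r add0r /sc scale1r scale0r add0r.
Qed.

End States.

Lemma hval_antilinear (R : realType) (E : lmodType R[i]) (g : semiInner E)
  (f : hcomp g) (a : R[i]) x y : f (a *: x + y) = a^* * f x + f y :> R[i].
Proof.
rewrite -!hdotc_in; have -> : hcomp_in g (a *: x + y) = a *: hcomp_in g x + hcomp_in g y.
  by apply/val_inj/funext => z /=; rewrite sdotPl.
by rewrite hdotcC hdotc_linear rmorphD rmorphM /= -!hdotcC.
Qed.

(** * The GNS construction *)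

Section GNS.
Context {R : realType} (A : cstarType R) (F : A -> R[i]).
Implicit Types (x y z b : A).
Hypotheses (FL : forall (a : R[i]) y z, F (a *: y + z) = a * F y + F z)
  (F_ge0 : forall y, 0 <= F (star y ** y))
  (FC : forall y, F (star y) = (F y)^* )
  (F_bound : forall b, exists2 C : R, 0 <= C & forall y,
     complex.Re (F (star (b ** y) ** (b ** y))) <= C ^+ 2 * complex.Re (F (star y ** y))).

Fact gns_linear (a : R[i]) x y z :
  F (star z ** (a *: x + y)) = a * F (star z ** x) + F (star z ** y).
Proof. by rewrite amulDr amulZr FL. Qed.
Fact gns_conj x y : F (star x ** y) = (F (star y ** x))^*.
Proof. by rewrite -FC starM starK. Qed.

Definition gns_dot : semiInner A :=
  @SemiInner R A (fun x z => F (star z ** x)) gns_linear gns_conj F_ge0.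

Definition gns_space := hcomp gns_dot.

Lemma gns_bound b : exists2 C : R, 0 <= C & forall y, sn gns_dot (b ** y) <= C * sn gns_dot y.
Proof.
have [C C0 hC] := F_bound b; exists C => // y.
by rewrite -(@ler_pXn2r _ 2) ?nnegrE ?mulr_ge0 ?sn_ge0 // exprMn !sn_sqr; exact: hC.
Qed.

Lemma gns_approx b : exists2 C : R, 0 <= C & forall (f : A -> R[i]^o) y e,
  0 <= e -> approximates gns_dot f y e ->
  approximates gns_dot (fun x => f (star b ** x)) (b ** y) (e * C).
Proof.
have [C C0 hC] := gns_bound (star b); exists C => // f y e e0 hy x.
have -> : gns_dot (b ** y) x = gns_dot y (star b ** x).
  by rewrite /= starM starK amulA.
by apply: le_trans (hy _) _; rewrite -mulrA ler_wpM2l.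
Qed.

Fact gns_op_subproof b (f : gns_space) :
  ((fun x => f (star b ** x)) : A -> R[i]^o) \in hcomp_pred gns_dot.
Proof.
apply/hcompP => e e0; have [C C0 hC] := gns_approx b.
have C1 : 0 < C + 1 by rewrite ltr_wpDl.
have e1 : 0 < e / (C + 1) by rewrite divr_gt0.
have [y hy] := @approx_ex _ _ gns_dot f _ e1.
exists (b ** y) => x; apply: le_trans (hC _ _ _ (ltW e1) hy x) _.
rewrite ler_wpM2r ?sn_ge0 // mulrAC ler_pdivrMr //.
by rewrite ler_wpM2l ?(ltW e0) // lerDl.
Qed.

(** The vector of y is the functional x |-> F(x^* y), so left multiplication by [b] on vectors is
    precomposition with [star b] on functionals; this form makes sense on the whole completion. *)
Definition gns_op b (f : gns_space) : gns_space := HComp (gns_op_subproof b f).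

Lemma gns_representation : @representation R A gns_space gns_op.
Proof.
split.
- move=> b; have lin : linear (gns_op b) by move=> a f h; apply: val_inj.
  split => //; have [C C0 hC] := gns_bound (star b).
  apply: (bounded_continuous (K := C)) => // f; rewrite !rn_hcomp.
  apply: sn_hcomp_le; first by rewrite mulr_ge0 ?sn_ge0.
  move=> y; apply: le_trans (rn_hval f (star b ** y)) _.
  by rewrite [C * _]mulrC -mulrA ler_wpM2l ?sn_ge0.
- move=> a b c f; apply/val_inj/funext => x /=.
  by rewrite starP amulPl hval_antilinear conjCK.
- by move=> b c f; apply/val_inj/funext => x /=; rewrite starM amulA.
- move=> b f h; apply/eqP; rewrite -subr_eq0; apply/eqP.
  have [C1 C10 h1] := gns_approx (star b); have [C2 C20 h2] := gns_approx b.
  have D0 : 0 <= C1 + C2 + 1 by rewrite !addr_ge0.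
  have [K1 K10 k1] := hdotcP (gns_op (star b) f) h D0.
  have [K2 K20 k2] := hdotcP f (gns_op b h) D0.
  apply: (@rn_small R R[i]^o _ ((K1 + K2) * (C1 + C2 + 1))) => e e0.
  pose t := Num.min e 1; have t0 : 0 < t by rewrite lt_min e0 ltr01.
  have t1 : t <= 1 by rewrite ge_min lexx orbT.
  have te : t <= e by rewrite ge_min lexx.
  have [y fy] := @approx_ex _ _ gns_dot f _ t0.
  have [z hz] := @approx_ex _ _ gns_dot h _ t0.
  pose s := t * (C1 + C2 + 1).
  have s0 : 0 <= s by rewrite mulr_ge0 // ltW.
  have sD : s <= C1 + C2 + 1 by rewrite ler_piMl.
  have wk (phi : A -> R[i]^o) u d : approximates gns_dot phi u d -> d <= s ->
      approximates gns_dot phi u s.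
    by move=> hu ds x; apply: le_trans (hu x) _; rewrite ler_wpM2r ?sn_ge0.
  have ts : t <= s by rewrite ler_peMr ?(ltW t0) // lerDr addr_ge0.
  have b1 := k1 _ _ _ s0 sD (wk _ _ _ (h1 _ _ _ (ltW t0) fy) _) (wk _ _ _ hz ts).
  have b2 := k2 _ _ _ s0 sD (wk _ _ _ fy ts) (wk _ _ _ (h2 _ _ _ (ltW t0) hz) _).
  apply: le_trans (_ : (K1 + K2) * s <= _); last first.
    by rewrite /s mulrCA mulrC ler_wpM2l // ?mulr_ge0 // addr_ge0.
  apply: le_trans (rn_tri (gns_dot (star b ** y) z : R[i]^o) _ _) _.
  rewrite mulrDl; apply: lerD.
    by apply: b1; rewrite ler_wpM2l ?(ltW t0) // -addrA lerDl addr_ge0.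
  have -> : gns_dot (star b ** y) z = gns_dot y (b ** z) by rewrite /= starM amulA.
  rewrite rn_distC; apply: b2.
  by rewrite ler_wpM2l ?(ltW t0) // addrAC lerDr addr_ge0.
Qed.

End GNS.

Section GelfandNaimark.
Context {R : realType} (A : unitalCstarType R).

(** The inequality x^* x <= r^2 as a sum of squares: y = r (1 - g) with (1 - g)^2 = 1 - x^* x /
    r^2. *)
Lemma contractive_defect (x : A) (r : R) : rn x < r ->
  exists y : A, (r ^+ 2)%:C *: aone = star x ** x + star y ** y.
Proof.
move=> xr; have r0 : 0 < r by apply: le_lt_trans xr; exact: rn_ge0.
pose h := ((r ^+ 2)^-1)%:C *: (star x ** x).
have r2 : 0 < r ^+ 2 by rewrite exprn_gt0.
have [||g [sg gE _ _]] := @sqrt_cstar R A h.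
- by rewrite starZr starM starK.
- rewrite rnZr gtr0_norm ?invr_gt0 // rn_star_amul mulrC ltr_pdivrMr // mul1r.
  by rewrite ltr_pXn2r ?nnegrE ?rn_ge0 // ltW.
exists (r%:C *: (aone - g)).
have -> : star x ** x = (r ^+ 2)%:C *: h.
  by rewrite scalerA -rmorphM /= mulfV ?gt_eqF // scale1r.
rewrite starZr starB star1 sg amulZl amulZr scalerA -rmorphM /= -expr2 -gE.
by rewrite !amulE amul1a amula1 amul1a; lmod.
Qed.

(** For r > |b| the identity r^2 - b^* b = z^* z gives the bound with [r]; then [r] decreases to
    |b|. *)
Lemma positive_functional_bound (F : A -> R[i]) (b y : A) :
  (forall (a : R[i]) y z, F (a *: y + z) = a * F y + F z) ->
  (forall y, 0 <= F (star y ** y)) ->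
  complex.Re (F (star (b ** y) ** (b ** y))) <= rn b ^+ 2 * complex.Re (F (star y ** y)).
Proof.
move=> FL F0.
have lim (r : R) : rn b < r ->
    complex.Re (F (star (b ** y) ** (b ** y))) <= r ^+ 2 * complex.Re (F (star y ** y)).
  move=> /contractive_defect [z zE]; rewrite -subr_ge0 -Re_realM -ReN -ReD.
  have -> : (r ^+ 2)%:C * F (star y ** y) - F (star (b ** y) ** (b ** y)) =
      F (star (z ** y) ** (z ** y)).
    have -> : star (z ** y) ** (z ** y) = (r ^+ 2)%:C *: (star y ** y) +
         ((-1 : R[i]) *: (star (b ** y) ** (b ** y)) + 0).
      have : star y ** ((r ^+ 2)%:C *: aone) ** y =
        star y ** (star b ** b + star z ** z) ** y by rewrite zE.
      rewrite amulZr amulZl amula1 amulDr amulDl !starM !amulA => ->.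
      by lmod.
    rewrite FL FL; have -> : F 0 = 0.
      by have := FL (-1) 0 0; rewrite scaler0 addr0 mulN1r addNr.
    by rewrite mulN1r addr0.
  exact: Re_ge0.
apply/ler_addgt0Pr => e e0.
set u := complex.Re _; set v := complex.Re _.
have v0 : 0 <= v by apply: Re_ge0.
pose t := Num.min 1 (e / (v * (rn b *+ 2 + 1) + 1)).
have c0 : 0 < v * (rn b *+ 2 + 1) + 1.
  by rewrite ltr_wpDl // mulr_ge0 // addr_ge0 // mulrn_wge0 // rn_ge0.
have t0 : 0 < t by rewrite lt_min ltr01 /= divr_gt0.
have t1 : t <= 1 by rewrite ge_min lexx.
have t2 : t * (v * (rn b *+ 2 + 1) + 1) <= e by rewrite -ler_pdivlMr // ge_min lexx orbT.
have := lim (rn b + t); rewrite ltrDl t0 => /(_ isT); rewrite -/u -/v.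
move: (rn_ge0 b) t2; rewrite !mulr2n; move: (rn b) => w w0 t2; nra.
Qed.

(** F is real at the squares of 1 + a y, hence at a y + star (a y); the cases a = 1 and a = i
    determine F at [star y]. *)
Lemma hermitian_functional (F : A -> R[i]) :
  (forall (a : R[i]) y z, F (a *: y + z) = a * F y + F z) ->
  (forall y, 0 <= F (star y ** y)) -> forall y, F (star y) = (F y)^*.
Proof.
move=> FL F0 y.
have FD u v : F (u + v) = F u + F v by have := FL 1 u v; rewrite scale1r mul1r.
have F00 : F 0 = 0 by apply: (addrI (F 0)); rewrite -FD !addr0.
have FZ a u : F (a *: u) = a * F u by have := FL a u 0; rewrite F00 !addr0.
have real (z : R[i]) : 0 <= z -> z^* = z by move=> /ReP ->; rewrite conj_realC.
have h (a : R[i]) : (a * F y + a^* * F (star y))^* = a * F y + a^* * F (star y).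
  have : star (aone + a *: y) ** (aone + a *: y) =
      star (aone : A) ** aone + (star (a *: y) ** (a *: y) + (a *: y + a^* *: star y)).
    by rewrite starD star1 starZ !(amulDl, amulDr) amul1a amula1 amul1a; lmod.
  move=> /(congr1 F); rewrite !FD !FZ => E.
  have -> : a * F y + a^* * F (star y) = F (star (aone + a *: y) ** (aone + a *: y)) -
     F (star (aone : A) ** aone) - F (star (a *: y) ** (a *: y)) by rewrite E; ring.
  by rewrite !rmorphB /= !real.
have := h 1; have := h 'i; rewrite rmorph1 conj_i !mul1r !rmorphD !rmorphM rmorphN /= conj_i.
have i2 : ('i : R[i]) * 'i = -1 by rewrite -expr2 sqr_i.
move=> /(congr1 (fun z => 'i * z)).
move: (F y) (F (star y)) (F y)^* (F (star y))^* => u v u' v' e1 e2.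
have {e1} e1 : u' - v' = v - u.
  have E1 : 'i * (- 'i * u' + - - 'i * v') = - ('i * 'i) * (u' - v') by ring.
  have E2 : 'i * ('i * u + - 'i * v) = ('i * 'i) * (u - v) by ring.
  by move: e1; rewrite E1 E2 i2 opprK mul1r mulN1r opprB.
have : u' *+ 2 = v *+ 2.
  transitivity ((u' + v') + (u' - v')); first by ring.
  by rewrite e2 e1; ring.
by move/eqP; rewrite eqrMn2r => /eqP.
Qed.

(** A state with F(x^* x) = |x|^2 makes the cyclic vector attain the norm of [x]. The zero algebra
    has no state; F = 0 serves there, which is why |xi| is only bounded by 1. *)
Theorem gelfand_naimark (x : A) : exists (H : hilbertType R) (rho : A -> H -> H) (xi : H),
  [/\ representation rho, forall h, rho aone h = h,
      rn xi <= 1 & rn (rho x xi) = rn x].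
Proof.
have [F [FL F0 F1 Fx]] : exists F : A -> R[i],
  [/\ forall (a : R[i]) y z, F (a *: y + z) = a * F y + F z, forall y, 0 <= F (star y ** y),
      complex.Re (F aone) <= 1 & F (star x ** x) = (rn x ^+ 2)%:C].
  have [n1|n1] := pselect ((aone : A) = 0).
    exists (fun=> 0); split => //; first by move=> *; rewrite mulr0 addr0.
    by rewrite -[x]amul1a n1 amul0l rn0 expr0n.
  by have [F [? ? F1 ?]] := state_exists x n1; exists F; split; rewrite // F1.
have FC := hermitian_functional FL F0.
have Fb b : exists2 C : R, 0 <= C & forall y,
    complex.Re (F (star (b ** y) ** (b ** y))) <= C ^+ 2 * complex.Re (F (star y ** y)).
  by exists (rn b); rewrite ?rn_ge0 // => y; apply: positive_functional_bound.
pose g := gns_dot FL F0 FC.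
exists (gns_space FL F0 FC), (gns_op Fb), (hcomp_in g aone); split.
- exact: gns_representation.
- by move=> f; apply/val_inj/funext => y /=; rewrite star1 amul1a.
- rewrite rn_hcomp sn_hcomp_in -(@ler_pXn2r _ 2) ?nnegrE ?sn_ge0 // sn_sqr /=.
  by rewrite star1 amul1a expr1n.
have -> : gns_op Fb x (hcomp_in g aone) = hcomp_in g x.
  by apply/val_inj/funext => y /=; rewrite starM starK amula1.
rewrite rn_hcomp sn_hcomp_in; apply/eqP; rewrite -(@eqrXn2 _ 2) ?sn_ge0 ?rn_ge0 //.
by rewrite sn_sqr /= Fx.
Qed.
End GelfandNaimark.

(** * Representations and orthonormal families *)

Section Representations.
Context {R : realType} (B : cstarType R) (H : hilbertType R) (pi : B -> H -> H).
Hypothesis rpi : representation pi.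
Implicit Types (b c : B) (x y : H).

Lemma rep_lin b : linear (pi b).
Proof. by have [h _ _ _] := rpi; have [] := h b. Qed.

Lemma rep_linl x : linear (pi^~ x).
Proof. by have [_ h _ _] := rpi; move=> a b c; rewrite h. Qed.

Lemma repM b c x : pi (b ** c) x = pi b (pi c x).
Proof. by have [_ _ h _] := rpi. Qed.

Lemma rep_star b x y : hd H (pi (star b) x) y = hd H x (pi b y).
Proof. by have [_ _ _ h] := rpi; exact: h. Qed.

Lemma rep_star' b x y : hd H (pi b x) y = hd H x (pi (star b) y).
Proof. by rewrite -rep_star starK. Qed.

(** For r > |b|, r^2 - b^* b = r^2 (1 - g)^2 holds in the unitization; on vectors this reads r^2
    |x|^2 - |pi b x|^2 = r^2 |x - pi g x|^2, which makes sense without a unit in [B]. *)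
Lemma rn_rep b x : rn (pi b x) <= rn b * rn x.
Proof.
have lim (r : R) : rn b < r -> rn (pi b x) <= r * rn x.
  move=> br; have r0 : 0 < r by apply: le_lt_trans br; exact: rn_ge0.
  have r2 : 0 < r ^+ 2 by rewrite exprn_gt0.
  have [||g [sg gE _ _]] := @sqrt_cstar R B (((r ^+ 2)^-1)%:C *: (star b ** b)).
  - by rewrite starZr starM starK.
  - rewrite rnZr gtr0_norm ?invr_gt0 // rn_star_amul mulrC ltr_pdivrMr // mul1r.
    by rewrite ltr_pXn2r ?nnegrE ?rn_ge0 // ltW.
  have bE : star b ** b = (r ^+ 2)%:C *: (g + g - g ** g).
    by rewrite gE scalerA -rmorphM /= mulfV ?gt_eqF // scale1r.
  rewrite -(@ler_pXn2r _ 2) ?nnegrE ?mulr_ge0 ?rn_ge0 ?(ltW r0) // exprMn.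
  rewrite -!sn_hd !sn_sqr -subr_ge0 -Re_realM -ReN -ReD.
  have -> : (r ^+ 2)%:C * hd H x x - hd H (pi b x) (pi b x) =
     (r ^+ 2)%:C * hd H (x - pi g x) (x - pi g x).
    rewrite -rep_star -repM bE (linZ (rep_linl x)) sdotZl -mulrBr; congr (_ * _).
    rewrite (linB (rep_linl x)) (linD (rep_linl x)) repM sdotBl sdotDl.
    rewrite !sdotBl !sdotBr -(rep_star g x x) sg -(rep_star g (pi g x) x) sg; ring.
  by rewrite Re_realM mulr_ge0 ?(ltW r2) // Re_ge0 // sdot_ge0.
apply/ler_addgt0Pr => e e0; have x1 : 0 < rn x + 1 by rewrite ltr_wpDl ?rn_ge0.
have := lim (rn b + e / (rn x + 1)); rewrite ltrDl divr_gt0 // => /(_ isT) /le_trans; apply.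
rewrite mulrDl lerD2l mulrAC ler_pdivrMr // ler_wpM2l ?(ltW e0) // lerDl //.
Qed.

End Representations.

Section GramSchmidt.
Context {R : realType} (K : hilbertType R).
Implicit Types (x y e : K) (es : seq K).

Fixpoint onseq es : Prop :=
  if es is e :: es' then
    [/\ hd K e e = 1, forall f, f \in es' -> hd K e f = 0 & onseq es'] else True.

Definition onproj es x := \sum_(e <- es) hd K x e *: e.

Lemma proj_dot es x e : onseq es -> e \in es -> hd K (onproj es x) e = hd K x e.
Proof.
elim: es => // f es ih [ff fo oes]; rewrite inE /onproj big_cons sdotDl sdotZl => h.
have z g : g \in es -> hd K g f = 0 by move=> /fo fg; rewrite sdotC fg rmorph0.
case/orP: h => [/eqP ->|ees]; last by rewrite fo // mulr0 add0r; exact: ih.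
rewrite ff mulr1 sdot_suml big_seq big1 ?addr0 // => g ges.
by rewrite sdotZl z // mulr0.
Qed.

Lemma proj_orth es x e : onseq es -> e \in es -> hd K (x - onproj es x) e = 0.
Proof. by move=> o h; rewrite sdotBl proj_dot // subrr. Qed.

Lemma dot_proj es x y : hd K x (onproj es y) = \sum_(e <- es) hd K x e * hd K e y.
Proof.
rewrite /onproj sdot_sumr; apply: eq_bigr => e _.
by rewrite sdotZr -sdotC mulrC.
Qed.

Lemma orth_complement_dot es x y : onseq es ->
  hd K (x - onproj es x) (y - onproj es y) =
  hd K x y - \sum_(e <- es) hd K x e * hd K e y.
Proof.
move=> o; rewrite sdotBr -dot_proj.
have -> : hd K (x - onproj es x) (onproj es y) = 0.
  rewrite dot_proj big_seq big1 // => e ees; by rewrite proj_orth // mul0r.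
rewrite subr0 sdotBl; congr (_ - _).
rewrite (sdotC _ y (onproj es x)) !dot_proj rmorph_sum; apply: eq_bigr => e _.
by rewrite rmorphM /= !hdotE -!sdotC mulrC.
Qed.

(** The given family is kept inside the new one: the slice under study must remain among the s_i
    when the family grows. *)
Lemma gram_schmidt es0 (xs : seq K) : onseq es0 -> exists es,
  [/\ onseq es, {subset es0 <= es} & forall x, x \in xs -> onproj es x = x].
Proof.
move=> o0; elim: xs => [|x xs [es [oes sub pes]]]; first by exists es0; split.
pose r := x - onproj es x.
have [r0|r0] := pselect (r = 0).
  exists es; split => // y; rewrite inE => /orP[/eqP ->|]; last exact: pes.
  by apply/eqP; rewrite eq_sym -subr_eq0; apply/eqP.
have rp := rn_gt0 r0.
pose e := ((rn r)^-1)%:C *: r.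
have eo f : f \in es -> hd K e f = 0.
  by move=> fes; rewrite /e sdotZl proj_orth // mulr0.
have rr : hd K r r = (rn r ^+ 2)%:C by rewrite sdotE sn_hd.
have ee : hd K e e = 1.
  rewrite /e sdotZl sdotZr conj_realC rr -!rmorphM /=.
  by rewrite (_ : _ * _ = 1) ?rmorph1 //; field; rewrite gt_eqF.
exists (e :: es); split => //.
  by move=> f /sub; rewrite inE orbC => ->.
have pE y : onproj (e :: es) y = hd K y e *: e + onproj es y by rewrite /onproj big_cons.
have pe y : hd K (onproj es y) e = 0.
  rewrite /onproj sdot_suml big_seq big1 // => f fes.
  by rewrite sdotZl (sdotC _ e f) eo // rmorph0 mulr0.
move=> y; rewrite inE pE => /orP[/eqP ->|yxs].
  have -> : hd K x e *: e = r.
    have -> : hd K x e = hd K r e by rewrite /r sdotBl pe subr0.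
    rewrite /e sdotZr conj_realC rr scalerA -!rmorphM /=.
    by rewrite (_ : _ * _ = 1) ?rmorph1 ?scale1r //; field; rewrite gt_eqF.
  by rewrite /r subrK.
by rewrite pes // -(pes _ yxs) pe scale0r add0r pes.
Qed.

End GramSchmidt.

(** * Inner products of finite sums of elementary tensors *)

Section TensorDot.
Context {R : realType} (K L : hilbertType R).
Implicit Types (u v : seq (K * L)).

(** Expanding the left legs in an orthonormal family turns the inner product into a sum of squared
    norms. Positivity, and the bounds for maps acting on one leg, follow at once. *)
Lemma tensor_dotE es u : (forall p, p \in u -> onproj es p.1 = p.1) ->
  tensor_dot u u = \sum_(e <- es) hd L (\sum_(p <- u) hd K p.1 e *: p.2)
                                       (\sum_(p <- u) hd K p.1 e *: p.2).
Proof.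
move=> pu; rewrite /tensor_dot.
under [RHS]eq_bigr => e _.
  rewrite sdot_suml; under eq_bigr => p _ do
    (rewrite sdotZl sdot_sumr; under eq_bigr => q _ do rewrite sdotZr -sdotC).
  over.
rewrite [RHS]exchange_big /= big_seq [RHS]big_seq; apply: eq_bigr => p pin.
under [RHS]eq_bigr => e _ do rewrite big_distrr /=.
rewrite [RHS]exchange_big /= big_seq [RHS]big_seq; apply: eq_bigr => q qin.
rewrite -[in LHS](pu _ qin) hdotE dot_proj big_distrl /=.
by apply: eq_bigr => e _; rewrite -mulrA.
Qed.

Lemma tensor_dot_ge0 u : 0 <= tensor_dot u u.
Proof.
have [es [_ _ pes]] := @gram_schmidt R K [::] (map fst u) I.
rewrite (@tensor_dotE es); last by move=> p pu; apply/pes/map_f.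
by apply: sumr_ge0 => e _; exact: sdot_ge0.
Qed.

(** Once z/|z| belongs to the orthonormal family, the left side involves a single term of the sum in
    [tensor_dotE]. *)
Lemma tensor_cauchy_schwarz u (z : K) (h : L) :
  rn (\sum_(p <- u) hd K p.1 z * hd L p.2 h) ^+ 2 <=
  complex.Re (tensor_dot u u) * (rn z * rn h) ^+ 2.
Proof.
have [z0|z0] := pselect (z = 0).
  rewrite z0 big1 ?rn0 ?mul0r ?expr0n /= ?mulr0 // => p _.
  by rewrite !hdotE sdot0r mul0r.
have zp := rn_gt0 z0; pose e0 := ((rn z)^-1)%:C *: z.
have oe0 : onseq [:: e0].
  split=> //; rewrite /e0 sdotZl sdotZr conj_realC sdotE sn_hd -!rmorphM /=.
  by rewrite (_ : _ * _ = 1) ?rmorph1 //; field; rewrite gt_eqF.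
have [es [oes sub pes]] := gram_schmidt (map fst u) oe0.
have e0es : e0 \in es by apply: sub; rewrite inE.
rewrite (@tensor_dotE es); last by move=> p pu; apply/pes/map_f.
pose X e := \sum_(p <- u) hd K p.1 e *: p.2.
have -> : \sum_(p <- u) hd K p.1 z * hd L p.2 h = (rn z)%:C * hd L (X e0) h.
  rewrite /X sdot_suml big_distrr /=; apply: eq_bigr => p _.
  rewrite !hdotE sdotZl mulrA; congr (_ * _).
  by rewrite /e0 sdotZr conj_realC mulrA -rmorphM /= mulfV ?gt_eqF // mul1r.
rewrite rnM rn_real gtr0_norm // !exprMn [leRHS]mulrCA; apply: ler_wpM2l; first exact: sqr_ge0.
apply: le_trans (_ : (rn h * sn (hd L) (X e0)) ^+ 2 <= _).
  rewrite ler_pXn2r ?nnegrE ?mulr_ge0 ?rn_ge0 ?sn_ge0 // mulrC -sn_hd.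
  exact: cauchy_schwarz.
rewrite exprMn mulrC; apply: ler_wpM2r; first exact: sqr_ge0.
rewrite sn_sqr (big_rem e0 e0es) /= ReD lerDl.
by apply/Re_ge0/sumr_ge0 => e _; exact: hdot_ge0.
Qed.

End TensorDot.

(** [Z] only parametrizes a dense subspace through [N]: for tensor products, sequences of pairs
    standing for sums. The bound makes L z depend on N z alone. *)
Lemma dense_extension (R : realType) (V : normedModType R[i]) (W : completeNormedModType R[i])
    (Z : Type) (N : Z -> V) (L : Z -> W) (M : R) : 0 <= M ->
  (forall t e, 0 < e -> exists z, rn (t - N z) < e) ->
  (forall (a : R[i]) z1 z2, exists z, N z = a *: N z1 + N z2 /\ L z = a *: L z1 + L z2) ->
  (forall z, rn (L z) <= M * rn (N z)) ->
  exists s : V -> W, [/\ linear s, forall t, rn (s t) <= M * rn t & forall z, s (N z) = L z].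
Proof.
move=> M0 dN lin bd.
have diff z1 z2 : rn (L z1 - L z2) <= M * rn (N z1 - N z2).
  have [z [Nz Lz]] := lin (-1) z2 z1.
  by have := bd z; rewrite Nz Lz !scaleN1r [- L _ + _]addrC [- N _ + _]addrC.
have ex t : exists y, forall z, rn (y - L z) <= M * rn (t - N z).
  have pos n : 0 < (n.+1%:R : R)^-1 by rewrite invr_gt0.
  have small e : 0 < e -> exists n0, forall n, (n0 <= n)%N -> (n.+1%:R : R)^-1 < e.
    move=> e0; exists (Num.truncn e^-1) => n hn.
    rewrite -[ltRHS]invrK ltf_pV2 ?posrE ?invr_gt0 //.
    by apply: lt_le_trans (truncnS_gt _) _; rewrite ler_nat ltnS.
  have /choice [u hu] : forall n : nat, exists z, rn (t - N z) < n.+1%:R^-1.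
    by move=> n; apply: dN.
  have M1 : 0 < M + 1 by rewrite ltr_wpDl.
  have [e e0|y hy] := @cauchy_rn R W (L \o u).
    have [|n0 hn0] := small (e / 2 / (M + 1)); first by rewrite !divr_gt0.
    exists n0 => m n hm hn /=; apply: le_lt_trans (diff _ _) _.
    apply: le_lt_trans (_ : (M + 1) * rn (N (u m) - N (u n)) < _).
      by rewrite ler_wpM2r ?rn_ge0 // lerDl.
    rewrite -ltr_pdivlMl // mulrC; apply: le_lt_trans (rn_tri t _ _) _.
    have -> : e / (M + 1) = e / 2 / (M + 1) + e / 2 / (M + 1).
      by rewrite -mulrDl -splitr.
    apply: ltrD; last exact: lt_trans (hu _) (hn0 _ hn).
    by rewrite rn_distC; apply: lt_trans (hu _) (hn0 _ hm).
  exists y => z; apply/ler_addgt0Pr => e e0.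
  have e2 : 0 < e / 2 by rewrite divr_gt0.
  have [n1 h1] := hy _ e2; have [|n2 h2] := small (e / 2 / (M + 1)).
    by rewrite divr_gt0.
  pose n := maxn n1 n2.
  apply: le_trans (rn_tri (L (u n)) _ _) _.
  have b1 : rn (y - L (u n)) <= e / 2 by apply/ltW/h1; exact: leq_maxl.
  have b2 : rn (L (u n) - L z) <= M * rn (t - N z) + M * rn (t - N (u n)).
    apply: le_trans (diff _ _) _; rewrite -mulrDr ler_wpM2l //.
    by apply: le_trans (rn_tri t _ _) _; rewrite rn_distC addrC.
  have b3 : M * rn (t - N (u n)) <= e / 2.
    apply: le_trans (_ : (M + 1) * (e / 2 / (M + 1)) <= _).
      apply: ler_pM; rewrite ?rn_ge0 ?lerDl //.
      by apply/ltW/(lt_trans (hu n))/h2; exact: leq_maxr.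
    by rewrite mulrC divfK // gt_eqF.
  by have := splitr e; lra.
have /choice [s hs] := ex.
have uniq t y : (exists2 K, 0 <= K & forall z, rn (y - L z) <= K * rn (t - N z)) -> y = s t.
  move=> [K K0 hK]; apply/eqP; rewrite -subr_eq0; apply/eqP.
  apply: (@rn_small R W _ (K + M)) => e e0; have [z hz] := dN t e e0.
  apply: le_trans (rn_tri (L z) _ _) _; rewrite mulrDl; apply: lerD.
    by apply: le_trans (hK z) _; rewrite ler_wpM2l // ltW.
  by rewrite rn_distC; apply: le_trans (hs t z) _; rewrite ler_wpM2l // ltW.
have sN z : s (N z) = L z by symmetry; apply: uniq; exists M => // z'; exact: diff.
exists s; split => //.
- move=> a t t'; apply/eqP; rewrite -subr_eq0; apply/eqP.
  apply: (@rn_small R W _ (M * (rn a + 1) *+ 2)) => e e0.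
  have [z hz] := dN t e e0; have [z' hz'] := dN t' e e0.
  have [w [Nw Lw]] := lin a z z'.
  have b1 := hs (a *: t + t') w; have b2 := hs t z; have b3 := hs t' z'.
  have -> : s (a *: t + t') - (a *: s t + s t') =
     (s (a *: t + t') - L w) - (a *: (s t - L z) + (s t' - L z')) by rewrite Lw; lmod.
  have c0 : rn (a *: (t - N z) + (t' - N z')) <= (rn a + 1) * e.
    apply: le_trans (rnD _ _) _; rewrite rnZ mulrDl mul1r lerD ?(ltW hz') //.
    by rewrite ler_wpM2l ?rn_ge0 // ltW.
  have c1 : rn (s (a *: t + t') - L w) <= M * ((rn a + 1) * e).
    apply: le_trans b1 _; rewrite ler_wpM2l //; apply: le_trans c0.
    by rewrite le_eqVlt; apply/orP; left; apply/eqP; congr rn; rewrite Nw; lmod.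
  have c2 : rn (a *: (s t - L z) + (s t' - L z')) <= M * ((rn a + 1) * e).
    apply: le_trans (rnD _ _) _; rewrite rnZ mulrCA mulrDl mul1r; apply: lerD.
      rewrite ler_wpM2l ?rn_ge0 //; apply: le_trans b2 _; by rewrite ler_wpM2l // ltW.
    by apply: le_trans b3 _; rewrite ler_wpM2l // ltW.
  by apply: le_trans (rnB _ _) _; rewrite mulr2n mulrDl -mulrA lerD.
- move=> t; apply/ler_addgt0Pr => e e0; have M1 : 0 < M + 1 by rewrite ltr_wpDl.
  have [|z hz] := dN t (e / 2 / (M + 1)); first by rewrite !divr_gt0.
  have c : M * rn (t - N z) <= e / 2.
    apply: le_trans (_ : (M + 1) * (e / 2 / (M + 1)) <= _).
      by apply: ler_pM; rewrite ?rn_ge0 ?lerDl // ltW.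
    by rewrite mulrC divfK // gt_eqF.
  apply: le_trans (rn_sub _ (L z)) _.
  have := hs t z; have := bd z.
  have : M * rn (N z) <= M * rn t + M * rn (t - N z).
    by rewrite -mulrDr ler_wpM2l // rn_distC rn_sub.
  by have := splitr e; lra.
Qed.

(** * Slices by vector functionals *)

Section TensorSums.
Context {R : realType} {C B : cstarType R} (T : minTensor C B).
Implicit Types (c : C) (b : B) (t : T) (z : seq (C * B)).

Definition tsum z : T := \sum_(p <- z) tens T p.1 p.2.

Lemma tsum1 c b : tsum [:: (c, b)] = tens T c b.
Proof. by rewrite /tsum big_seq1. Qed.

Lemma tsum_lin (a : R[i]) z1 z2 :
  tsum ([seq (a *: p.1, p.2) | p <- z1] ++ z2) = a *: tsum z1 + tsum z2.
Proof.
rewrite /tsum big_cat big_map /= scaler_sumr; congr (_ + _).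
by apply: eq_bigr => p _; rewrite (linZ (tensPl T p.2)).
Qed.

Lemma tsum_dense t (e : R) : 0 < e -> exists z, rn (t - tsum z) < e.
Proof.
move=> e0; have : closed_span [set t | exists c b, t = tens T c b] t by rewrite tens_dense.
move=> /closure_rn /(_ e e0) [v [n [a [x [hx ->]]]] h].
have /choice [p hp] : forall i : 'I_n, exists p : C * B, x i = tens T p.1 p.2.
  by move=> i; have [c [b ->]] := hx i; exists (c, b).
exists [seq (a i *: (p i).1, (p i).2) | i <- index_enum 'I_n].
rewrite /tsum big_map /= (eq_bigr (fun i => a i *: x i)) // => i _.
by rewrite (linZ (tensPl T _)) -hp.
Qed.

Lemma tsum_ind (D : set T) : closed D -> (forall z, D (tsum z)) -> forall t, D t.
Proof.
move=> /closed_rn cD h t; apply: cD => e e0.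
by have [z hz] := tsum_dense t e0; exists (tsum z).
Qed.

Lemma tsum_ext (W : normedModType R[i]) (f g : T -> W) (K L : R) :
  (forall s t, rn (f s - f t) <= K * rn (s - t)) ->
  (forall s t, rn (g s - g t) <= L * rn (s - t)) ->
  (forall z, f (tsum z) = g (tsum z)) -> forall t, f t = g t.
Proof.
move=> fK gL fg t; apply/eqP; rewrite -subr_eq0; apply/eqP.
apply: (@tsum_ind [set t | f t - g t = 0]) => [|z]; last by rewrite /= fg subrr.
apply: (@closed_lip R T W _ 0 (K + L)) => x y.
have -> : f x - g x - (f y - g y) = (f x - f y) - (g x - g y) by lmod.
by apply: le_trans (rnB _ _) _; rewrite mulrDl lerD.
Qed.

Lemma star_tsum_mul z z' : star (tsum z') ** tsum z =
  \sum_(q <- z') \sum_(p <- z) tens T (star q.1 ** p.1) (star q.2 ** p.2).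
Proof.
rewrite /tsum star_sum amul_suml; apply: eq_bigr => q _.
by rewrite amul_sumr; apply: eq_bigr => p _; rewrite tens_star tensM.
Qed.

End TensorSums.

Lemma lin_lip (R : realType) (V W : normedModType R[i]) (f : V -> W) (K : R) : linear f ->
  (forall x, rn (f x) <= K * rn x) -> forall x y, rn (f x - f y) <= K * rn (x - y).
Proof. by move=> lf fK x y; rewrite -(linB lf). Qed.

Section Slices.
Context {R : realType} {C : cstarType R} {B : unitalCstarType R} (T : minTensor C B).
Context {K : hilbertType R} {sg : C -> K -> K} (rsg : representation sg).
Implicit Types (x y e : K) (c : C) (b : B) (t : T) (z : seq (C * B)).

(** Take a representation [rho] and a vector [ka] at which the norm of the slice [w] is attained,
    and h = rho w ka. Then |h|^2 is the inner product of (sg (x) rho)(z)(x (x) ka) with y (x) h,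
    which the spatial norm of the sum controls. *)
Lemma slice_bound x y z :
  rn (\sum_(p <- z) hd K (sg p.1 x) y *: p.2) <= rn x * rn y * rn (tsum T z).
Proof.
set w := \sum_(p <- z) _; have [H [rho [ka [rr _ ka1 wka]]]] := gelfand_naimark w.
pose h := rho w ka; have [h0|h0] := pselect (h = 0).
  by rewrite -wka -/h h0 rn0 !mulr_ge0 ?rn_ge0.
have hp := rn_gt0 h0; pose r := rn (tsum T z).
have dE : hd H h h = \sum_(p <- tensor_act sg rho z [:: (x, ka)]) hd K p.1 y * hd H p.2 h.
  have -> : tensor_act sg rho z [:: (x, ka)] = [seq (sg p.1 x, rho p.2 ka) | p <- z].
    by rewrite /tensor_act; elim: (z) => //= p z' ->.
  rewrite big_map /= {1}/h /w (lin_sum (rep_linl rr ka)) !hdotE sdot_suml.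
  by apply: eq_bigr => p _; rewrite !hdotE (linZ (rep_linl rr ka)) sdotZl.
have sp : spatial_norm_le z r by apply: (proj1 (tens_norm T z (rn_ge0 _))); rewrite rn_le.
have := sp K H sg rho rsg rr [:: (x, ka)].
rewrite lecE => /andP[_]; rewrite -rmorphXn /= Re_realM => b1.
have dk : complex.Re (tensor_dot [:: (x, ka)] [:: (x, ka)]) = rn x ^+ 2 * rn ka ^+ 2.
  by rewrite /tensor_dot !big_seq1 /= !hdotE !sdotE !sn_hd -rmorphM.
have := tensor_cauchy_schwarz (tensor_act sg rho z [:: (x, ka)]) y h.
rewrite -dE sdotE sn_hd rn_real ger0_norm ?sqr_ge0 // => b2.
rewrite -wka -/h.
have b3 : (rn h ^+ 2) ^+ 2 <= (r * rn x * rn ka * (rn y * rn h)) ^+ 2.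
  apply: le_trans b2 _; rewrite [leRHS]exprMn; apply: ler_wpM2r; first exact: sqr_ge0.
  by apply: le_trans b1 _; rewrite dk !exprMn mulrA.
move: b3; rewrite ler_pXn2r ?nnegrE ?sqr_ge0 ?mulr_ge0 ?rn_ge0 // expr2 mulrA ler_pM2r //.
move=> /le_trans; apply; rewrite -/r.
have -> : r * rn x * rn ka * rn y = (rn x * rn y * r) * rn ka by ring.
by rewrite ler_piMr // !mulr_ge0 // rn_ge0.
Qed.

Lemma vslice_ex x y : exists s : T -> B, [/\ linear s,
  forall t, rn (s t) <= rn x * rn y * rn t &
  forall z, s (tsum T z) = \sum_(p <- z) hd K (sg p.1 x) y *: p.2].
Proof.
apply: dense_extension; first by rewrite mulr_ge0 ?rn_ge0.
- exact: tsum_dense.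
- move=> a z1 z2; exists ([seq (a *: p.1, p.2) | p <- z1] ++ z2).
  rewrite tsum_lin; split => //; rewrite big_cat big_map /= scaler_sumr; congr (_ + _).
  by apply: eq_bigr => p _; rewrite !hdotE (linZ (rep_linl rsg x)) sdotZl scalerA.
- exact: slice_bound.
Qed.

(* [vslice x y] is the slice map of the vector functional [c |-> <sg c x, y>]. *)
Definition vslice x y : T -> B := sval (cid (vslice_ex x y)).

Lemma vslice_linear x y : linear (vslice x y).
Proof. by rewrite /vslice; case: cid => s []. Qed.

Lemma vslice_bound x y t : rn (vslice x y t) <= rn x * rn y * rn t.
Proof. by rewrite /vslice; case: cid => s [] /=. Qed.

Lemma vslice_tsum x y z : vslice x y (tsum T z) = \sum_(p <- z) hd K (sg p.1 x) y *: p.2.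
Proof. by rewrite /vslice; case: cid => s [] /=. Qed.

Lemma vslice_tens x y c b : vslice x y (tens T c b) = hd K (sg c x) y *: b.
Proof. by rewrite -tsum1 vslice_tsum big_seq1. Qed.

Let vlip x y := lin_lip (vslice_linear x y) (vslice_bound x y).

Let mull_lip (s : T) t t' : rn (s ** t - s ** t') <= rn s * rn (t - t').
Proof. by rewrite -amulBr rn_amul. Qed.

Let mulr_lip (s : T) t t' : rn (t ** s - t' ** s) <= rn s * rn (t - t').
Proof. by rewrite -amulBl mulrC rn_amul. Qed.

Lemma vslice_mull x y c t :
  vslice x y (tens T c aone ** t) = vslice x (sg (star c) y) t.
Proof.
move: t; apply: (@tsum_ext R C B T B _ _ (rn x * rn y * rn (tens T c aone)) (rn x * rn (sg (star c) y))).
- move=> s t; apply: le_trans (vlip _ _ _ _) _.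
  by rewrite -[leRHS]mulrA ler_wpM2l ?mulr_ge0 ?rn_ge0.
- exact: vlip.
move=> z; rewrite vslice_tsum {1}/tsum amul_sumr (lin_sum (vslice_linear _ _)).
apply: eq_bigr => p _; rewrite tensM amul1a vslice_tens (repM rsg).
by rewrite (rep_star' rsg).
Qed.

Lemma vslice_mulr x y c t :
  vslice x y (t ** tens T c aone) = vslice (sg c x) y t.
Proof.
move: t; apply: (@tsum_ext R C B T B _ _ (rn x * rn y * rn (tens T c aone)) (rn (sg c x) * rn y)).
- move=> s t; apply: le_trans (vlip _ _ _ _) _.
  by rewrite -[leRHS]mulrA ler_wpM2l ?mulr_ge0 ?rn_ge0.
- exact: vlip.
move=> z; rewrite vslice_tsum {1}/tsum amul_suml (lin_sum (vslice_linear _ _)).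
by apply: eq_bigr => p _; rewrite tensM amula1 vslice_tens (repM rsg).
Qed.

Lemma vslice_star x y t : star (vslice x y t) = vslice y x (star t).
Proof.
move: t; apply: (@tsum_ext R C B T B _ _ (rn x * rn y) (rn y * rn x)).
- by move=> s t; rewrite -starB rn_star; exact: vlip.
- by move=> s t; apply: le_trans (vlip _ _ _ _) _; rewrite -starB rn_star.
move=> z; rewrite vslice_tsum star_sum {1}/tsum star_sum (lin_sum (vslice_linear _ _)).
apply: eq_bigr => p _; rewrite starZ tens_star vslice_tens; congr (_ *: _).
by rewrite (rep_star rsg) -sdotC.
Qed.

Section Defect.
Context {H : hilbertType R} {rho : B -> H -> H} (rrho : representation rho).
Variables (x : K) (ka : H) (es : seq K).
Hypothesis oes : onseq es.

(** The form of ((1 - p) (x) 1)(sg (x) rho)(t)(x (x) ka), with p the projection onto the span of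
    [es], expressed through slices because [t] need not be a finite sum. [QE] is this identity for
    finite sums; positivity passes to the limit. *)
Let Q t t' : R[i] := hd H (rho (vslice x x (star t' ** t)) ka) ka -
  \sum_(e <- es) hd H (rho (vslice x e t) ka) (rho (vslice x e t') ka).

Let Q_linear (a : R[i]) t t' s : Q (a *: t + t') s = a * Q t s + Q t' s.
Proof.
rewrite /Q amulDr amulZr (vslice_linear x x) (rep_linl rrho) sdotPl mulrBr.
rewrite [RHS]addrACA -opprD mulr_sumr -big_split /=; congr (_ - _).
by apply: eq_bigr => e _; rewrite (vslice_linear x e) (rep_linl rrho) !hdotE sdotPl.
Qed.

Let Q_conj t t' : Q t' t = (Q t t')^*.
Proof.
rewrite /Q rmorphB /= rmorph_sum /=; congr (_ - _).
  have -> : star t ** t' = star (star t' ** t) by rewrite starM starK.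
  by rewrite -vslice_star !hdotE (rep_star rrho) sdotC.
by apply: eq_bigr => e _; rewrite !hdotE -sdotC.
Qed.

Let QE z : Q (tsum T z) (tsum T z) = tensor_dot
  [seq (sg p.1 x - onproj es (sg p.1 x), rho p.2 ka) | p <- z]
  [seq (sg p.1 x - onproj es (sg p.1 x), rho p.2 ka) | p <- z].
Proof.
have E1 : hd H (rho (vslice x x (star (tsum T z) ** tsum T z)) ka) ka =
    \sum_(p <- z) \sum_(q <- z) hd K (sg p.1 x) (sg q.1 x) * hd H (rho p.2 ka) (rho q.2 ka).
  rewrite star_tsum_mul (lin_sum (vslice_linear _ _)) (lin_sum (rep_linl rrho ka)).
  rewrite sdot_suml exchange_big /=; apply: eq_bigr => q _.
  rewrite (lin_sum (vslice_linear _ _)) (lin_sum (rep_linl rrho ka)) hdotE sdot_suml.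
  apply: eq_bigr => p _.
  rewrite vslice_tens (linZ (rep_linl rrho ka)) sdotZl (repM rsg) (repM rrho).
  by rewrite (rep_star rsg) (rep_star rrho).
have E2 e : hd H (rho (vslice x e (tsum T z)) ka) (rho (vslice x e (tsum T z)) ka) =
    \sum_(p <- z) \sum_(q <- z) hd K (sg p.1 x) e * hd K e (sg q.1 x) *
      hd H (rho p.2 ka) (rho q.2 ka).
  rewrite vslice_tsum (lin_sum (rep_linl rrho ka)) sdot_suml; apply: eq_bigr => p _.
  rewrite (linZ (rep_linl rrho ka)) sdotZl sdot_sumr mulr_sumr; apply: eq_bigr => q _.
  by rewrite (linZ (rep_linl rrho ka)) sdotZr -sdotC mulrA.
rewrite /Q E1 (eq_bigr _ (fun e _ => E2 e)) [X in _ - X]exchange_big /= -sumrB /tensor_dot !big_map.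
apply: eq_bigr => p _; rewrite [X in _ - X]exchange_big /= -sumrB big_map; apply: eq_bigr => q _.
by rewrite !hdotE orth_complement_dot // mulrBl mulr_suml.
Qed.

Let M := rn x ^+ 2 * rn ka ^+ 2 + \sum_(e <- es) (rn x * rn e * rn ka) ^+ 2.

Let M0 : 0 <= M.
Proof.
by apply: addr_ge0; [rewrite mulr_ge0 ?sqr_ge0|apply: sumr_ge0 => e _; exact: sqr_ge0].
Qed.

Let Q1_bound t t' : rn (hd H (rho (vslice x x (star t' ** t)) ka) ka) <=
  rn x ^+ 2 * rn ka ^+ 2 * (rn t * rn t').
Proof.
apply: le_trans (cauchy_schwarz _ _ _) _; rewrite !sn_hd.
apply: le_trans (ler_wpM2r (rn_ge0 _) (rn_rep rrho _ _)) _.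
rewrite -[leLHS]mulrA -[rn ka * rn ka]expr2 [leRHS]mulrAC.
apply: ler_wpM2r; first exact: sqr_ge0.
apply: le_trans (vslice_bound _ _ _) _; rewrite -expr2; apply: ler_wpM2l; first exact: sqr_ge0.
by apply: le_trans (rn_amul _ _) _; rewrite rn_star mulrC.
Qed.

Let Q_bound t t' : rn (Q t t') <= M * (rn t * rn t').
Proof.
apply: le_trans (rnB _ _) _; rewrite mulrDl; apply: lerD; first exact: Q1_bound.
apply: le_trans (rn_sum _ _) _; rewrite mulr_suml; apply: ler_sum => e _.
apply: le_trans (cauchy_schwarz _ _ _) _; rewrite !sn_hd.
have h s : rn (rho (vslice x e s) ka) <= rn x * rn e * rn ka * rn s.
  apply: le_trans (rn_rep rrho _ _) _; rewrite mulrAC ler_wpM2r ?rn_ge0 //.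
  exact: vslice_bound.
by rewrite expr2 mulrACA ler_pM ?rn_ge0.
Qed.

Let Q_ge0 t : 0 <= Q t t.
Proof.
have Qr : (Q t t)^* = Q t t by rewrite -Q_conj.
have {Qr} Qi : Q t t = (complex.Re (Q t t))%:C.
  move: Qr; case: (Q t t) => a b [] /= /eqP; rewrite eq_sym -addr_eq0 -mulr2n mulrn_eq0 /=.
  by move=> /eqP ->.
rewrite Qi lecR; apply/ler_addgt0Pr => e e0.
pose k := M * (rn t *+ 2 + 1) + 1.
have k0 : 0 < k.
  rewrite ltr_wpDl //; apply: mulr_ge0 => //.
  by rewrite addr_ge0 // mulrn_wge0 // rn_ge0.
pose d := Num.min 1 (e / k); have d0 : 0 < d by rewrite lt_min ltr01 divr_gt0.
have d1 : d <= 1 by rewrite ge_min lexx.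
have dk : d * k <= e by rewrite -ler_pdivlMr // ge_min lexx orbT.
have [z hz] := tsum_dense t d0.
have QL u v s : Q (u - v) s = Q u s - Q v s.
  by rewrite addrC -scaleN1r Q_linear mulN1r addrC.
have QR u v s : Q s (u - v) = Q s u - Q s v.
  by rewrite Q_conj QL rmorphB /= -!Q_conj.
have dif : Q t t - Q (tsum T z) (tsum T z) = Q (t - tsum T z) t + Q (tsum T z) (t - tsum T z).
  by rewrite QL QR; ring.
have : rn (Q t t - Q (tsum T z) (tsum T z)) <= e.
  rewrite dif; apply: le_trans (rnD _ _) _; apply: le_trans dk.
  apply: le_trans (_ : M * (d * rn t) + M * ((rn t + 1) * d) <= _).
    apply: lerD; apply: le_trans (Q_bound _ _) _; rewrite ler_wpM2l //.
      by rewrite ler_wpM2r ?rn_ge0 // ltW.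
    apply: ler_pM; rewrite ?rn_ge0 ?(ltW hz) //.
    apply: le_trans (rn_sub _ t) _; rewrite lerD2l rn_distC.
    by apply: le_trans (ltW hz) d1.
  have -> : d * k = M * (d * rn t) + M * ((rn t + 1) * d) + d by rewrite /k mulr2n; ring.
  by rewrite lerDl ltW.
have Qz : 0 <= Q (tsum T z) (tsum T z) by rewrite QE; exact: tensor_dot_ge0.
have := Re_rn (Q t t - Q (tsum T z) (tsum T z)); rewrite ReD ReN ler_norml => /andP[lo _].
have := Re_ge0 Qz; lra.
Qed.

Definition defect : semiInner T := SemiInner Q_linear Q_conj Q_ge0.

Lemma defectE t : complex.Re (defect t t) =
  complex.Re (hd H (rho (vslice x x (star t ** t)) ka) ka) -
  \sum_(e <- es) rn (rho (vslice x e t) ka) ^+ 2.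
Proof.
rewrite /= /Q ReD ReN; congr (_ - _).
rewrite raddf_sum; apply: eq_bigr => e _.
by rewrite -sn_hd sn_sqr.
Qed.

Lemma defect_tsum z : (forall p, p \in z -> onproj es (sg p.1 x) = sg p.1 x) ->
  sn defect (tsum T z) = 0.
Proof.
move=> pz; rewrite /sn /= QE /tensor_dot big_map big_seq big1 ?sqrtr0 // => p pin.
by rewrite pz // subrr big1 // => q _; rewrite !hdotE sdot0l mul0r.
Qed.

Lemma sn_defect t : sn defect t <= rn x * rn ka * rn t.
Proof.
rewrite -(@ler_pXn2r _ 2) ?nnegrE ?sn_ge0 ?mulr_ge0 ?rn_ge0 // sn_sqr defectE.
apply: le_trans (_ : _ <= rn x ^+ 2 * rn ka ^+ 2 * (rn t * rn t)) _; last by rewrite !exprMn expr2.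
apply: le_trans (le_trans (Re_le_rn _) (Q1_bound t t)).
by rewrite gerBl sumr_ge0 // => e _; exact: sqr_ge0.
Qed.

End Defect.

(** [es] spans the vectors sg(c) x for the terms of one finite sum close to [t], hence depends on
    neither [rho] nor [ka]. This uniformity lets the same family give positivity in [B] and
    smallness in the representation under study. *)
Lemma slice_defect x t (es0 : seq K) (eps : R) : onseq es0 -> 0 < eps ->
  exists es, [/\ onseq es, {subset es0 <= es} &
    forall (H : hilbertType R) (rho : B -> H -> H) (ka : H), representation rho ->
    let q := complex.Re (hd H (rho (vslice x x (star t ** t)) ka) ka) -
      \sum_(e <- es) rn (rho (vslice x e t) ka) ^+ 2 in
    0 <= q /\ q <= (eps * rn ka) ^+ 2].
Proof.
move=> o0 eps0; have x1 : 0 < rn x + 1 by rewrite ltr_wpDl ?rn_ge0.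
have [|z hz] := @tsum_dense _ _ _ T t (eps / (rn x + 1)); first by rewrite divr_gt0.
have [es [oes sub pes]] := gram_schmidt [seq sg p.1 x | p <- z] o0.
exists es; split => // H rho ka rr q.
rewrite /q -(defectE rr x ka oes); split; first exact/Re_ge0/sdot_ge0.
rewrite -sn_sqr ler_pXn2r ?nnegrE ?sn_ge0 ?mulr_ge0 ?rn_ge0 ?(ltW eps0) //.
have -> : t = tsum T z + (t - tsum T z) by rewrite addrC subrK.
apply: le_trans (snD _ _ _) _; rewrite defect_tsum ?add0r; last first.
  by move=> p pz; apply: pes; apply: (map_f (fun p => sg p.1 x)).
apply: le_trans (sn_defect _ _ _ _ _) _.
rewrite mulrAC ler_wpM2r ?rn_ge0 //; apply: le_trans (_ : rn x * (eps / (rn x + 1)) <= _).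
  by rewrite ler_wpM2l ?rn_ge0 // ltW.
by rewrite mulrA ler_pdivrMr // mulrC ler_wpM2l ?(ltW eps0) // lerDl.
Qed.

End Slices.

(** * Positivity tested in representations *)

Section NonnegByRepresentations.
Context {R : realType} (B : unitalCstarType R).

(** Let b = |a| - a. Its form at h lies between 0 and |a| |h|^2, so the Cauchy-Schwarz inequality
    for this form gives |rho(b) ka| <= |a| when |ka| <= 1; at a vector attaining |b| this is |b| <=
    |a|. *)
Lemma nonneg_rep (a : B) : star a = a ->
  (forall (H : hilbertType R) (rho : B -> H -> H) (ka : H), representation rho ->
     0 <= complex.Re (hd H (rho a ka) ka)) -> nonneg a.
Proof.
move=> sa pos; split => //; exists (rn a); first exact: rn_ge0.
have [H [rho [ka [rr r1 k1 <-]]]] := gelfand_naimark (sc B (rn a) - a).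
set b := sc B (rn a) - a; have sb : star b = b by rewrite starB star_sc sa.
have bE h : rho b h = (rn a)%:C *: h - rho a h.
  by rewrite (linB (rep_linl rr h)) (linZ (rep_linl rr h)) r1.
have up h : complex.Re (hd H (rho b h) h) <= rn a * rn h ^+ 2.
  rewrite bE sdotBl sdotZl ReD ReN Re_realM -sn_sqr sn_hd gerBl; exact: pos.
have lo h : 0 <= hd H (rho b h) h.
  have real : (hd H (rho b h) h)^* = hd H (rho b h) h.
    by rewrite -sdotC -(rep_star rr) sb.
  have -> : hd H (rho b h) h = (complex.Re (hd H (rho b h) h))%:C.
    move: real; case: (hd H _ _) => u v [] /= /eqP; rewrite eq_sym -addr_eq0 -mulr2n mulrn_eq0 /=.
    by move=> /eqP ->.
  rewrite lecR bE sdotBl sdotZl ReD ReN Re_realM -sn_sqr sn_hd subr_ge0.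
  apply: le_trans (Re_le_rn _) _; apply: le_trans (cauchy_schwarz _ _ _) _.
  by rewrite !sn_hd expr2 mulrA ler_wpM2r ?rn_ge0 ?rn_rep.
have bL (c : R[i]) h h' k : hd H (rho b (c *: h + h')) k = c * hd H (rho b h) k + hd H (rho b h') k.
  by rewrite (rep_lin rr b) sdotPl.
have bC h k : hd H (rho b k) h = (hd H (rho b h) k)^*.
  by rewrite -sdotC -(rep_star rr) sb.
pose q := SemiInner bL bC lo.
have [->|/eqP x0] := eqVneq (rho b ka) 0; first by rewrite rn0 rn_ge0.
have x1 := rn_gt0 x0.
have cs := cauchy_schwarz q ka (rho b ka).
have e1 : rn (q ka (rho b ka)) = rn (rho b ka) ^+ 2.
  by rewrite /= hdotE sdotE sn_hd rn_real ger0_norm // sqr_ge0.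
have n1 : sn q ka ^+ 2 <= rn a * rn ka ^+ 2 by rewrite sn_sqr; exact: up.
have n2 : sn q (rho b ka) ^+ 2 <= rn a * rn (rho b ka) ^+ 2 by rewrite sn_sqr; exact: up.
have : (rn (rho b ka) ^+ 2) ^+ 2 <= (rn a * rn (rho b ka)) ^+ 2.
  rewrite -e1; apply: le_trans (_ : (sn q ka * sn q (rho b ka)) ^+ 2 <= _).
    by rewrite ler_pXn2r ?nnegrE ?mulr_ge0 ?sn_ge0 ?rn_ge0.
  rewrite exprMn; apply: le_trans (ler_pM (sqr_ge0 _) (sqr_ge0 _) n1 n2) _.
  have -> : rn a * rn ka ^+ 2 * (rn a * rn (rho b ka) ^+ 2) =
     (rn a * rn (rho b ka)) ^+ 2 * rn ka ^+ 2 by ring.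
  by rewrite ler_piMr ?sqr_ge0 // expr_le1 // rn_ge0.
rewrite ler_pXn2r ?nnegrE ?mulr_ge0 ?sqr_ge0 ?rn_ge0 // expr2 ler_pM2r //.
Qed.

End NonnegByRepresentations.

(** * Multipliers and elementary tensors *)

Lemma ler_lim_factor (R : realType) (x y z : R) : 0 <= z ->
  (forall r, x < r -> y <= r * z) -> y <= x * z.
Proof.
move=> z0 h; apply/ler_addgt0Pr => e e0; have z1 : 0 < z + 1 by rewrite ltr_wpDl.
have := h (x + e / (z + 1)); rewrite ltrDl divr_gt0 // => /(_ isT) /le_trans; apply.
by rewrite mulrDl lerD2l mulrAC ler_pdivrMr // ler_wpM2l ?(ltW e0) // lerDl.
Qed.

Lemma closure_subset_closed (R : realType) (V : normedModType R[i]) (X D : set V) :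
  closed D -> X `<=` D -> closure X `<=` D.
Proof.
move=> /closed_rn cD XD v /closure_rn h; apply: cD => e /h [x Xx xv].
by exists x => //; exact: XD.
Qed.

Lemma amul_faithful (R : realType) (T : cstarType R) (u v : T) :
  (forall y, y ** u = y ** v) -> u = v.
Proof.
move=> h; apply/eqP; rewrite -subr_eq0; apply/eqP/rn_eq0/eqP.
by rewrite -sqrf_eq0 -rn_star_amul amulBr h subrr rn0.
Qed.

(** * Adjointable actions on a C*-algebra *)

Section Actions.
Context {R : realType} (C T : cstarType R) (phi : C -> T -> T).
Implicit Types (c : C) (s t : T).
Hypotheses (phi_linl : forall t, linear (phi^~ t))
  (phiM : forall c c' t, phi (c ** c') t = phi c (phi c' t))
  (phi_adj : forall c s t, star (phi c s) ** t = star s ** phi (star c) t).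

Lemma action_linear c : linear (phi c).
Proof.
move=> a s t; apply: amul_faithful => y.
by rewrite -[y]starK -[c]starK !amulDr !amulZr -!phi_adj !amulDr !amulZr.
Qed.

(** p = phi(a) and q = 1 - phi(g), where (1 - g)^2 = 1 - a^2, satisfy p^2 + q^2 = 1. *)
Let contr a t : star a = a -> rn a < 1 -> rn (phi a t) <= rn t.
Proof.
move=> sa a1; have [||g [sg gE _ gD]] := @sqrt_cstar R C (a ** a).
- by rewrite starM sa.
- by rewrite rn_self_sqr // expr_lt1 ?rn_ge0.
have ag : a ** g = g ** a.
  have [|c1 c2 c3] := @commute_closed R C a (a ** a); first by rewrite amulA.
  exact: (gD _ c1 c2 c3).
apply: (@adjointable_contraction R T (phi a) (fun t => t - phi g t)).
- exact: action_linear.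
- by move=> b x y; rewrite action_linear; lmod.
- by move=> x y; rewrite phi_adj sa.
- by move=> x y; rewrite starB amulBl amulBr phi_adj sg.
- by move=> x; rewrite (linB (action_linear a)) -!phiM ag.
- move=> x; rewrite -phiM -gE (linB (phi_linl x)) (linD (phi_linl x)) phiM.
  by rewrite (linB (action_linear g)); lmod.
Qed.

Let contr_sa a t : star a = a -> rn (phi a t) <= rn a * rn t.
Proof.
move=> sa; apply: ler_lim_factor (rn_ge0 t) _ => r ar.
have r0 : 0 < r by apply: le_lt_trans ar; exact: rn_ge0.
have -> : a = r%:C *: ((r^-1)%:C *: a).
  by rewrite scalerA -rmorphM /= mulfV ?gt_eqF // scale1r.
rewrite (linZ (phi_linl t)) rnZr gtr0_norm // ler_pM2l //; apply: contr.
  by rewrite starZr sa.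
by rewrite rnZr gtr0_norm ?invr_gt0 // mulrC ltr_pdivrMr // mul1r.
Qed.

(** Covers at once *-homomorphisms, acting on their target by left multiplication, and morphisms
    into a multiplier algebra: boundedness is automatic for both. *)
Lemma action_bound c t : rn (phi c t) <= rn c * rn t.
Proof.
rewrite -(@ler_pXn2r _ 2) ?nnegrE ?mulr_ge0 ?rn_ge0 //.
rewrite -rn_star_amul phi_adj -phiM exprMn.
apply: le_trans (rn_amul _ _) _; rewrite rn_star -rn_star_amul.
apply: le_trans (ler_wpM2l (rn_ge0 _) (contr_sa t _)) _; first by rewrite starM starK.
by rewrite expr2 mulrCA.
Qed.

End Actions.

Lemma star_hom_bound (R : realType) (A D : cstarType R) (f : A -> D) : star_hom f ->
  forall x, rn (f x) <= rn x.
Proof.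
move=> [lf fM fS] x; have [->|/eqP /rn_gt0 x0] := eqVneq (f x) 0; first by rewrite rn0 rn_ge0.
rewrite -(ler_pM2r x0) -expr2 -rn_amul_star.
rewrite -[rn (f x)]rn_star; apply: (@action_bound R A D (fun a d => f a ** d)) => [t a y z|c c' t|c s t].
- by rewrite lf amulDl amulZl.
- by rewrite fM amulA.
- by rewrite starM fS amulA.
Qed.

Section Multipliers.
Context {R : realType} (A T : cstarType R) (Phi : A -> multiplier T).
Implicit Types (m : multiplier T) (x y t u : T) (a b : A).

Lemma mleft_linear m : linear (mleft m).
Proof.
by move=> a x y; apply: amul_faithful => z; rewrite !(amulDr, amulZr, multiplierP).
Qed.

Lemma mleftM m x y : mleft m (x ** y) = mleft m x ** y.
Proof. by apply: amul_faithful => z; rewrite multiplierP !amulA multiplierP. Qed.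

Lemma mleft_star m x y : star (mleft m x) ** y = star x ** mleft (mstar m) y.
Proof.
by rewrite -[LHS]starK starM starK multiplierP starM.
Qed.

Hypothesis mPhi : cstar_Mor Phi.

Lemma Mor_linear t : linear (fun a => mleft (Phi a) t).
Proof. by move=> c a b; have [-> _ _ _] := mPhi. Qed.

Lemma MorM a b t : mleft (Phi (a ** b)) t = mleft (Phi a) (mleft (Phi b) t).
Proof. by have [_ -> _ _] := mPhi. Qed.

Lemma Mor_star a x y : star (mleft (Phi a) x) ** y = star x ** mleft (Phi (star a)) y.
Proof. by have [_ _ -> _] := mPhi; exact: mleft_star. Qed.

Lemma Mor_bound a t : rn (mleft (Phi a) t) <= rn a * rn t.
Proof. exact: (action_bound Mor_linear MorM Mor_star). Qed.

End Multipliers.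

(** By nondegeneracy, as the unit fixes every Phi(x) t. It is a parameter, since the tensor product
    of unital algebras has a unit without being a declared [unitalCstarType]. *)
Lemma Mor_unit (R : realType) (A T : cstarType R) (one : A) (Phi : A -> multiplier T) :
  left_id one (amul : A -> A -> A) -> cstar_Mor Phi -> forall t, mleft (Phi one) t = t.
Proof.
move=> one_l mPhi t; have [_ _ _ dn] := mPhi.
have cl : closed [set u | mleft (Phi one) u - u = 0].
  apply: (@closed_lip R T T _ 0 (rn one + 1)) => x y.
  have -> : mleft (Phi one) x - x - (mleft (Phi one) y - y) =
      mleft (Phi one) (x - y) - (x - y) by rewrite (linB (mleft_linear _)); lmod.
  by apply: le_trans (rnB _ _) _; rewrite mulrDl mul1r lerD2r Mor_bound.
apply/eqP; rewrite -subr_eq0; apply/eqP.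
have : closed_span [set u | exists x t, u = mleft (Phi x) t] t by rewrite dn.
apply: (closure_subset_closed cl) => u [n [a [x [hx ->]]]] /=.
rewrite (lin_sum (mleft_linear _)) -sumrB big1 // => i _.
have [b [t' ->]] := hx i.
by rewrite (linZ (mleft_linear _)) -(MorM mPhi) one_l subrr.
Qed.

Lemma Mor1 (R : realType) (A : unitalCstarType R) (T : cstarType R)
  (Phi : A -> multiplier T) : cstar_Mor Phi -> forall t, mleft (Phi aone) t = t.
Proof. by apply: Mor_unit => x; exact: amul1a. Qed.

(** * Bounds for elementary tensors *)

Section TensorMaps.
Context {R : realType}.

Lemma tensor_dot_swap (H K : hilbertType R) (u v : seq (H * K)) :
  tensor_dot u v = tensor_dot [seq (p.2, p.1) | p <- u] [seq (p.2, p.1) | p <- v].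
Proof.
rewrite /tensor_dot big_map; apply: eq_bigr => p _; rewrite big_map.
by apply: eq_bigr => q _; rewrite mulrC.
Qed.

Lemma tensor_map_right (H K : hilbertType R) (u : seq (H * K)) (f : K -> K) (r : R) :
  linear f -> (forall x, rn (f x) <= r * rn x) ->
  tensor_dot [seq (p.1, f p.2) | p <- u] [seq (p.1, f p.2) | p <- u] <=
    (r%:C) ^+ 2 * tensor_dot u u.
Proof.
move=> lf fr; have [es [_ _ pes]] := @gram_schmidt R H [::] (map fst u) I.
rewrite !(@tensor_dotE _ _ _ es); first last.
- by move=> _ /mapP[p pu ->]; apply/pes/(map_f fst pu).
- by move=> p pu; apply/pes/map_f.
rewrite mulr_sumr; apply: ler_sum => e _; rewrite big_map /=.
have -> : \sum_(p <- u) hd H p.1 e *: f p.2 = f (\sum_(p <- u) hd H p.1 e *: p.2).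
  by rewrite (lin_sum lf); apply: eq_bigr => p _; rewrite (linZ lf).
rewrite !hdotE; set x := \sum_(p <- u) _; rewrite !sdotE !sn_hd -rmorphXn -rmorphM lecR -exprMn.
have r0 := le_trans (rn_ge0 _) (fr x).
by rewrite ler_pXn2r ?nnegrE ?rn_ge0.
Qed.

Lemma tensor_map_left (H K : hilbertType R) (u : seq (H * K)) (f : H -> H) (r : R) :
  linear f -> (forall x, rn (f x) <= r * rn x) ->
  tensor_dot [seq (f p.1, p.2) | p <- u] [seq (f p.1, p.2) | p <- u] <=
    (r%:C) ^+ 2 * tensor_dot u u.
Proof.
move=> lf fr; rewrite tensor_dot_swap [X in _ * X]tensor_dot_swap.
have -> : [seq (p.2, p.1) | p <- [seq (f p.1, p.2) | p <- u]] =
   [seq (p.1, f p.2) | p <- [seq (p.2, p.1) | p <- u]] by rewrite -!map_comp.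
exact: tensor_map_right.
Qed.

End TensorMaps.

Section TensorUnits.
Context {R : realType} {C : cstarType R} {B : unitalCstarType R} (T : minTensor C B).
Implicit Types (c : C) (b : B) (t : T).

(** The bound is on [c] in all representations and not on its norm, because the element to which
    [slice_of_tensor] applies it is known only through its vector functionals. *)
Lemma tens_left_bound c b (r : R) : 0 <= r ->
  (forall (K : hilbertType R) (sg : C -> K -> K), representation sg ->
     forall x, rn (sg c x) <= r * rn x) -> rn (tens T c b) <= r * rn b.
Proof.
move=> r0 h; have rb0 : 0 <= r * rn b by rewrite mulr_ge0 ?rn_ge0.
rewrite -rn_le.
suff /(tens_norm T _ rb0) : spatial_norm_le [:: (c, b)] (r * rn b) by rewrite big_seq1.
move=> H K pi rho rpi rrho u; rewrite /tensor_act /= cats0.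
have -> : [seq (pi c p.1, rho b p.2) | p <- u] =
    [seq (pi c p.1, p.2) | p <- [seq (p.1, rho b p.2) | p <- u]].
  by rewrite -map_comp.
apply: le_trans (tensor_map_left _ (rep_lin rpi c) (h _ _ rpi)) _.
rewrite rmorphM /= exprMn -[leRHS]mulrA.
apply: ler_wpM2l; first by rewrite -rmorphXn lecR sqr_ge0.
exact: (tensor_map_right _ (rep_lin rrho b) (rn_rep rrho b)).
Qed.

Lemma rn_tens c b : rn (tens T c b) <= rn c * rn b.
Proof. by apply: tens_left_bound (rn_ge0 _) _ => K sg rsg; exact: rn_rep. Qed.

(** [C] has only approximate units, so Phi(u)(e (x) 1) has to take the place of Phi(u). A strict
    neighbourhood involves finitely many tests on each side, hence the list [ts] and the two
    bounds. *)
Lemma tensor_unit (ts : seq T) (eta : R) : 0 < eta -> exists e : C, forall t, t \in ts ->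
  rn (t - tens T e aone ** t) <= eta /\ rn (t - t ** tens T e aone) <= eta.
Proof.
move=> eta0; have d0 : 0 < eta / 4 by rewrite divr_gt0.
have /choice [z hz] : forall t, exists z, rn (t - tsum T z) < eta / 4.
  by move=> t; exact: tsum_dense.
pose N (t : T) := \sum_(p <- z t) rn p.2.
pose M := \sum_(t <- ts) \sum_(p <- z t) rn p.2.
have M0 : 0 <= M by do 2! (apply: sumr_ge0 => ? _); exact: rn_ge0.
have M1 : 0 < M + 1 by rewrite ltr_wpDl.
pose cs := flatten [seq [seq p.1 | p <- z t] | t <- ts].
have [|e [e2 he]] := @approximate_unit R C cs (eta / 4 / (M + 1)); first by rewrite divr_gt0.
have E2 : rn (tens T e aone) <= 2.
  apply: le_trans (rn_tens e (aone : B)) _.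
  by apply: le_trans (ler_wpM2l (rn_ge0 _) (rn_aone B)) _; rewrite mulr1.
exists e => t tts.
have cin p : p \in z t -> rn (p.1 - e ** p.1) <= eta / 4 / (M + 1) /\
    rn (p.1 - p.1 ** e) <= eta / 4 / (M + 1).
  move=> pz; apply: he; apply/flattenP; exists [seq p.1 | p <- z t]; apply: map_f => //.
have NM : N t <= M.
  rewrite /M (big_rem t) //= lerDl; do 2! (apply: sumr_ge0 => ? _); exact: rn_ge0.
have small (f : C -> C) : (forall p, p \in z t -> rn (f p.1) <= eta / 4 / (M + 1)) ->
    rn (\sum_(p <- z t) tens T (f p.1) p.2) <= eta / 4.
  move=> hf; apply: le_trans (rn_sum _ _) _.
  apply: le_trans (_ : eta / 4 / (M + 1) * N t <= _).
    rewrite /N mulr_sumr big_seq [leRHS]big_seq; apply: ler_sum => p pz.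
    by apply: le_trans (rn_tens _ _) _; rewrite ler_wpM2r ?rn_ge0 ?hf.
  rewrite mulrAC ler_pdivrMr // ler_wpM2l ?(ltW d0) //.
  by apply: le_trans NM _; rewrite lerDl.
have close (g : T -> T) : linear g -> (forall x, rn (g x) <= 3 * rn x) ->
    rn (g (tsum T (z t))) <= eta / 4 -> rn (g t) <= eta.
  move=> lg g3 gz; have -> : g t = g (tsum T (z t)) + g (t - tsum T (z t)).
    by rewrite -(linD lg) addrC subrK.
  apply: le_trans (rnD _ _) _; have := g3 (t - tsum T (z t)); have := hz t; lra.
split; apply: (close (fun x => x - _)).
- by move=> a x y; rewrite amulDr amulZr; lmod.
- move=> x; apply: le_trans (rnB _ _) _; have := rn_amul (tens T e aone) x.
  by have := rn_ge0 x; nra.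
- have -> : tsum T (z t) - tens T e aone ** tsum T (z t) =
      \sum_(p <- z t) tens T (p.1 - e ** p.1) p.2.
    rewrite /tsum amul_sumr -sumrB; apply: eq_bigr => p _.
    by rewrite tensM amul1a (linB (tensPl T _)).
  by apply: (small (fun c => c - e ** c)) => p /cin [].
- by move=> a x y; rewrite amulDl amulZl; lmod.
- move=> x; apply: le_trans (rnB _ _) _; have := rn_amul x (tens T e aone).
  by have := rn_ge0 x; nra.
- have -> : tsum T (z t) - tsum T (z t) ** tens T e aone =
      \sum_(p <- z t) tens T (p.1 - p.1 ** e) p.2.
    rewrite /tsum amul_suml -sumrB; apply: eq_bigr => p _.
    by rewrite tensM amula1 (linB (tensPl T _)).
  by apply: (small (fun c => c - c ** e)) => p /cin [].
Qed.

End TensorUnits.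

(** * The slice space *)

Section ClosedSpan.
Context {R : realType} {V : normedModType R[i]}.
Implicit Types (X D : set V) (x y : V) (a : R[i]).

Lemma lspan_mem X : X `<=` lspan X.
Proof.
move=> x Xx; exists 1, (fun=> 1), (fun=> x); split => //.
by rewrite big_ord1 scale1r.
Qed.

Lemma lspan0 X : lspan X 0.
Proof. by exists 0, (fun=> 0), (fun=> 0); split=> [[]|]; rewrite ?big_ord0. Qed.

Lemma lspan_lin X a x y : lspan X x -> lspan X y -> lspan X (a *: x + y).
Proof.
move=> [n [c [u [hu ->]]]] [m [d [v [hv ->]]]].
exists (n + m)%N, (fun k : 'I_(n + m) => match fintype.split k with inl i => a * c i | inr j => d j end),
  (fun k : 'I_(n + m) => match fintype.split k with inl i => u i | inr j => v j end).
split; first by move=> k; case: splitP.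
rewrite big_split_ord /= scaler_sumr; congr (_ + _); apply: eq_bigr => i _.
  by rewrite (unsplitK (inl i)) scalerA.
by rewrite (unsplitK (inr i)).
Qed.

Lemma closure_lin D a x y : (forall b u v, D u -> D v -> D (b *: u + v)) ->
  closure D x -> closure D y -> closure D (a *: x + y).
Proof.
move=> DL /closure_rn hx /closure_rn hy; apply/closure_rn => e e0.
have e2 : 0 < e / 2 by rewrite divr_gt0.
have a1 : 0 < rn a + 1 by rewrite ltr_wpDl ?rn_ge0.
have [u Du xu] := hx (e / 2 / (rn a + 1)) (divr_gt0 e2 a1).
have [v Dv yv] := hy _ e2; exists (a *: u + v); first exact: DL.
have -> : a *: x + y - (a *: u + v) = a *: (x - u) + (y - v) by lmod.
apply: le_lt_trans (rnD _ _) _; rewrite rnZ [e]splitr; apply: ler_ltD yv.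
apply: le_trans (_ : rn a * (e / 2 / (rn a + 1)) <= _).
  by rewrite ler_wpM2l ?rn_ge0 // ltW.
by rewrite mulrA ler_pdivrMr // mulrC ler_wpM2l ?(ltW e2) // lerDl.
Qed.

Lemma closed_span_mem X : X `<=` closed_span X.
Proof. by move=> x /lspan_mem; exact: subset_closure. Qed.

Lemma closed_span_lin X a x y :
  closed_span X x -> closed_span X y -> closed_span X (a *: x + y).
Proof. by apply: closure_lin => b u v; exact: lspan_lin. Qed.

Lemma closed_span0 X : closed_span X 0.
Proof. by apply/subset_closure/lspan0. Qed.

Lemma closed_span_closed X : closed (closed_span X).
Proof. exact: closed_closure. Qed.

Lemma closed_span_sub X D : closed D -> D 0 ->
  (forall b u v, D u -> D v -> D (b *: u + v)) -> X `<=` D -> closed_span X `<=` D.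
Proof.
move=> cD D0 DL XD; apply: closure_subset_closed cD _ => x [n [a [v [hv ->]]]].
elim/big_ind: _ => //.
  by move=> u w Du Dw; rewrite -[u]scale1r; exact: DL.
by move=> i _; rewrite -[_ *: _]addr0; apply: DL => //; apply: XD.
Qed.

End ClosedSpan.

Section VectorSlices.
Context {R : realType} {A B : unitalCstarType R} {C : cstarType R} {T : minTensor C B}.
Context {Phi : A -> multiplier T} (mPhi : cstar_Mor Phi).

(* Slicing [Phi u (c (x) 1)] with vector functionals: the strict extension of a slice map
   is not needed for elements of the tensor product. *)
Definition vector_slices : set B := [set b | exists (K : hilbertType R) (sg : C -> K -> K)
  (rsg : representation sg) (x y : K) (c : C) (u : A),
  b = vslice rsg x y (mleft (Phi u) (tens T c aone))].

Lemma vslice_lip (K : hilbertType R) (sg : C -> K -> K) (rsg : representation sg) x y (s t : T) :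
  rn (vslice rsg x y s - vslice rsg x y t) <= rn x * rn y * rn (s - t).
Proof. exact: lin_lip (vslice_linear _ _ _) (vslice_bound _ _ _) _ _. Qed.

Lemma vector_functional_bounded (K : hilbertType R) (sg : C -> K -> K)
  (rsg : representation sg) x y : bounded_functional (fun c => hd K (sg c x) y : R[i]^o).
Proof.
have lw : linear (fun c => hd K (sg c x) y : R[i]^o).
  by move=> a c c'; rewrite (rep_linl rsg x) sdotPl.
split => //; apply: (@bounded_continuous R C R[i]^o _ (rn x * rn y)) => // c.
apply: le_trans (cauchy_schwarz _ _ _) _; rewrite !sn_hd.
by rewrite [leRHS]mulrAC ler_wpM2r ?rn_ge0 // mulrC rn_rep.
Qed.

Lemma vector_slices_sub : vector_slices `<=` slice_space Phi.
Proof.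
move=> b [K [sg [rsg [x [y [c [u ->]]]]]]]; apply: closed_span_mem.
(* Slicing m (c (x) 1) by the vectors x, y is slicing [m] by d |-> <sg(d) sg(c) x, y>. It is
   strictly continuous in [m], which enters only through its value on c (x) 1. *)
exists (fun d => hd K (sg d (sg c x)) y), (fun m => vslice rsg x y (mleft m (tens T c aone))), u.
split => //; first exact: vector_functional_bounded.
split.
  move=> F m FF Fm; have [Fl _] := Fm (tens T c aone).
  apply: continuous_cvg Fl; apply: (@bounded_continuous R T B _ (rn x * rn y)).
    exact: vslice_linear.
  exact: vslice_bound.
exists (vslice rsg (sg c x) y); split; last by move=> t; rewrite -vslice_mulr.
split; first exact: vslice_linear.
  by apply: bounded_continuous (vslice_linear _ _ _) (vslice_bound _ _ _).
by move=> d b'; rewrite vslice_tens.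
Qed.

(** A general functional is not expressed by vector functionals; duality replaces this. If s(t) were
    outside, some [th] would vanish on the vector slices but not at s(t). For a finite sum z near t,
    y = (id (x) th)(z) is then small in every representation, since [th] vanishes on the slices of
    t. Hence y (x) 1 is small, hence w(y) = th(s(z)), hence th(s(t)). *)
Let slice_of_tensor (w : C -> R[i]^o) (s : T -> B) (t : T) :
  bounded_functional w -> slice_map w s ->
  (forall (K : hilbertType R) (sg : C -> K -> K) (rsg : representation sg) x y,
     closed_span vector_slices (vslice rsg x y t)) ->
  closed_span vector_slices (s t).
Proof.
move=> [lw cw] [ls cs sE] ht; apply: contrapT => nst.
have [Kw Kw0 hw] := continuous_bounded lw cw.
have [Ks Ks0 hs] := continuous_bounded ls cs.
have [|||th [lth th0 thst [Kt Kt0 ht']]] := @hahn_banach_separation R B (closed_span vector_slices) _ _ (s t).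
- exact: closed_span0.
- by move=> a x y; exact: closed_span_lin.
- by move=> /(closure_subset_closed (@closed_span_closed _ _ _) (@subset_refl _ _)).
have one0 : 0 < rn (aone : B).
  apply: rn_gt0 => e0; apply: thst; rewrite -[s t]amula1 e0 amul0r.
  exact: lin0 lth.
apply: thst; apply: (@rn_small R R[i]^o _ (Kt * Ks + Ks * Kt)) => d d0.
have [z hz] := tsum_dense t d0.
pose y := \sum_(p <- z) (th p.2 : R[i]) *: p.1.
have yE (K : hilbertType R) (sg : C -> K -> K) (rsg : representation sg) x x' :
    hd K (sg y x) x' = th (vslice rsg x x' (tsum T z)).
  rewrite vslice_tsum (lin_sum lth) (lin_sum (rep_linl rsg x)) sdot_suml.
  apply: eq_bigr => p _; rewrite (linZ lth) (linZ (rep_linl rsg x)) sdotZl.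
  by rewrite mulrC.
have yb (K : hilbertType R) (sg : C -> K -> K) : representation sg ->
    forall x, rn (sg y x) <= Kt * d * rn x.
  move=> rsg x; have [->|/eqP /rn_gt0 x0] := eqVneq (sg y x) 0.
    by rewrite rn0 !mulr_ge0 ?rn_ge0 // ltW.
  rewrite -(ler_pM2r x0) -expr2.
  have -> : rn (sg y x) ^+ 2 = rn (hd K (sg y x) (sg y x)).
    by rewrite sdotE sn_hd rn_real ger0_norm ?sqr_ge0.
  rewrite (yE _ _ rsg) -[vslice _ _ _ _](subrK (vslice rsg x (sg y x) t)).
  rewrite (linD lth) (th0 _ (ht _ _ _ _ _)) addr0.
  apply: le_trans (ht' _) _; rewrite -!mulrA; apply: ler_wpM2l; first exact: ltW.
  apply: le_trans (vslice_lip _ _ _ _ _) _; rewrite rn_distC mulrC.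
  by rewrite ler_wpM2r ?mulr_ge0 ?rn_ge0 // ltW.
have y1 := tens_left_bound T aone (mulr_ge0 (ltW Kt0) (ltW d0)) yb.
have wy : rn (w y : R[i]) * rn (aone : B) <= Ks * (Kt * d * rn (aone : B)).
  rewrite -rnZ -sE; apply: le_trans (hs _) _.
  by rewrite ler_wpM2l // ltW.
have thz : th (s (tsum T z)) = w y.
  rewrite (lin_sum ls) (lin_sum lth) (lin_sum lw); apply: eq_bigr => p _.
  by rewrite sE (linZ lth) (linZ lw); exact: mulrC.
have -> : th (s t) = th (s (t - tsum T z)) + w y.
  by rewrite (linB ls) (linB lth) thz subrK.
apply: le_trans (rnD _ _) _; rewrite mulrDl; apply: lerD.
  apply: le_trans (ht' _) _; rewrite -mulrA ler_wpM2l ?(ltW Kt0) //.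
  apply: le_trans (hs _) _; rewrite ler_wpM2l ?(ltW Ks0) // ltW //.
apply: le_trans (_ : _ <= Ks * (Kt * d)) _.
  by rewrite -(ler_pM2r one0) -[leRHS]mulrA.
by rewrite mulrA.
Qed.

(** The neighbourhood filter of [m] in the strict topology. Continuity along it yields a finite test
    set and a tolerance, the input of [tensor_unit]. *)
Let strict_filter (m : multiplier T) : set_system (multiplier T) :=
  [set P | exists (ts : seq T) (eta : R), 0 < eta /\ forall n : multiplier T,
     (forall t, t \in ts -> rn (mleft m t - mleft n t) < eta /\
                            rn (mright m t - mright n t) < eta) -> P n].

Let strict_filter_filter m : Filter (strict_filter m).
Proof.
split.
- by exists [::], 1.
- move=> P Q [ts [e [e0 hP]]] [us [d [d0 hQ]]]; exists (ts ++ us), (Num.min e d).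
  split=> [|n hn]; first by rewrite lt_min e0.
  split; [apply: hP|apply: hQ] => t tin; have [|] := hn t; rewrite ?mem_cat ?tin ?orbT //.
    by rewrite !lt_min => /andP[-> _] /andP[-> _].
  by rewrite !lt_min => /andP[_ ->] /andP[_ ->].
- move=> P Q PQ [ts [e [e0 hP]]]; exists ts, e; split => // n /hP; exact: PQ.
Qed.

Let strict_filter_cvg m : strict_cvg (strict_filter m) m.
Proof.
move=> t; have F := strict_filter_filter m.
split; apply/cvg_rn => e e0; exists [:: t], e; split => // n /(_ t); rewrite inE eqxx.
  by case.
by case.
Qed.

(** Strict continuity of [f] and an approximate unit c (x) 1 bring f(Phi x) close to s(Phi x (c (x)
    1)), the slice of an element of the tensor product, to which [slice_of_tensor] applies. *)
Lemma slice_spaceE : slice_space Phi = closed_span vector_slices.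
Proof.
apply/seteqP; split; last first.
  apply: closed_span_sub vector_slices_sub; [exact: closed_span_closed|exact: closed_span0|].
  by move=> a x y; exact: closed_span_lin.
apply: closed_span_sub; [exact: closed_span_closed|exact: closed_span0| |].
  by move=> a x y; exact: closed_span_lin.
move=> b [w [f [x [bw [cf [s [ss fs]]] ->]]]].
have /closed_rn := @closed_span_closed R B vector_slices; apply => e e0.
have FF := strict_filter_filter (Phi x); have := cf _ _ FF (@strict_filter_cvg (Phi x)).
move=> /cvg_rn /(_ e e0) [ts [eta [eta0 h]]].
have x1 : 0 < rn x + 1 by rewrite ltr_wpDl ?rn_ge0.
have [|c hc] := @tensor_unit R C B T (ts ++ map (mright (Phi x)) ts) (eta / 2 / (rn x + 1)).
  by rewrite !divr_gt0.
exists (s (mleft (Phi x) (tens T c aone))).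
  apply: slice_of_tensor bw ss _ => K sg rsg x' y'; apply: closed_span_mem.
  by exists K, sg, rsg, x', y', c, x.
rewrite -fs; apply: h => t tin; have e2 : eta / 2 < eta.
  by rewrite ltr_pdivrMr // mulr_natr mulr2n ltrDl.
split; apply: le_lt_trans e2.
  rewrite /= -mleftM -(linB (mleft_linear _)); apply: le_trans (Mor_bound mPhi _ _) _.
  have [|h1 _] := hc t; first by rewrite mem_cat tin.
  apply: le_trans (ler_wpM2l (rn_ge0 x) h1) _.
  rewrite mulrA ler_pdivrMr // mulrC ler_wpM2l ?lerDl //.
  by rewrite divr_ge0 // ltW.
rewrite /= multiplierP.
have [|_ h2] := hc (mright (Phi x) t); first by rewrite mem_cat map_f ?orbT.
apply: le_trans h2 _; rewrite ler_pdivrMr // ler_peMr ?divr_ge0 ?(ltW eta0) //.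
by rewrite lerDr rn_ge0.
Qed.

Lemma slice_space_closed : closed (slice_space Phi).
Proof. exact: closed_span_closed. Qed.

Lemma slice_space_lin (a : R[i]) x y :
  slice_space Phi x -> slice_space Phi y -> slice_space Phi (a *: x + y).
Proof. exact: closed_span_lin. Qed.

Lemma vslice_mem (K : hilbertType R) (sg : C -> K -> K) (rsg : representation sg) x y c u :
  slice_space Phi (vslice rsg x y (mleft (Phi u) (tens T c aone))).
Proof. by apply: vector_slices_sub; exists K, sg, rsg, x, y, c, u. Qed.

(** With [t] the adjoint of Phi(u)(c (x) 1), t (d (x) 1) equals (star c (x) 1) Phi(star u)(d (x) 1),
    whose slices are vector slices because [star c] moves onto a vector; a suitable [d] brings it
    close to [t]. *)
Lemma vslice_star_mem (K : hilbertType R) (sg : C -> K -> K) (rsg : representation sg) x y c u :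
  slice_space Phi (star (vslice rsg x y (mleft (Phi u) (tens T c aone)))).
Proof.
rewrite vslice_star; set t := star _.
have /closed_rn := slice_space_closed; apply => e e0.
have k0 : 0 < rn y * rn x + 1 by rewrite ltr_wpDl ?mulr_ge0 ?rn_ge0.
have [|d ed] := @tensor_unit R C B T [:: t] (e / 2 / (rn y * rn x + 1)).
  by rewrite !divr_gt0.
exists (vslice rsg y x (t ** tens T d aone)).
  by rewrite /t (Mor_star mPhi) tens_star star1 vslice_mull; exact: vslice_mem.
apply: le_lt_trans (_ : e / 2 < e); last first.
  by rewrite ltr_pdivrMr // mulr_natr mulr2n ltrDl.
have [|_ h2] := ed t; first by rewrite inE.
apply: le_trans (vslice_lip _ _ _ _ _) _.
apply: le_trans (ler_wpM2l _ h2) _; first by rewrite mulr_ge0 ?rn_ge0.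
rewrite mulrA ler_pdivrMr // mulrC ler_wpM2l ?lerDl //.
by rewrite divr_ge0 // ltW.
Qed.

Lemma slice_space_star x : slice_space Phi x -> slice_space Phi (star x).
Proof.
suff : slice_space Phi `<=` [set x | slice_space Phi (star x)] by apply.
rewrite {1}slice_spaceE; apply: closed_span_sub.
- apply/closed_rn => v h; have /closed_rn := slice_space_closed; apply => e /h [y Sy vy].
  by exists (star y) => //; rewrite -starB rn_star.
- by rewrite /= star0; exact: closed_span0.
- by move=> a u v /= hu hv; rewrite starD starZ; exact: slice_space_lin.
- by move=> b [K [sg [rsg [y [z [c [u ->]]]]]]]; exact: vslice_star_mem.
Qed.

(** The slices of Phi(1)(c (x) 1) are the multiples <sg(c) x, y> 1. If all these numbers vanish, so
    do all slices; then 0 generates [B] and the unit itself is 0. *)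
Lemma slice_space_one : cstar_generated (slice_space Phi) = setT -> slice_space Phi aone.
Proof.
move=> gen.
have [[K [sg [rsg [x [y [c n0]]]]]]|triv] := pselect (exists (K : hilbertType R)
    (sg : C -> K -> K) (rsg : representation sg) (x y : K) c, hd K (sg c x) y <> 0).
  have := @vslice_mem K sg rsg x y c aone; rewrite (Mor1 mPhi) vslice_tens => h.
  have -> : (aone : B) = (hd K (sg c x) y)^-1 *: (hd K (sg c x) y *: aone) + 0.
    by rewrite addr0 scalerA mulVf ?scale1r //; apply/eqP.
  by apply: slice_space_lin h _; exact: closed_span0.
have cl0 : closed [set 0 : B].
  apply/closed_rn => v h; apply: (@rn_small R B v 1) => e e0.
  by have [x -> ] := h e e0; rewrite subr0 mul1r => /ltW.
suff -> : (aone : B) = 0 by exact: closed_span0.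
have : cstar_generated (slice_space Phi) aone by rewrite gen.
move=> /(_ [set 0]); apply; split; first split.
- by [].
- by move=> a x y -> ->; rewrite scaler0 addr0.
- by move=> x y -> ->; rewrite amul0l.
- by move=> x ->; rewrite star0.
- exact: cl0.
rewrite slice_spaceE; apply: closed_span_sub.
- exact: cl0.
- by [].
- by move=> a x y -> ->; rewrite scaler0 addr0.
- move=> b [K [sg [rsg [x [y [c [u ->]]]]]]] /=.
  move: (mleft _ _); apply: (@tsum_ext R C B T B _ _ (rn x * rn y) 0).
  + exact: vslice_lip.
  + by move=> s t; rewrite subrr rn0 mul0r.
  + move=> z; rewrite vslice_tsum big1 // => p _.
    suff -> : hd K (sg p.1 x) y = 0 by rewrite scale0r.
    by apply: contrapT => n0; apply: triv; exists K, sg, rsg, x, y, p.1.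
Qed.

Lemma slice_space_operator_system : cstar_generated (slice_space Phi) = setT ->
  operator_system (slice_space Phi).
Proof.
move=> gen; split; [exact: slice_space_one|exact: slice_space_lin|exact: slice_space_star].
Qed.

End VectorSlices.

(** * Completely positive kernels *)

Section Families.
Context {R : realType} {D : unitalCstarType R} {H : hilbertType R} (E : D -> H -> H -> R[i]).
Hypotheses (EL : forall (a : R[i]) d d' h h', E (a *: d + d') h h' = a * E d h h' + E d' h h')
  (EC : forall d h h', E (star d) h' h = (E d h h')^*)
  (Epos : forall n (d : 'I_n -> D) (h : 'I_n -> H),
    0 <= \sum_i \sum_k E (star (d i) ** d k) (h k) (h i)).
Variables (n : nat) (h : 'I_n -> H).

Fact family_linear (a : R[i]) (f g k : {ffun 'I_n -> D}) :
  \sum_i \sum_l E (star (k i) ** (a *: f + g) l) (h l) (h i) =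
  a * (\sum_i \sum_l E (star (k i) ** f l) (h l) (h i)) +
  \sum_i \sum_l E (star (k i) ** g l) (h l) (h i).
Proof.
rewrite mulr_sumr -big_split; apply: eq_bigr => i _ /=.
rewrite mulr_sumr -big_split; apply: eq_bigr => l _ /=.
by rewrite !ffunE amulPr EL.
Qed.

Fact family_conj (f k : {ffun 'I_n -> D}) :
  \sum_i \sum_l E (star (f i) ** k l) (h l) (h i) =
  (\sum_i \sum_l E (star (k i) ** f l) (h l) (h i))^*.
Proof.
rewrite rmorph_sum exchange_big /=; apply: eq_bigr => i _.
rewrite rmorph_sum; apply: eq_bigr => l _.
by have := EC (star (k i) ** f l) (h l) (h i); rewrite starM starK.
Qed.

(** The Stinespring form on D (x) H, restricted to sums of f_i (x) h_i with the vectors h_i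
    fixed. *)
Definition family_dot : semiInner {ffun 'I_n -> D} :=
  @SemiInner R {ffun 'I_n -> D} (fun f g => \sum_i \sum_l E (star (g i) ** f l) (h l) (h i))
    family_linear family_conj (fun f => Epos f h).

End Families.

(* A completely positive map from [D] to [B(H)], given by its matrix coefficients. *)
Record cp_kernel (R : realType) (D : unitalCstarType R) (H : hilbertType R) := CPKernel {
  kerl :> D -> H -> H -> R[i] ;
  kerlP : forall (a : R[i]) d d' h h', kerl (a *: d + d') h h' = a * kerl d h h' + kerl d' h h' ;
  kerlPl : forall (a : R[i]) d h k h', kerl d (a *: h + k) h' = a * kerl d h h' + kerl d k h' ;
  kerlPr : forall (a : R[i]) d h h' k', kerl d h (a *: h' + k') = a^* * kerl d h h' + kerl d h k' ;
  kerl_ge0 : forall n (d : 'I_n -> D) (h : 'I_n -> H),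
    0 <= \sum_i \sum_k kerl (star (d i) ** d k) (h k) (h i)
}.

Section Kernels.
Context {R : realType} {D : unitalCstarType R} {H : hilbertType R} (E : cp_kernel D H).
Implicit Types (d : D) (h k : H) (a : R[i]).

Let linE h h' : linear (fun d => E d h h' : R[i]^o).
Proof. by move=> a d d'; exact: kerlP. Qed.
Let linEl d h' : linear (fun h => E d h h' : R[i]^o).
Proof. by move=> a h k; exact: kerlPl. Qed.

Lemma kerlD d d' h h' : E (d + d') h h' = E d h h' + E d' h h'.
Proof. exact: (linD (linE h h')). Qed.
Lemma kerlZ a d h h' : E (a *: d) h h' = a * E d h h'.
Proof. exact: (linZ (linE h h')). Qed.
Lemma kerlN d h h' : E (- d) h h' = - E d h h'.
Proof. exact: (linN (linE h h')). Qed.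
Lemma kerlB d d' h h' : E (d - d') h h' = E d h h' - E d' h h'.
Proof. exact: (linB (linE h h')). Qed.
Lemma kerl0 h h' : E 0 h h' = 0. Proof. exact: (lin0 (linE h h')). Qed.
Lemma kerl_sum I (r : seq I) (F : I -> D) h h' :
  E (\sum_(i <- r) F i) h h' = \sum_(i <- r) E (F i) h h'.
Proof. exact: (lin_sum (linE h h')). Qed.

Lemma kerlBl d h k h' : E d (h - k) h' = E d h h' - E d k h'.
Proof. exact: (linB (linEl d h')). Qed.

Lemma kerl_pos d h : 0 <= E (star d ** d) h h.
Proof. by have := kerl_ge0 E (fun _ : 'I_1 => d) (fun=> h); rewrite !big_ord1. Qed.

Let Im_ge0 (z : R[i]) : 0 <= z -> complex.Im z = 0.
Proof. by rewrite lecE => /andP[/eqP]. Qed.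

(** Positivity for the pairs (1, k) and (d, h) forces E d h k + E (star d) k h to be real; k = h'
    and k = i h' give the symmetry. *)
Lemma kerlC d h h' : E (star d) h' h = (E d h h')^*.
Proof.
have key k : complex.Im (E d h k + E (star d) k h) = 0.
  have := kerl_ge0 E (fun i : 'I_2 => if val i is 0%N then aone else d)
    (fun i : 'I_2 => if val i is 0%N then k else h).
  rewrite !big_ord_recl !big_ord0 /= !addr0 star1 amul1a amula1.
  move=> /Im_ge0; have := Im_ge0 (kerl_pos aone k); have := Im_ge0 (kerl_pos d h).
  rewrite star1 !amul1a => e1 e2.
  by rewrite !raddfD /= e1 e2 add0r addr0.
have := key ('i *: h'); have := key h'.
rewrite -['i *: h']addr0 kerlPr kerlPl (lin0 (linEl _ _)).
have -> : E d h 0 = 0.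
  by have := kerlPr E (-1) d h 0 0; rewrite scaler0 addr0 rmorphN1 mulN1r addNr.
rewrite !addr0 conj_i; case: (E d h h') (E (star d) h' h) => u v [u' v'] /=.
rewrite !mul0r !mul1r !oppr0 !mulN1r ?addr0 ?add0r ?sub0r => e1 e2.
apply/eqP; rewrite eq_complex /=; apply/andP; split; apply/eqP; lra.
Qed.

Local Notation family_dot := (family_dot (kerlP E) kerlC (@kerl_ge0 _ _ _ E)).

(** In the Stinespring form, d (x) h - 1 (x) k has square E(d^* d) at (h, h) minus |k|^2. If it is a
    null vector, pairing it with star c (x) h' gives the second claim: this is the multiplicative
    domain. Slot 0 of the families is kept for that pairing. *)
Lemma kerl_lower d h k : (forall h', E d h h' = hd H k h') ->
  (forall h h', E aone h h' = hd H h h') ->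
  rn k ^+ 2 <= complex.Re (E (star d ** d) h h) /\
  (complex.Re (E (star d ** d) h h) <= rn k ^+ 2 ->
   forall c h', E (c ** d) h h' = E c k h').
Proof.
move=> Ed E1.
have Eds h' : E (star d) h' h = hd H h' k by rewrite kerlC Ed -sdotC.
pose v : {ffun 'I_3 -> D} := [ffun i : 'I_3 => match val i with 0%N => 0 | 1%N => d | _ => - aone end : D].
pose hh h' (i : 'I_3) := match val i with 0%N => h' | 1%N => h | _ => k end.
have gvv h' : family_dot (hh h') v v = E (star d ** d) h h - (rn k ^+ 2)%:C.
  rewrite /= !big_ord_recl !big_ord0 !ffunE /= !(star0, amul0l, amul0r, kerl0, starN, star1).
  rewrite !(amulNl, amulNr, amul1a, amula1, kerlN) Ed Eds E1 !sdotE sn_hd; ring.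
split.
  have := sdot_ge0 (family_dot (hh h)) v; rewrite gvv => /Re_ge0.
  by rewrite ReD ReN /= subr_ge0.
move=> up c h'.
pose u : {ffun 'I_3 -> D} := [ffun i : 'I_3 => match val i with 0%N => star c | _ => 0 end : D].
have v0 : sn (family_dot (hh h')) v = 0.
  by rewrite /sn gvv; apply: ler0_sqrtr; rewrite ReD ReN /= subr_le0.
have guv : family_dot (hh h') v u = E (c ** d) h h' - E c k h'.
  rewrite /= !big_ord_recl !big_ord0 !ffunE /= !(star0, amul0l, amul0r, kerl0, starN, star1).
  rewrite !(amulNl, amulNr, amul1a, amula1, kerlN, starK); ring.
apply/eqP; rewrite -subr_eq0 -guv; apply/eqP/rn_eq0/eqP.
rewrite eq_le rn_ge0 andbT; apply: le_trans (cauchy_schwarz _ _ _) _.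
by rewrite v0 mul0r.
Qed.

Lemma kerl_cauchy_schwarz d y h h' : rn (E (d ** y) h h') <=
  Num.sqrt (complex.Re (E (d ** star d) h' h')) * Num.sqrt (complex.Re (E (star y ** y) h h)).
Proof.
pose v : {ffun 'I_2 -> D} := [ffun i : 'I_2 => (if val i is 0%N then 0 else y) : D].
pose u : {ffun 'I_2 -> D} := [ffun i : 'I_2 => (if val i is 0%N then star d else 0) : D].
pose hh (i : 'I_2) := if val i is 0%N then h' else h.
have := cauchy_schwarz (family_dot hh) v u; rewrite /sn.
rewrite /= !big_ord_recl !big_ord0 !ffunE /= !(star0, amul0l, amul0r, kerl0, starK).
by rewrite !(addr0, add0r) mulrC.
Qed.

End Kernels.

(** * Complete order embeddings of an operator system *)

Section OrderEmbedding.
Context {R : realType} {B D : unitalCstarType R} (S : set B) (j : B -> D).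
Hypotheses (S1 : S aone) (SL : forall (a : R[i]) x y, S x -> S y -> S (a *: x + y))
  (SS : forall x, S x -> S (star x)).
Hypotheses (jL : forall (a : R[i]) x y, S x -> S y -> j (a *: x + y) = a *: j x + j y)
  (j1 : j aone = aone)
  (jpos : forall n (X : 'M[B]_n), (forall i k, S (X i k)) ->
     mx_positive X -> mx_positive (map_mx j X)).

Lemma subspace0 : S 0.
Proof. by have := SL (-1) S1 S1; rewrite scaleN1r addNr. Qed.

Lemma subspaceZ (a : R[i]) x : S x -> S (a *: x).
Proof. by move=> Sx; rewrite -[_ *: _]addr0; apply: SL => //; exact: subspace0. Qed.

Lemma subspaceD x y : S x -> S y -> S (x + y).
Proof. by move=> Sx Sy; rewrite -[x]scale1r; exact: SL. Qed.

Lemma embed0 : j 0 = 0.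
Proof. by have := jL (-1) S1 S1; rewrite !scaleN1r !addNr. Qed.

Lemma embedZ (a : R[i]) x : S x -> j (a *: x) = a *: j x.
Proof. by move=> Sx; rewrite -[_ *: _]addr0 jL ?embed0 ?addr0 //; exact: subspace0. Qed.

Lemma embedD x y : S x -> S y -> j (x + y) = j x + j y.
Proof. by move=> Sx Sy; rewrite -[x]scale1r jL // !scale1r. Qed.

Lemma embed_sc (r : R) : j (sc B r) = sc D r.
Proof. by rewrite /sc embedZ // j1. Qed.

(* [[W + eps, s^*], [s, 1]] is positive when [W - s^* s] is; so is its image by [j]. *)
Lemma embed_schur n (s : 'I_n -> B) (W : B) (eps : R) :
  (forall i, S (s i)) -> S W -> 0 < eps -> nonneg (W - \sum_i star (s i) ** s i) ->
  (forall i, j (star (s i)) = star (j (s i))) /\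
  exists m (w : 'I_m -> D), \sum_k star (w k) ** w k =
    sc D eps + j W - \sum_i star (j (s i)) ** j (s i).
Proof.
move=> Ss SW eps0 nn; have [b [sb bE _]] := nonneg_sqrt nn eps0.
(* Row 0 of [Y] is (b, 0) and row i is (s_i, unit vector i), with b^2 = eps + W - sum_i s_i^* s_i,
   so that Y^* Y = X. *)
pose Y : 'M[B]_n.+1 := \matrix_(p, q) match unlift ord0 p, unlift ord0 q with
  | None, None => b | Some i, None => s i | None, Some _ => 0
  | Some i, Some k => if i == k then aone else 0 end.
pose X : 'M[B]_n.+1 := \matrix_(p, q) match unlift ord0 p, unlift ord0 q with
  | None, None => sc B eps + W | Some i, None => s i | None, Some k => star (s k)
  | Some i, Some k => if i == k then aone else 0 end.
have S0 := subspace0.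
have SX p q : S (X p q).
  rewrite mxE; case: (unlift _ p) (unlift _ q) => [i|] [k|] //.
  - by case: ifP.
  - exact: SS.
  - by apply: SL.
have delta_sum (V : nmodType) (f : 'I_n -> V) (i : 'I_n) :
    \sum_k (if k == i then f k else 0) = f i.
  by rewrite -big_mkcond big_pred1_eq.
have pX : mx_positive X.
  exists Y; apply/matrixP => p q; rewrite !mxE big_ord_recl !mxE unlift_none.
  under eq_bigr => k _ do rewrite !mxE liftK.
  case: (unliftP ord0 p) => [i _|_]; case: (unliftP ord0 q) => [k _|_].
  - rewrite star0 amul0l add0r.
    rewrite (eq_bigr (fun l => if l == i then (if l == k then aone else 0) else 0)) ?delta_sum // => l _.
    by case: eqP; rewrite ?star1 ?amul1a ?star0 ?amul0l.
  - rewrite star0 amul0l add0r.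
    rewrite (eq_bigr (fun l => if l == i then s l else 0)) ?delta_sum // => l _.
    by case: eqP; rewrite ?star1 ?amul1a ?star0 ?amul0l.
  - rewrite amul0r add0r.
    rewrite (eq_bigr (fun l => if l == k then star (s l) else 0)) ?delta_sum // => l _.
    by case: eqP; rewrite ?amula1 ?amul0r.
  - by rewrite sb bE -addrA subrK.
have [Z ZE] := jpos SX pX.
have e p q : j (X p q) = \sum_k star (Z k p) ** Z k q.
  by move/matrixP: ZE => /(_ p q); rewrite !mxE.
pose o := lift (@ord0 n).
have e00 : \sum_k star (Z k ord0) ** Z k ord0 = sc D eps + j W.
  by rewrite -e mxE unlift_none embedD ?embed_sc //; exact: subspaceZ.
have ei0 i : \sum_k star (Z k (o i)) ** Z k ord0 = j (s i).
  by rewrite -e mxE unlift_none liftK.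
(* Z^* Z is hermitian, so positivity of the image alone forces [j] to respect adjoints. *)
have jstar i : j (star (s i)) = star (j (s i)).
  have -> : j (star (s i)) = j (X ord0 (o i)) by rewrite mxE unlift_none liftK.
  by rewrite e -ei0 star_sum; apply: eq_bigr => k _; rewrite starM starK.
have e0i i : \sum_k star (Z k ord0) ** Z k (o i) = star (j (s i)).
  by rewrite -jstar -e mxE unlift_none liftK.
have eil i l : \sum_k star (Z k (o i)) ** Z k (o l) = if l == i then aone else 0.
  by rewrite -e mxE !liftK eq_sym; case: ifP; rewrite ?embed0.
(* Completing the square: the columns of [Z] over the unit block are orthonormal by [eil], and
   column 0 minus its components along them has the Schur complement as its square. *)
split=> //; exists n.+1, (fun k => Z k ord0 - \sum_i Z k (o i) ** j (s i)).
pose Q := \sum_i star (j (s i)) ** j (s i).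
have t1 : \sum_k star (Z k ord0) ** (\sum_i Z k (o i) ** j (s i)) = Q.
  under eq_bigr => k _ do rewrite amul_sumr.
  rewrite exchange_big; apply: eq_bigr => i _ /=.
  by rewrite -e0i amul_suml; apply: eq_bigr => k _; rewrite amulA.
have t2 : \sum_k star (\sum_i Z k (o i) ** j (s i)) ** Z k ord0 = Q.
  under eq_bigr => k _ do rewrite star_sum amul_suml.
  rewrite exchange_big; apply: eq_bigr => i _ /=.
  by rewrite -[X in _ = _ ** X]ei0 amul_sumr; apply: eq_bigr => k _; rewrite starM amulA.
have t3 : \sum_k star (\sum_i Z k (o i) ** j (s i)) ** (\sum_i Z k (o i) ** j (s i)) = Q.
  under eq_bigr => k _ do rewrite star_sum amul_suml.
  rewrite exchange_big; apply: eq_bigr => i _ /=.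
  under eq_bigr => k _ do rewrite starM amul_sumr.
  rewrite exchange_big /=.
  rewrite -[RHS](delta_sum D (fun l => star (j (s i)) ** j (s l)) i); apply: eq_bigr => l _.
  transitivity (star (j (s i)) ** (\sum_k star (Z k (o i)) ** Z k (o l)) ** j (s l)).
    by rewrite amul_sumr amul_suml; apply: eq_bigr => k _; rewrite !amulA.
  by rewrite eil; case: eqP; rewrite ?amula1 ?amul0r ?amul0l.
transitivity (\sum_k star (Z k ord0) ** Z k ord0
  - \sum_k star (Z k ord0) ** (\sum_i Z k (o i) ** j (s i))
  - \sum_k star (\sum_i Z k (o i) ** j (s i)) ** Z k ord0
  + \sum_k star (\sum_i Z k (o i) ** j (s i)) ** (\sum_i Z k (o i) ** j (s i))).
  rewrite -!sumrB -big_split; apply: eq_bigr => k _ /=.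
  by rewrite starB !amulBl !amulBr; lmod.
by rewrite e00 t1 t2 t3 subrK.
Qed.

Lemma embed_star s : S s -> j (star s) = star (j s).
Proof.
move=> Ss; have [||||h _] := @embed_schur 1 (fun=> s) (sc B (rn s ^+ 2)) 1 _ _ _ _.
- by [].
- exact: subspaceZ.
- by [].
- rewrite big_ord1; apply: nonneg_near; first by rewrite starN starM starK.
  by rewrite rnN rn_star_amul.
exact: (h ord0).
Qed.

(** No norm bound on [j] is at hand; the estimate is [embed_schur] with W = |s|^2. *)
Lemma embed_bound (H : hilbertType R) (E : cp_kernel D H) s h : S s ->
  complex.Re (E (star (j s) ** j s) h h) <= rn s ^+ 2 * complex.Re (E aone h h).
Proof.
move=> Ss; set k := complex.Re (E aone h h).
have k0 : 0 <= k by apply/Re_ge0; have := kerl_pos E aone h; rewrite star1 amul1a.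
rewrite -subr_le0; apply: small_eq0 => e e0; have k1 : 0 < k + 1 by rewrite ltr_wpDl.
have d0 : 0 < e / (k + 1) by rewrite divr_gt0.
have [||||_ [m [w wE]]] := @embed_schur 1 (fun=> s) (sc B (rn s ^+ 2)) (e / (k + 1)) _ _ _ _.
- by [].
- exact: subspaceZ.
- by [].
- rewrite big_ord1; apply: nonneg_near; first by rewrite starN starM starK.
  by rewrite rnN rn_star_amul.
have : 0 <= complex.Re (E (\sum_k star (w k) ** w k) h h).
  rewrite kerl_sum raddf_sum sumr_ge0 // => i _; exact/Re_ge0/kerl_pos.
rewrite wE big_ord1 embed_sc kerlB kerlD !kerlZ ReD ReN ReD !Re_realM -/k.
have : e / (k + 1) * k <= e.
  by rewrite mulrAC ler_pdivrMr // ler_wpM2l ?(ltW e0) // lerDl.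
lra.
Qed.

End OrderEmbedding.

Lemma vsliceZr (R : realType) (C : cstarType R) (B : unitalCstarType R) (T : minTensor C B)
    (K : hilbertType R) (sg : C -> K -> K) (rsg : representation sg) (a : R[i]) x y (t : T) :
  vslice rsg x (a *: y) t = a^* *: vslice rsg x y t.
Proof.
move: t; apply: (@tsum_ext R C B T B _ _ (rn x * rn (a *: y)) (rn a * (rn x * rn y))).
- exact: vslice_lip.
- move=> s t; rewrite -scalerBr rnZ rn_conj -mulrA ler_wpM2l ?rn_ge0 //; exact: vslice_lip.
move=> z; rewrite !vslice_tsum scaler_sumr; apply: eq_bigr => p _.
by rewrite sdotZr scalerA.
Qed.

(** * Slices in the multiplicative domain *)

Section SliceKernels.
Context {R : realType} {A B : unitalCstarType R} {C : cstarType R} {T : minTensor C B}.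
Context {Phi : A -> multiplier T} (mPhi : cstar_Mor Phi).
Context {D : unitalCstarType R} (j : B -> D).
Local Notation S := (slice_space Phi).
Hypotheses (S1 : S aone)
  (jL : forall (a : R[i]) x y, S x -> S y -> j (a *: x + y) = a *: j x + j y)
  (j1 : j aone = aone)
  (jpos : forall n (X : 'M[B]_n), (forall i k, S (X i k)) ->
     mx_positive X -> mx_positive (map_mx j X)).
Context {H : hilbertType R} {tau : B -> H -> H} (rtau : representation tau) (E : cp_kernel D H).
Hypotheses (Ej : forall s, S s -> forall h h', E (j s) h h' = hd H (tau s h) h')
  (E1 : forall h h', E aone h h' = hd H h h').

Let SL := fun a x y => @slice_space_lin R A B C T Phi a x y.
Let SS := slice_space_star mPhi.

(* The defect of [slice_defect] vanishes in every representation up to [eps], so the kernel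
   cannot see a larger value of [j s^* j s] than [tau] does. *)
Lemma kernel_slice_upper (K : hilbertType R) (sg : C -> K -> K) (rsg : representation sg)
    x z c u h s : hd K z z = 1 -> s = vslice rsg x z (mleft (Phi u) (tens T c aone)) ->
  complex.Re (E (star (j s) ** j s) h h) <= rn (tau s h) ^+ 2.
Proof.
move=> z1 sE; pose t := mleft (Phi u) (tens T c aone).
(* The two error terms are the margin of [embed_schur], evaluated at h, and the defect left by
   [slice_defect]. *)
suff key (e : R) : 0 < e ->
    complex.Re (E (star (j s) ** j s) h h) <= rn (tau s h) ^+ 2 + (e * rn h ^+ 2 + (e * rn h) ^+ 2).
  rewrite -subr_le0; apply: small_eq0 => e e0.
  have k0 : 0 < rn h ^+ 2 *+ 2 + 1 by rewrite ltr_wpDl // mulrn_wge0 // sqr_ge0.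
  pose d := Num.min 1 (e / (rn h ^+ 2 *+ 2 + 1)).
  have d0 : 0 < d by rewrite lt_min ltr01 divr_gt0.
  have d1 : d <= 1 by rewrite ge_min lexx.
  have dk : d * (rn h ^+ 2 *+ 2 + 1) <= e by rewrite -ler_pdivlMr // ge_min lexx orbT.
  rewrite lerBlDl; apply: le_trans (key d d0) _; rewrite lerD2l exprMn.
  move: dk; have := sqr_ge0 (rn h); rewrite mulr2n; move: (rn h ^+ 2) => v; nra.
move=> e0; have oz : onseq [:: z] by [].
have [es [oes sub defect_es]] := slice_defect rsg x t oz e0.
pose n := size es; pose si (i : 'I_n) := vslice rsg x (nth 0 es i) t.
pose W := vslice rsg x x (star t ** t).
have sW : star W = W by rewrite vslice_star starM starK.
have SW : S W.
  rewrite /W /t (Mor_star mPhi) -(MorM mPhi).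
  have -> : star (tens T c aone) = tens T (star c) aone by rewrite tens_star star1.
  by rewrite vslice_mull; exact: vslice_mem.
have sumE (V : nmodType) (F : K -> V) : \sum_(e <- es) F e = \sum_(i < n) F (nth 0 es i).
  by rewrite (big_nth 0) big_mkord.
have [||||jstar [m [w wE]]] := @embed_schur R B D S j S1 SL SS jL j1 jpos n si W e.
- by move=> i; exact: vslice_mem.
- exact: SW.
- exact: e0.
- apply: nonneg_rep => [|L rho k rrho].
    rewrite starB sW star_sum; congr (_ - _); apply: eq_bigr => i _.
    by rewrite starM starK.
  rewrite (linB (rep_linl rrho k)) sdotBl ReD ReN.
  rewrite (lin_sum (rep_linl rrho k)) sdot_suml raddf_sum.
  have [q0 _] := defect_es L rho k rrho; move: q0; rewrite sumE /W.
  congr (0 <= _ - _); apply: eq_bigr => i _.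
  by rewrite -sn_hd sn_sqr (repM rrho) (rep_star rrho).
have [i0 s0] : exists i, s = si i; first rewrite sE.
  have zi : z \in es by apply: sub; rewrite inE.
  by exists (Ordinal (etrans (index_mem z es) zi)); rewrite /si /= nth_index.
pose r i := rn (tau (si i) h) ^+ 2; pose r' i := complex.Re (E (star (j (si i)) ** j (si i)) h h).
(* The sum of the r'_i exceeds that of the r_i by at most the errors, and each r'_i is at least r_i,
   so the excess at the index of [s] alone is at most the errors. *)
have low i : r i <= r' i.
  apply: (proj1 (kerl_lower _ E1)) => h'; apply: Ej; exact: vslice_mem.
have : 0 <= complex.Re (E (\sum_k star (w k) ** w k) h h).
  rewrite kerl_sum raddf_sum sumr_ge0 // => k _; exact/Re_ge0/kerl_pos.
rewrite wE kerlB kerlD kerl_sum (Ej SW) kerlZ E1 ReD ReN ReD Re_realM raddf_sum /=.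
have -> : complex.Re (hdot h h) = rn h ^+ 2 by rewrite hdotE -sn_sqr sn_hd.
have [_] := defect_es H tau h rtau; rewrite sumE -/W /=.
rewrite s0 -/(r i0) -/(r' i0) (bigD1 i0) //= [\sum_(i < n) complex.Re _](bigD1 i0) //= -/(r i0) -/(r' i0).
have : \sum_(i < n | i != i0) r i <= \sum_(i < n | i != i0) r' i by apply: ler_sum => i _.
rewrite /r /r'; lra.
Qed.

Let kernel_unit_slice (K : hilbertType R) (sg : C -> K -> K) (rsg : representation sg)
    x z c u s : hd K z z = 1 -> s = vslice rsg x z (mleft (Phi u) (tens T c aone)) ->
  forall d h h', E (d ** j s) h h' = E d (tau s h) h'.
Proof.
move=> z1 sE d h h'; have Ss : S s by rewrite sE; exact: vslice_mem.
by apply: (proj2 (kerl_lower (Ej Ss h) E1)); apply: (kernel_slice_upper h z1 sE).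
Qed.

(** Slices at unit vectors are settled by the equality case of [kerl_lower]. The property is linear
    in [s], and it is closed because [embed_bound] controls j(s - y) inside the kernel. *)
Lemma kernel_multiplicative s : S s -> forall d h h', E (d ** j s) h h' = E d (tau s h) h'.
Proof.
pose P s := forall d h h', E (d ** j s) h h' = E d (tau s h) h'.
suff : S `<=` [set s | S s /\ P s] by move=> h /h [].
have P0 : P 0.
  move=> d h h'; rewrite (embed0 S1 jL) amul0r kerl0 (lin0 (rep_linl rtau h)).
  by have := kerlPl E (-1) d h h h'; rewrite scaleN1r addNr mulN1r addNr.
have PL (a : R[i]) x y : S x -> S y -> P x -> P y -> P (a *: x + y).
  move=> Sx Sy Px Py d h h'; rewrite jL // amulDr amulZr kerlD kerlZ Px Py.
  by rewrite (rep_linl rtau h) kerlPl.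
rewrite {1}(slice_spaceE mPhi); apply: closed_span_sub.
- clear s; apply/closed_rn => s hs; have Ss : S s.
    have /closed_rn := @slice_space_closed R A B C T Phi; apply => e /hs [y [Sy _] sy].
    by exists y.
  split=> // d h h'; apply/eqP; rewrite -subr_eq0; apply/eqP.
  pose M := Num.sqrt (complex.Re (E (d ** star d) h' h')).
  apply: (@rn_small R R[i]^o _ (M * rn h + M * rn h)) => e e0.
  have [y [Sy Py] sy] := hs e e0.
  have Sd : S (s - y) by rewrite addrC -scaleN1r; exact: SL.
  have -> : E (d ** j s) h h' - E d (tau s h) h' =
      E (d ** j (s - y)) h h' - E (d ** aone) (tau (s - y) h) h'.
    have jd : j s = j y + j (s - y) by rewrite -(embedD jL) // addrC subrK.
    rewrite jd amulDr kerlD Py amula1 (linB (rep_linl rtau h)) kerlBl; ring.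
  apply: le_trans (rnB _ _) _; rewrite mulrDl; apply: lerD;
    apply: le_trans (kerl_cauchy_schwarz _ _ _ _ _) _; rewrite -mulrA;
    apply: ler_wpM2l; rewrite ?sqrtr_ge0 //.
    rewrite -[rn h * e]ger0_norm ?mulr_ge0 ?rn_ge0 ?(ltW e0) // -sqrtr_sqr ler_wsqrtr //.
    apply: le_trans (embed_bound S1 SL SS jL j1 jpos E h Sd) _.
    rewrite E1 -sn_sqr sn_hd -exprMn mulrC ler_pXn2r ?nnegrE ?mulr_ge0 ?rn_ge0 ?(ltW e0) //.
    by rewrite ler_wpM2l ?rn_ge0 // ltW.
  rewrite star1 amul1a E1 -sn_sqr sn_hd sqrtr_sqr ger0_norm ?rn_ge0 //.
  by apply: le_trans (rn_rep rtau _ _) _; rewrite mulrC ler_wpM2l ?rn_ge0 // ltW.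
- by split; [exact: closed_span0|].
- by move=> a x y [Sx Px] [Sy Py]; split; [exact: SL|exact: PL].
move=> b [K [sg [rsg [x [z [c [u bE]]]]]]]; have Sb : S b by rewrite bE; exact: vslice_mem.
split=> //; have [z0|/rn_gt0 z0] := pselect (z = 0).
  suff -> : b = 0 by [].
  rewrite bE; apply/rn_eq0/eqP; rewrite eq_le rn_ge0 andbT.
  by apply: le_trans (vslice_bound _ _ _ _) _; rewrite z0 rn0 mulr0 mul0r.
(* Slices are antilinear in the second vector, so [z] may be normalized and then start an
   orthonormal family. *)
have z1 : hd K (((rn z)^-1)%:C *: z) (((rn z)^-1)%:C *: z) = 1.
  rewrite sdotZl sdotZr conj_realC sdotE sn_hd -!rmorphM /=.
  by rewrite (_ : _ * _ = 1) ?rmorph1 //; field; rewrite gt_eqF.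
set b1 := vslice rsg x (((rn z)^-1)%:C *: z) (mleft (Phi u) (tens T c aone)).
have -> : b = (rn z)%:C *: b1 + 0.
  rewrite addr0 /b1 vsliceZr conj_realC scalerA -rmorphM /= mulfV ?gt_eqF //.
  by rewrite scale1r.
apply: PL => //; [exact: vslice_mem|exact: closed_span0|].
by move=> d h h'; exact: (kernel_unit_slice z1 (erefl b1)).
Qed.

End SliceKernels.

(** * Hyperrigidity *)

Section KernelDomain.
Context {R : realType} {B D : unitalCstarType R} {H : hilbertType R}.
Context (tau : B -> H -> H) (rtau : representation tau) (E : cp_kernel D H).
Hypothesis E1 : forall h h', E aone h h' = hd H h h'.

(** [d] is in the multiplicative domain with value tau(b), from one side only. The relation passes
    to sums, products and limits but not visibly to adjoints, so its users also carry it for the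
    adjoints. *)
Definition intertwined (d : D) (b : B) := forall c h h', E (c ** d) h h' = E c (tau b h) h'.

Lemma kerl0l d h' : E d 0 h' = 0.
Proof. by have := kerlBl E d 0 0 h'; rewrite !subrr. Qed.

Lemma kerl_norm c d h h' : rn (E (c ** d) h h') <=
  Num.sqrt (complex.Re (E (c ** star c) h' h')) * (rn d * rn h).
Proof.
apply: le_trans (kerl_cauchy_schwarz _ _ _ _ _) _; apply: ler_wpM2l; rewrite ?sqrtr_ge0 //.
rewrite -[rn d * rn h]ger0_norm ?mulr_ge0 ?rn_ge0 // -sqrtr_sqr ler_wsqrtr //.
have := @positive_functional_bound R D (fun x => E x h h) d aone.
rewrite star1 amula1 amul1a E1 -sn_sqr sn_hd exprMn; apply.
  by move=> a x y; exact: kerlP.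
by move=> x; exact: kerl_pos.
Qed.

Lemma intertwined0 : intertwined 0 0.
Proof. by move=> c h h'; rewrite amul0r kerl0 (lin0 (rep_linl rtau h)) kerl0l. Qed.

Lemma intertwined_lin (a : R[i]) d e b c : intertwined d b -> intertwined e c ->
  intertwined (a *: d + e) (a *: b + c).
Proof.
move=> db ec x h h'; rewrite amulDr amulZr kerlD kerlZ db ec.
by rewrite (rep_linl rtau h) kerlPl.
Qed.

Lemma intertwinedM d e b c : intertwined d b -> intertwined e c ->
  intertwined (d ** e) (b ** c).
Proof. by move=> db ec x h h'; rewrite amulA ec db (repM rtau). Qed.

Lemma intertwined_closed d b : (forall e : R, 0 < e -> exists d' b',
  [/\ intertwined d' b', rn (d - d') < e & rn (b - b') < e]) -> intertwined d b.
Proof.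
move=> cl c h h'; apply/eqP; rewrite -subr_eq0; apply/eqP.
set M := Num.sqrt (complex.Re (E (c ** star c) h' h')).
apply: (@rn_small R R[i]^o _ (M * rn h + M * rn h)) => e e0.
have [d' [b' [db dd bb]]] := cl e e0.
have -> : E (c ** d) h h' - E c (tau b h) h' =
    E (c ** (d - d')) h h' - E (c ** aone) (tau (b - b') h) h'.
  by rewrite amulBr kerlB db amula1 (linB (rep_linl rtau h)) kerlBl; ring.
apply: le_trans (rnB _ _) _; rewrite mulrDl; apply: lerD;
  apply: le_trans (kerl_norm _ _ _ _) _; rewrite -mulrA; apply: ler_wpM2l; rewrite ?sqrtr_ge0 //.
  by rewrite mulrC ler_wpM2l ?rn_ge0 // ltW.
apply: le_trans (ler_wpM2r (rn_ge0 _) (rn_aone D)) _; rewrite mul1r.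
by apply: le_trans (rn_rep rtau _ _) _; rewrite mulrC ler_wpM2l ?rn_ge0 // ltW.
Qed.

End KernelDomain.

Section Hyperrigidity.
Context {R : realType} {A B : unitalCstarType R} {C : cstarType R} {T : minTensor C B}.
Context {Phi : A -> multiplier T} (mPhi : cstar_Mor Phi).

(** A square factor whose only nonzero row is [d]. *)
Fact mx_positive_family n (d : 'I_n -> B) :
  mx_positive (\matrix_(i, k) (star (d i) ** d k)).
Proof.
case: n d => [|n] d; first by exists 0; apply/matrixP => -[].
exists (\matrix_(i, k) if i == ord0 then d k else 0); apply/matrixP => i k; rewrite !mxE.
rewrite (bigD1 ord0) //= !mxE eqxx big1 ?addr0 // => l /negbTE l0.
by rewrite !mxE l0 amul0r.
Qed.

Section UcpKernel.
Context {H : hilbertType R} {eta : B -> H -> H} (ucp : unital_completely_positive eta).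

Fact ucp_kernelP (a : R[i]) d d' h h' :
  hd H (eta (a *: d + d') h) h' = a * hd H (eta d h) h' + hd H (eta d' h) h'.
Proof. by have [_ -> _ _] := ucp; rewrite sdotPl. Qed.

Fact ucp_kernelPl (a : R[i]) d h k h' :
  hd H (eta d (a *: h + k)) h' = a * hd H (eta d h) h' + hd H (eta d k) h'.
Proof. by have [/(_ d) [-> _] _ _ _] := ucp; rewrite sdotPl. Qed.

Fact ucp_kernelPr (a : R[i]) d h h' k' :
  hd H (eta d h) (a *: h' + k') = a^* * hd H (eta d h) h' + hd H (eta d h) k'.
Proof. by rewrite sdotDr sdotZr. Qed.

Fact ucp_kernel_ge0 n (d : 'I_n -> B) (h : 'I_n -> H) :
  0 <= \sum_i \sum_k hd H (eta (star (d i) ** d k) (h k)) (h i).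
Proof.
have [_ _ _ pos] := ucp; have := pos n _ (mx_positive_family d) h.
by congr (0 <= _); apply: eq_bigr => i _; apply: eq_bigr => k _; rewrite mxE.
Qed.

Definition ucp_kernel : cp_kernel B H :=
  CPKernel ucp_kernelP ucp_kernelPl ucp_kernelPr ucp_kernel_ge0.

End UcpKernel.

Lemma cstar_generated_sub (S D : set B) : cstar_subalgebra D -> S `<=` D -> cstar_generated S `<=` D.
Proof. by move=> hD SD x /(_ D); apply. Qed.

(** The case D = B, j = id. The elements intertwined with themselves together with their adjoints
    form a C*-subalgebra containing [S]; at c = 1 the relation reads eta(b) = tau(b). *)
Lemma slice_space_hyperrigid : cstar_generated (slice_space Phi) = setT ->
  hyperrigid (slice_space Phi).
Proof.
move=> gen H tau eta rtau ucp agree; have S1 := slice_space_one mPhi gen.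
have [eta_op etaL eta1 _] := ucp; have E1 h h' : ucp_kernel ucp aone h h' = hd H h h'.
  by rewrite /= eta1.
have Ej s : slice_space Phi s -> forall h h', ucp_kernel ucp s h h' = hd H (tau s h) h'.
  by move=> Ss h h'; rewrite agree.
have mult s : slice_space Phi s -> intertwined tau (ucp_kernel ucp) s s.
  by move=> Ss; apply: (@kernel_multiplicative R A B C T Phi mPhi B id S1 _ _ _ H tau rtau
       (ucp_kernel ucp) Ej E1 s Ss) => // n X _ [Y ->]; exists Y; apply/matrixP => i k; rewrite !mxE.
pose P := intertwined tau (ucp_kernel ucp).
have all b : P b b.
  suff : cstar_generated (slice_space Phi) `<=` [set b | P b b /\ P (star b) (star b)].
    by rewrite gen => /(_ b I) [].
  apply: cstar_generated_sub => [|s Ss]; last first.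
    by split; apply: mult => //; exact: slice_space_star.
  split.
  - by rewrite /= star0; split; exact: intertwined0.
  - move=> a x y [Px Px'] [Py Py']; split; first exact: intertwined_lin.
    by rewrite starD starZ; exact: intertwined_lin.
  - by move=> x y [Px Px'] [Py Py']; rewrite /= starM; split; exact: intertwinedM.
  - by move=> x [Px Px']; rewrite /= starK; split.
  - apply/closed_rn => v hv; split; apply: (intertwined_closed rtau E1) => e /hv [x [Px Px'] vx].
      by exists x, x; split.
    by exists (star x), (star x); rewrite -starB rn_star.
apply/funext => b; apply/funext => h; apply/eqP; rewrite -subr_eq0; apply/eqP/(@hd_eq0 R H).
by have := all b aone h (tau b h - eta b h); rewrite /= amul1a eta1 !hdotE sdotBl => ->; rewrite subrr.
Qed.

End Hyperrigidity.

(** * Arveson's extension theorem *)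

Section Sesquilinear.
Context {R : realType} {D : unitalCstarType R} {H : hilbertType R} (E : D -> H -> H -> R[i]).
Hypotheses (EL : forall (a : R[i]) d d' h h', E (a *: d + d') h h' = a * E d h h' + E d' h h')
  (EC : forall d h h', E (star d) h' h = (E d h h')^*)
  (Epos : forall n (d : 'I_n -> D) (h : 'I_n -> H),
    0 <= \sum_i \sum_k E (star (d i) ** d k) (h k) (h i))
  (E1 : forall h h', E aone h h' = hd H h h').

Let linE h h' : linear (fun d => E d h h' : R[i]^o).
Proof. by move=> a d d'; exact: EL. Qed.
Let EZ a d h h' : E (a *: d) h h' = a * E d h h'.
Proof. exact: (linZ (linE h h')). Qed.
Let EN d h h' : E (- d) h h' = - E d h h'.
Proof. exact: (linN (linE h h')). Qed.
Let E0 h h' : E 0 h h' = 0. Proof. exact: (lin0 (linE h h')). Qed.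

(* [1 (x) (a h + k) - a 1 (x) h - 1 (x) k] is a null vector of the form defined by [E]. *)
Lemma kernel_linear a d h k h' : E d (a *: h + k) h' = a * E d h h' + E d k h'.
Proof.
pose v : {ffun 'I_4 -> D} := [ffun i : 'I_4 => match val i with
  | 0%N => 0 | 1%N => aone | 2%N => - a *: aone | _ => - aone end : D].
pose u : {ffun 'I_4 -> D} := [ffun i : 'I_4 => match val i with
  | 0%N => star d | _ => 0 end : D].
pose hh (i : 'I_4) := match val i with
  | 0%N => h' | 1%N => a *: h + k | 2%N => h | _ => k end.
pose g := family_dot EL EC Epos hh.
have v0 : sn g v = 0.
  suff e : g v v = 0 by rewrite /sn e sqrtr0.
  rewrite /= !big_ord_recl !big_ord0 !ffunE /= !(star0, amul0l, amul0r, E0, starN, starZ, star1).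
  rewrite !(amulNl, amulNr, amulZl, amulZr, amul1a, EN, EZ, E1).
  rewrite !(sdotDl, sdotDr, sdotZl, sdotZr) rmorphN /=; ring.
have guv : g v u = E d (a *: h + k) h' - (a * E d h h' + E d k h').
  rewrite /= !big_ord_recl !big_ord0 !ffunE /= !(star0, amul0l, amul0r, E0, starK).
  rewrite !(amulNr, amulZr, amula1, EN, EZ); ring.
apply/eqP; rewrite -subr_eq0 -guv; apply/eqP/rn_eq0/eqP.
rewrite eq_le rn_ge0 andbT; apply: le_trans (cauchy_schwarz _ _ _) _.
by rewrite v0 mul0r.
Qed.

Fact kernel_antilinear a d h h' k' : E d h (a *: h' + k') = a^* * E d h h' + E d h k'.
Proof.
have F x : E d h x = (E (star d) x h)^* by rewrite -EC starK.
by rewrite !F kernel_linear rmorphD rmorphM.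
Qed.

Definition sesquilinear_kernel : cp_kernel D H :=
  CPKernel EL kernel_linear kernel_antilinear Epos.

End Sesquilinear.

Lemma sum_pick (V : nmodType) (T : eqType) (hs : seq T) x0 x (f : T -> V) :
  uniq hs -> x \in hs -> \sum_(i < size hs | nth x0 hs i == x) f (nth x0 hs i) = f x.
Proof.
move=> us xs; pose i0 := Ordinal (etrans (index_mem x hs) xs).
rewrite (big_pred1 i0) /= ?nth_index // => i; rewrite /= -val_eqE /=.
by apply/eqP/eqP => [<-|->]; rewrite ?nth_index ?index_uniq.
Qed.

Section Arveson.
Context {R : realType} {B D : unitalCstarType R} (S : set B) (j : B -> D).
Hypotheses (S1 : S aone) (SL : forall (a : R[i]) x y, S x -> S y -> S (a *: x + y))
  (SS : forall x, S x -> S (star x)).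
Hypotheses (jL : forall (a : R[i]) x y, S x -> S y -> j (a *: x + y) = a *: j x + j y)
  (j1 : j aone = aone)
  (jemb : forall n (X : 'M[B]_n), (forall i k, S (X i k)) ->
     (mx_positive X <-> mx_positive (map_mx j X))).
Context {H : hilbertType R} {tau : B -> H -> H} (rtau : representation tau).
Hypothesis tau1 : forall h, tau aone h = h.

Local Notation V := ((H * H)%type -> D).
Implicit Types (d : D) (p q : H * H) (v : V).

(* [single d (h, h')] stands for the functional [E |-> E d h h'] on kernels. *)
Let ind p q : R := (p == q)%:R.
Let single d q : V := fun p => (ind p q)%:C *: d.
Let dsum (z : seq (D * (H * H))) : V := fun p => \sum_(x <- z) single x.1 x.2 p.
Let W : set V := [set v | exists z, v = dsum z].
(** Positive hermitian part, as a sum of kernels y(h')^* y(h). Functions with zero hermitian part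
    lie in [P] with both signs, so a functional positive on [P] is automatically hermitian. *)
Let P : set V := [set v | exists m (y : 'I_m -> H -> D), forall h h',
  v (h, h') + star (v (h', h)) = \sum_k star (y k h') ** y k h].
Let value (z : seq (B * (H * H))) : R[i] := \sum_(x <- z) hd H (tau x.1 x.2.1) x.2.2.
(** The graph to be extended: j(s) placed at (h, h') goes to the real part of <tau(s) h, h'>. *)
Let G0 v (r : R) := exists z : seq (B * (H * H)),
  [/\ forall x, x \in z -> S x.1, v = dsum [seq (j x.1, x.2) | x <- z] &
      r = complex.Re (value z)].

Let dsum_cat z z' : dsum (z ++ z') = dsum z + dsum z'.
Proof. by apply/funext => p; rewrite /dsum big_cat. Qed.

Let dsumZ (a : R[i]) z : dsum [seq (a *: x.1, x.2) | x <- z] = a *: dsum z.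
Proof.
apply/funext => p; transitivity (a *: \sum_(x <- z) single x.1 x.2 p); last by [].
rewrite scaler_sumr /dsum big_map; apply: eq_bigr => x _.
by rewrite /single /= !scalerA mulrC.
Qed.

Let WD x y : W x -> W y -> W (x + y).
Proof. by move=> [z ->] [z' ->]; exists (z ++ z'); rewrite dsum_cat. Qed.

Let WZ (a : R[i]) x : W x -> W (a *: x).
Proof. by move=> [z ->]; exists [seq (a *: x.1, x.2) | x <- z]; rewrite dsumZ. Qed.

Let W1 d q : W (single d q).
Proof. by exists [:: (d, q)]; apply/funext => p; rewrite /dsum big_seq1. Qed.

Let P0 v : (forall h h', v (h, h') + star (v (h', h)) = 0) -> P v.
Proof. by move=> h; exists 0, (fun=> fun=> 0) => k k'; rewrite h big_ord0. Qed.

Let PD x y : P x -> P y -> P (x + y).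
Proof.
move=> [m [f hf]] [n [g hg]].
exists (m + n)%N, (fun k : 'I_(m + n) => match fintype.split k with inl i => f i | inr l => g l end).
move=> h h'; rewrite big_split_ord /=.
rewrite (eq_bigr (fun i => star (f i h') ** f i h)) => [|i _]; last first.
  by rewrite (unsplitK (inl i)).
rewrite [X in _ = _ + X](eq_bigr (fun i => star (g i h') ** g i h)) => [|i _]; last first.
  by rewrite (unsplitK (inr i)).
by rewrite -hf -hg /= starD addrACA.
Qed.

Let PZ (r : R) x : 0 <= r -> P x -> P (r%:C *: x).
Proof.
move=> r0 [m [f hf]]; exists m, (fun k h => (Num.sqrt r)%:C *: f k h) => h h'.
rewrite /= starZr -scalerDr hf scaler_sumr; apply: eq_bigr => k _.
by rewrite starZr amulZl amulZr scalerA -rmorphM /= -expr2 sqr_sqrtr.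
Qed.

Let G0D x y r s : G0 x r -> G0 y s -> G0 (x + y) (r + s).
Proof.
move=> [z [Sz -> ->]] [z' [Sz' -> ->]]; exists (z ++ z'); split.
- by move=> u; rewrite mem_cat => /orP[/Sz|/Sz'].
- by rewrite map_cat dsum_cat.
- by rewrite /value big_cat ReD.
Qed.

Let G0Z t x r : G0 x r -> G0 (t%:C *: x) (t * r).
Proof.
move=> [z [Sz -> ->]]; exists [seq (t%:C *: x.1, x.2) | x <- z]; split.
- by move=> _ /mapP[u /Sz Su ->]; exact: subspaceZ.
- rewrite -dsumZ -!map_comp; congr dsum; apply/eq_in_map => u /Sz Su /=.
  by rewrite (embedZ S1 SL jL).
- rewrite /value -Re_realM mulr_sumr big_map /=; congr (complex.Re _); apply: eq_bigr => u _.
  by rewrite (linZ (rep_linl rtau _)) !hdotE sdotZl.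
Qed.

Let G0W x r : G0 x r -> W x.
Proof. by move=> [z [_ -> _]]; exists [seq (j x.1, x.2) | x <- z]. Qed.

(** Dominated by r/2 placed at (h, h) and at (h', h'): r times the hermitian part of the difference
    is the kernel of r delta_h' - d delta_h plus that of y delta_h, where y^* y = r^2 - d^* d. The
    formulas also cover h = h'. *)
Let single_cofinal d h h' : exists e r, G0 e r /\ P (e - single d (h, h')).
Proof.
pose r := rn d + 1; have r0 : 0 < r by rewrite ltr_wpDl ?rn_ge0.
have [|y yE] := @contractive_defect R D d r; first by rewrite ltrDl.
pose z : seq (B * (H * H)) := [:: (sc B (r / 2), (h, h)); (sc B (r / 2), (h', h'))].
exists (dsum [seq (j x.1, x.2) | x <- z]), (complex.Re (value z)); split.
  by exists z; split=> // x; rewrite !inE => /orP[] /eqP ->; exact: subspaceZ.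
set v := (_ - _); have -> : v = (r^-1)%:C *: (r%:C *: v).
  by rewrite scalerA -rmorphM /= mulVf ?gt_eqF // scale1r.
apply: PZ; first by rewrite invr_ge0 ltW.
pose dl (x k : H) : R := (k == x)%:R.
exists 2, (fun i : 'I_2 => if val i is 0%N then
   (fun k => (dl h' k * r)%:C *: aone - (dl h k)%:C *: d) else (fun k => (dl h k)%:C *: y)).
move=> k k'; rewrite !big_ord_recl big_ord0 /= addr0.
have indE a b x x' : ind (a, b) (x, x') = dl x a * dl x' b.
  by rewrite /ind xpair_eqE -mulnb natrM.
have vE q : (r%:C *: v) q = r%:C *: ((ind q (h, h))%:C *: sc D (r / 2) +
    (ind q (h', h'))%:C *: sc D (r / 2) - (ind q (h, h'))%:C *: d).
  transitivity (r%:C *: (dsum [seq (j x.1, x.2) | x <- z] q - single d (h, h') q)); first by [].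
  by rewrite /dsum !big_cons big_nil /single /= addr0 !(embed_sc S1 SL jL j1).
rewrite !vE !indE !(starB, starD, starZr, star_sc, star1).
have yy : star y ** y = (r ^+ 2)%:C *: aone - star d ** d by rewrite yE addrAC subrr add0r.
rewrite !(amulBl, amulBr, amulZl, amulZr, amul1a, amula1) yy /sc.
have rc : r = r / 2 + r / 2 by rewrite -splitr.
move: (star d ** d) (r / 2) rc => X c ->.
rewrite expr2 !(rmorphM, rmorphD) /=.
move: (dl h k) (dl h k') (dl h' k) (dl h' k') => a a' b b'.
lmod.
Qed.

Let cofinal x : W x -> exists e r, G0 e r /\ P (e - x).
Proof.
have d0 : dsum [::] = 0 by apply/funext => p; rewrite /dsum big_nil.
move=> [z ->]; elim: z => [|[d [h h']] z [e [r [ger Pe]]]].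
  exists 0, 0; split; first by exists [::]; split=> //; rewrite /value big_nil.
  by rewrite d0 subr0; apply: P0 => h h'; rewrite /= star0 addr0.
have [e' [r' [ger' Pe']]] := single_cofinal d h h'.
exists (e' + e), (r' + r); split; first exact: G0D.
have -> : e' + e - dsum ((d, (h, h')) :: z) = (e' - single d (h, h')) + (e - dsum z).
  apply/funext => p.
  transitivity (e' p + e p - (single d (h, h') p + dsum z p)).
    by congr (_ - _); rewrite /dsum big_cons.
  by rewrite opprD addrACA.
exact: PD.
Qed.

(** Here the order on j(S) is carried back to [S]. On the finitely many vectors of [z] the function
    is a matrix over j(S); its hermitian part is positive, so by [jemb] the matrix over [S] is Z^*
    Z, and [tau] turns this into a nonnegative form whose value is 2r. *)
Let G0P x r : G0 x r -> P x -> 0 <= r.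
Proof.
move=> [z [Sz -> ->]] [m [y hy]].
pose hs := undup (map (fun u : B * (H * H) => u.2.1) z ++ map (fun u : B * (H * H) => u.2.2) z).
have uhs : uniq hs := undup_uniq _.
have z1 u : u \in z -> u.2.1 \in hs.
  by move=> uz; rewrite mem_undup mem_cat (map_f (fun u : B * (H * H) => u.2.1)).
have z2 u : u \in z -> u.2.2 \in hs.
  by move=> uz; rewrite mem_undup mem_cat (map_f (fun u : B * (H * H) => u.2.2)) ?orbT.
pose n := size hs; pose e (i : 'I_n) := nth 0 hs i.
pose u (i k : 'I_n) : B := \sum_(x <- z) (ind (e k, e i) x.2)%:C *: x.1.
have S0 : S 0 by exact: (subspace0 S1 SL).
have Ssum (F : B * (H * H) -> R[i]) (z' : seq (B * (H * H))) : (forall x, x \in z' -> S x.1) ->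
    S (\sum_(x <- z') F x *: x.1) /\ j (\sum_(x <- z') F x *: x.1) = \sum_(x <- z') F x *: j x.1.
  elim: z' => [|w z' ih] Sz'; first by rewrite !big_nil (embed0 S1 jL).
  have [w' xz|Sx jx] := ih; first by apply: Sz'; rewrite inE xz orbT.
  have Sx1 : S w.1 by apply: Sz'; rewrite inE eqxx.
  by rewrite !big_cons; split; [exact: SL|rewrite jL // jx].
have Su i k : S (u i k) by apply: (proj1 (Ssum _ _ _)).
have ju i k : j (u i k) = dsum [seq (j x.1, x.2) | x <- z] (e k, e i).
  rewrite (proj2 (Ssum _ _ Sz)) /dsum big_map; by [].
pose t := \sum_i \sum_k hd H (tau (u i k) (e k)) (e i).
have tE : t = value z.
  have -> : t = \sum_(x <- z) \sum_(i < n | e i == x.2.2) \sum_(k < n | e k == x.2.1)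
      hd H (tau x.1 (e k)) (e i).
    rewrite /t; under eq_bigr => i _.
      under eq_bigr => k _ do rewrite (lin_sum (rep_linl rtau _)) sdot_suml.
      rewrite exchange_big /=; over.
    rewrite exchange_big /=; apply: eq_bigr => -[b [a a']] _; rewrite [RHS]big_mkcond.
    apply: eq_bigr => i _ /=; case: ifP => ei; [rewrite [RHS]big_mkcond|rewrite big1 //];
      [apply: eq_bigr|] => k _; rewrite (linZ (rep_linl rtau _)) !hdotE sdotZl /ind xpair_eqE ei ?andbT.
      by case: eqP; rewrite ?mul1r ?mul0r.
    by rewrite andbF mul0r.
  rewrite /value big_seq [RHS]big_seq; apply: eq_bigr => w wz.
  rewrite (sum_pick 0 (fun g => \sum_(k < n | e k == w.2.1) hd H (tau w.1 (e k)) g)) ?z2 //.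
  by rewrite (sum_pick 0 (fun g => hd H (tau w.1 g) w.2.2)) ?z1.
(* Positivity asks for a square factor, while the y_l form an m by n matrix; padding by zeros to
   size n + m makes both matrices square. *)
pose X : 'M[B]_(n + m) := \matrix_(p, q) match fintype.split p, fintype.split q with
  | inl i, inl k => u i k + star (u k i) | _, _ => 0 end.
pose Y : 'M[D]_(n + m) := \matrix_(p, q) match fintype.split p, fintype.split q with
  | inr l, inl k => y l (e k) | _, _ => 0 end.
have SX (a b : 'I_(n + m)) : S (X a b).
  rewrite mxE; case: (fintype.split a) (fintype.split b) => [i|l] [k|l'] //.
  by apply: (subspaceD SL) => //; exact: SS.
have jX : mx_positive (map_mx j X).
  exists Y; apply/matrixP => p q; rewrite !mxE big_split_ord /= big1 ?add0r => [|l _]; last first.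
    by rewrite !mxE (unsplitK (inl l)) amul0r.
  under eq_bigr => l _ do rewrite !mxE (unsplitK (inr l)).
  case: (fintype.split p) (fintype.split q) => [i|l] [k|l'];
    rewrite ?(embed0 S1 jL); last 3 first.
  - by rewrite big1 // => ? _; rewrite amul0r.
  - by rewrite big1 // => ? _; rewrite star0 amul0l.
  - by rewrite big1 // => ? _; rewrite amul0r.
  rewrite -hy (embedD jL) ?(embed_star S1 SL SS jL j1 (fun n X SX => proj1 (jemb SX))) ?ju //.
  exact: SS.
have [Z ZE] := proj2 (jemb SX) jX.
have : 0 <= \sum_i \sum_k hd H (tau (u i k + star (u k i)) (e k)) (e i).
  have -> : \sum_i \sum_k hd H (tau (u i k + star (u k i)) (e k)) (e i) =
      \sum_p hd H (\sum_k tau (Z p (lshift m k)) (e k)) (\sum_k tau (Z p (lshift m k)) (e k)).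
    under [RHS]eq_bigr => p _ do rewrite sdot_suml; rewrite [RHS]exchange_big /=.
    rewrite exchange_big /=; apply: eq_bigr => k _.
    under [RHS]eq_bigr => p _ do rewrite hdotE sdot_sumr; rewrite [RHS]exchange_big /=.
    apply: eq_bigr => i _; move/matrixP: ZE => /(_ (lshift m i) (lshift m k)).
    rewrite !mxE !(unsplitK (inl _)) => ->.
    rewrite (lin_sum (rep_linl rtau _)) !hdotE sdot_suml; apply: eq_bigr => p _.
    by rewrite (repM rtau) !hdotE (rep_star rtau).
  by apply: sumr_ge0 => p _; exact: sdot_ge0.
have -> : \sum_i \sum_k hd H (tau (u i k + star (u k i)) (e k)) (e i) = t + t^*.
  rewrite {2}/t rmorph_sum.
  rewrite [X in _ = _ + X](eq_bigr (fun i => \sum_k (hd H (tau (u i k) (e k)) (e i))^*)) => [|i _];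
    last by rewrite rmorph_sum.
  rewrite [X in _ = _ + X]exchange_big /= -big_split; apply: eq_bigr => i _ /=.
  rewrite -big_split; apply: eq_bigr => k _ /=.
  by rewrite (linD (rep_linl rtau _)) !hdotE sdotDl (rep_star rtau) -sdotC.
move/Re_ge0; rewrite ReD cRe_conj tE; lra.
Qed.

(** E d h h' is the complexified extension at [single d (h, h')]. Vectors are mere labels in
    functions on H x H, so no linearity in them is built in; [sesquilinear_kernel] recovers it from
    positivity and the value at 1. *)
Lemma arveson_kernel : exists E : cp_kernel D H,
  (forall s, S s -> forall h h', E (j s) h h' = hd H (tau s h) h') /\
  (forall h h', E aone h h' = hd H h h').
Proof.
have WZr (r : R) x : W x -> W (r%:C *: x) by exact: WZ.
have W0 : W 0 by rewrite -[0](scale0r (single 0 (0, 0))); apply: WZ; exact: W1.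
have P00 : P 0 by apply: P0 => h h'; rewrite /= star0 addr0.
have G00 : G0 0 0 by have [e [r [ger _]]] := cofinal W0; have := G0Z 0 ger; rewrite scale0r mul0r.
have [f [fD fZ fG fP]] := riesz_extension WD WZr P00 PD PZ G00 G0D G0Z G0P G0W cofinal.
pose F := complexify f.
have FD x y : W x -> W y -> F (x + y) = F x + F y by exact: complexifyD.
have FZ a x : W x -> F (a *: x) = a * F x by exact: (complexifyZ WZ fD fZ).
pose E d h h' := F (single d (h, h')).
have EL (a : R[i]) d d' h h' : E (a *: d + d') h h' = a * E d h h' + E d' h h'.
  rewrite /E -FZ; last exact: W1.
  rewrite -FD; [|by apply: WZ; exact: W1|exact: W1].
  congr (F _); apply/funext => p.
  transitivity (a *: single d (h, h') p + single d' (h, h') p); last by [].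
  by rewrite /single scalerDr !scalerA mulrC.
have fN x : W x -> f (- x) = - f x.
  by move=> Wx; have := fZ (-1) x Wx; rewrite rmorphN1 scaleN1r mulN1r.
have skew x : W x -> (forall h h', x (h, h') + star (x (h', h)) = 0) -> f x = 0.
  move=> Wx hx; apply/eqP; rewrite eq_le; apply/andP; split; last by apply: fP => //; exact: P0.
  rewrite -oppr_ge0 -fN //; apply: fP; first by rewrite -scaleN1r; exact: WZ.
  by apply: P0 => h h'; transitivity (- (x (h, h') + star (x (h', h))));
    [rewrite opprD -starN|rewrite hx oppr0].
(* The difference of the two functions has zero hermitian part. *)
have fC d q : f (single (star d) q) = f (single d (q.2, q.1)).
  apply/eqP; rewrite -subr_eq0 -fN // -fD //; last by rewrite -scaleN1r; exact: WZ.
  apply/eqP/skew => [|h h']; first by apply: WD => //; rewrite -scaleN1r; exact: WZ.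
  transitivity (single (star d) q (h, h') - single d (q.2, q.1) (h, h') +
    star (single (star d) q (h', h) - single d (q.2, q.1) (h', h))); first by [].
  rewrite /single starB !starZr starK.
  have -> : ind (h', h) q = ind (h, h') (q.2, q.1).
    by case: q => a b; rewrite /ind !xpair_eqE andbC.
  have -> : ind (h', h) (q.2, q.1) = ind (h, h') q.
    by case: q => a b; rewrite /ind !xpair_eqE andbC.
  lmod.
have si (a : R[i]) d q : a *: single d q = single (a *: d) q.
  apply/funext => p; transitivity (a *: single d q p); first by [].
  by rewrite /single !scalerA mulrC.
have EC d h h' : E (star d) h' h = (E d h h')^*.
  rewrite /E /F /complexify !si fC /=.
  have -> : 'i *: star d = star (- ('i *: d)).
    by rewrite starN starZ conj_i scaleNr opprK.
  have sN d' q : single (- d') q = - single d' q.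
    by rewrite -[- d']scaleN1r -si scaleN1r.
  rewrite fC /= sN fN //.
  by rewrite rmorphB rmorphM /= conj_i !conj_realC rmorphN mulrN mulNr.
have Fsum I (r : seq I) (x : I -> V) : (forall i, W (x i)) ->
    W (\sum_(i <- r) x i) /\ F (\sum_(i <- r) x i) = \sum_(i <- r) F (x i).
  move=> Wx; elim: r => [|i r [Wr Fr]].
    by rewrite !big_nil; split=> //; have := FZ 0 0 W0; rewrite scale0r mul0r.
  by rewrite !big_cons; split; [exact: WD|rewrite FD // Fr].
have Epos n (d : 'I_n -> D) (h : 'I_n -> H) :
    0 <= \sum_i \sum_k E (star (d i) ** d k) (h k) (h i).
  pose v : V := \sum_i \sum_k single (star (d i) ** d k) (h k, h i).
  have Wv' i : W (\sum_k single (star (d i) ** d k) (h k, h i)) by apply: (proj1 (Fsum _ _ _ _)).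
  have Wv : W v by apply: (proj1 (Fsum _ _ _ _)).
  have -> : \sum_i \sum_k E (star (d i) ** d k) (h k) (h i) = F v.
    rewrite /v (proj2 (Fsum _ _ _ Wv')); apply: eq_bigr => i _.
    by rewrite (proj2 (Fsum _ _ _ _)).
  have vE k k' : v (k, k') = \sum_i \sum_l (ind (k, k') (h l, h i))%:C *: (star (d i) ** d l).
    by rewrite /v fct_sumE; apply: eq_bigr => i _; rewrite fct_sumE.
  have vS k k' : star (v (k', k)) = v (k, k').
    rewrite !vE star_sum exchange_big /=; apply: eq_bigr => i _.
    rewrite star_sum; apply: eq_bigr => l _; rewrite starZr starM starK.
    by congr (_%:C *: _); rewrite /ind !xpair_eqE andbC.
  have f0 : f ('i *: v) = 0.
    apply: skew => [|k k']; first exact: WZ.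
    transitivity ('i *: v (k, k') + star ('i *: v (k', k))); first by [].
    by rewrite starZ conj_i vS scaleNr subrr.
  rewrite /F /complexify f0 mulr0 subr0 lecR; apply: fP => //.
  pose y k := \sum_l ((k == h l)%:R : R)%:C *: d l.
  exists 2, (fun=> y) => k k'; rewrite vS !big_ord_recl big_ord0 addr0.
  suff -> : v (k, k') = star (y k') ** y k by [].
  rewrite vE /y star_sum amul_suml; apply: eq_bigr => i _.
  rewrite amul_sumr; apply: eq_bigr => l _.
  rewrite starZr amulZl amulZr scalerA -rmorphM /=; congr (_%:C *: _).
  by rewrite /ind xpair_eqE -mulnb natrM mulrC.
have Ej s : S s -> forall h h', E (j s) h h' = hd H (tau s h) h'.
  move=> Ss h h'; have fj s' : S s' -> f (single (j s') (h, h')) = complex.Re (hd H (tau s' h) h').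
    move=> Ss'; apply: fG; exists [:: (s', (h, h'))]; split.
    - by move=> x; rewrite inE => /eqP ->.
    - by apply/funext => p; rewrite /dsum big_seq1.
    - by rewrite /value big_seq1.
  rewrite /E /F /complexify si -(embedZ S1 SL jL) // !fj //; last exact: subspaceZ.
  rewrite (linZ (rep_linl rtau h)) sdotZl Re_iM rmorphN mulrN opprK.
  by rewrite [RHS]complexE; case: (hd _ _ _).
have E1 h h' : E aone h h' = hd H h h' by rewrite -j1 Ej // tau1.
by exists (sesquilinear_kernel EL EC Epos E1).
Qed.

End Arveson.

(** * The C*-envelope *)

Section ClosedRange.
Context {R : realType} {A B : unitalCstarType R} {f : A -> B} (hf : unital_star_hom f).

Let lf : linear f. Proof. by have [[]] := hf. Qed.
Let fM x y : f (x ** y) = f x ** f y. Proof. by have [[]] := hf. Qed.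
Let fS x : f (star x) = star (f x). Proof. by have [[]] := hf. Qed.
Let f1 : f aone = aone. Proof. by have [] := hf. Qed.

Let f_bound x : rn (f x) <= rn x.
Proof. by have [h _] := hf; exact: star_hom_bound. Qed.

(* [x (1 + x^* x)^-1] is bounded, and is close to [x] when [x] is small. *)
Let small_lift_half x : rn (f x) <= 2^-1 ->
  exists2 y, rn y <= 2 & rn (f x - f y) <= 8^-1.
Proof.
move=> hx; have [u [u1 [uk ku] su com]] := nonneg_resolvent (nonneg_star_mul x) ltr01.
rewrite invr1 scale1r in uk ku; exists (x ** u).
  rewrite -(@ler_pXn2r _ 2) ?nnegrE ?rn_ge0 // -rn_star_amul starM su.
  have -> : u ** star x ** (x ** u) = u - u ** u.
    have -> : u ** star x ** (x ** u) = u ** (sc A 1 + star x ** x) ** u - u ** u.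
      by rewrite /sc !amulE !amula1; lmod.
    by rewrite ku amul1a.
  apply: le_trans (rnB _ _) _; apply: le_trans (_ : 1 + 1 * 1 <= _); last by rewrite expr2; lra.
  apply: lerD => //; apply: le_trans (rn_amul _ _) _.
  by apply: ler_pM; rewrite ?rn_ge0.
have e : aone - f u = f u ** star (f x) ** f x.
  have := congr1 f ku; rewrite f1 /sc scale1r fM (linD lf) f1 fM fS amulDr amula1 amulA => <-.
  by rewrite addrC addKr.
have -> : f x - f (x ** u) = f x ** (f u ** star (f x) ** f x).
  by rewrite -e amulBr amula1 fM.
apply: le_trans (rn_amul _ _) _.
have fu : rn (f u) <= 1 by apply: le_trans (f_bound _) u1.
have h1 := le_trans (rn_amul (f u ** star (f x)) (f x)) (ler_wpM2r (rn_ge0 _) (rn_amul _ _)).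
rewrite rn_star in h1; move: h1 hx fu (rn_ge0 (f x)) (rn_ge0 (f u))
  (rn_ge0 (f u ** star (f x) ** f x)).
move: (rn (f x)) (rn (f u)) (rn (_ ** _)) => a b c h1 a2 b1 a0 b0 c0.
have h2 : b * a * a <= a * a by rewrite -mulrA ler_piMl // mulr_ge0.
have h3 : a * a <= 2^-1 * 2^-1 by apply: ler_pM.
apply: le_trans (_ : 2^-1 * (2^-1 * 2^-1) <= _); last by lra.
by apply: ler_pM => //; lra.
Qed.

Let small_lift x (r : R) : 0 < r -> rn (f x) <= r ->
  exists2 y, rn y <= 4 * r & rn (f x - f y) <= r / 4.
Proof.
move=> r0 hx; pose s := 2 * r; have s0 : 0 < s by rewrite mulr_gt0.
have [|y hy fy] := @small_lift_half ((s^-1)%:C *: x).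
  rewrite (linZ lf) rnZr gtr0_norm ?invr_gt0 // mulrC ler_pdivrMr //.
  by rewrite /s mulrA mulVf ?mul1r.
exists (s%:C *: y).
  rewrite rnZr gtr0_norm // /s; move: hy r0; move: (rn y) => a; nra.
have -> : f x - f (s%:C *: y) = s%:C *: (f ((s^-1)%:C *: x) - f y).
  rewrite !(linZ lf) scalerBr scalerA -rmorphM /= mulfV ?gt_eqF // scale1r //.
rewrite rnZr gtr0_norm // /s; move: fy r0; move: (rn _) => a; nra.
Qed.

(** Successive approximation as in the open mapping theorem: each round lifts an approximation of
    the residual, with norm controlled by the residual, so the lifts sum to a preimage. *)
Lemma star_hom_closed_range : closed (range f).
Proof.
apply/closed_rn => y hy.
pose P y := forall e : R, 0 < e -> exists x, rn (y - f x) < e.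
have Py : P y by move=> e /hy [_ [x _ <-] h]; exists x.
(* If |w - f x| < |w|/4 then |f x| <= 2 |w|, and [small_lift] with r = 2 |w| gives norm at most 8
   |w| and error |w|/2, in total 3/4 |w|. *)
have /choice [F hF] : forall y, exists x, P y -> rn x <= 8 * rn y /\ rn (y - f x) <= 3 / 4 * rn y.
  move=> w; have [Pw|nP] := pselect (P w); last by exists 0.
  have [->|/eqP /rn_gt0 w0] := eqVneq w 0.
    by exists 0 => _; rewrite (lin0 lf) subr0 !rn0 !mulr0.
  have [|x hx] := Pw (rn w / 4); first by rewrite divr_gt0.
  have fx : rn (f x) <= 2 * rn w.
    have := rn_sub (f x) w; rewrite rn_distC in hx *; lra.
  have [|y' h1 h2] := @small_lift x (2 * rn w) _ fx; first by rewrite mulr_gt0.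
  exists y' => _; split; first by lra.
  by apply: le_trans (rn_tri (f x) _ _) _; lra.
pose G (p : A * B) := (p.1 + F p.2, p.2 - f (F p.2)).
pose u n := iter n G (0, y).
have uP n : P (u n).2 /\ f (u n).1 = y - (u n).2.
  elim: n => [|n [ih1 ih2]] /=; first by rewrite (lin0 lf) subrr.
  split; last by rewrite (linD lf) ih2; lmod.
  move=> e e0; have [x hx] := ih1 e e0; exists (x - F (u n).2).
  rewrite (linB lf); have -> : (u n).2 - f (F (u n).2) - (f x - f (F (u n).2)) = (u n).2 - f x by lmod.
  by [].
have un n : rn (u n).2 <= rn y * (3 / 4) ^+ n.
  elim: n => [|n ih] /=; first by rewrite mulr1.
  have [_ h] := hF _ (proj1 (uP n)); apply: le_trans h _.
  rewrite exprS mulrCA ler_wpM2l // divr_ge0 //.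
have q0 : 0 <= 3 / 4 :> R by rewrite divr_ge0.
have q1 : 3 / 4 < 1 :> R by lra.
have [||n|l [hl _]] := @geom_cauchy R A (fun n => (u n).1) (8 * rn y) (3 / 4).
- by rewrite divr_ge0.
- by lra.
- rewrite /= addrC addKr; have [h _] := hF _ (proj1 (uP n)); apply: le_trans h _.
  by rewrite -mulrA ler_wpM2l // un.
exists l => //; apply/eqP; rewrite -subr_eq0; apply/eqP; apply: (@rn_small R B _ 2) => e e0.
have [N1 h1] := hl e e0; have [N2 h2] := @geom_small R (3 / 4) (rn y) e q0 q1 e0.
pose n := maxn N1 N2.
have -> : f l - y = f (l - (u n).1) - (u n).2 by rewrite (linB lf) (proj2 (uP n)); lmod.
apply: le_trans (rnB _ _) _; have := h1 n (leq_maxl _ _); have := h2 n (leq_maxr _ _).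
have := un n; have := f_bound (l - (u n).1); lra.
Qed.

End ClosedRange.

Section Envelope.
Context {R : realType} {A B : unitalCstarType R} {C : cstarType R} {T : minTensor C B}.
Context {Phi : A -> multiplier T} (mPhi : cstar_Mor Phi).
Local Notation S := (slice_space Phi).
Hypothesis gen : cstar_generated S = setT.

Section Quotient.
Context {D : unitalCstarType R} {j : B -> D} (ext : cstar_extension S j).

Let S1 : S aone := slice_space_one mPhi gen.
Let SL := fun a x y => @slice_space_lin R A B C T Phi a x y.
Let SS := slice_space_star mPhi.
Let jL (a : R[i]) x y : S x -> S y -> j (a *: x + y) = a *: j x + j y.
Proof. by have [h _ _ _] := ext; exact: h. Qed.
Let j1 : j aone = aone. Proof. by have [_ h _ _] := ext. Qed.
Let jemb n (X : 'M[B]_n) : (forall i k, S (X i k)) ->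
  (mx_positive X <-> mx_positive (map_mx j X)).
Proof. by have [_ _ h _] := ext; exact: h. Qed.
Let jpos n (X : 'M[B]_n) : (forall i k, S (X i k)) -> mx_positive X -> mx_positive (map_mx j X).
Proof. by move=> /jemb h /h. Qed.

(** The graph of the quotient map in the making: every kernel that follows a representation [tau] on
    j(S) must have [d] in its multiplicative domain with value tau(b). *)
Let related (d : D) (b : B) := forall (H : hilbertType R) (tau : B -> H -> H)
  (E : cp_kernel D H), representation tau ->
  (forall s, S s -> forall h h', E (j s) h h' = hd H (tau s h) h') ->
  (forall h h', E aone h h' = hd H h h') -> intertwined tau E d b.

(** Arveson's theorem enters here: a kernel over a representation where |b| is attained sees |d| at
    least as large. Hence the relation is single-valued and contractive. *)
Let related_norm d b : related d b -> rn b <= rn d.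
Proof.
move=> rdb; have [H [rho [xi [rrho rho1 xi1 rbxi]]]] := gelfand_naimark b.
have [E [Ej E1]] := arveson_kernel S1 SL SS jL j1 jemb rrho rho1.
rewrite -rbxi; set h := rho b xi; have [->|/eqP /rn_gt0 h0] := eqVneq h 0.
  by rewrite rn0 rn_ge0.
rewrite -(ler_pM2r h0) -expr2.
have -> : rn h ^+ 2 = rn (E (aone ** d) xi h).
  by rewrite (rdb H rho E rrho Ej E1) E1 sdotE sn_hd rn_real ger0_norm ?sqr_ge0.
apply: le_trans (kerl_norm E1 _ _ _ _) _.
rewrite amul1a star1 E1 -sn_sqr sn_hd sqrtr_sqr ger0_norm ?rn_ge0 // mulrC.
by rewrite ler_wpM2r ?rn_ge0 // ler_piMr ?rn_ge0.
Qed.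

Let rel d b := related d b /\ related (star d) (star b).

Let rel0 : rel 0 0.
Proof. by rewrite /rel !star0; split=> H tau E rtau _ _; exact: intertwined0. Qed.

Let rel_lin (a : R[i]) d e b c : rel d b -> rel e c -> rel (a *: d + e) (a *: b + c).
Proof.
move=> [db db'] [ec ec']; rewrite /rel !starD !starZ; split=> H tau E rtau Ej E1.
  by apply: intertwined_lin (db _ _ _ _ _ _) (ec _ _ _ _ _ _).
by apply: intertwined_lin (db' _ _ _ _ _ _) (ec' _ _ _ _ _ _).
Qed.

Let relM d e b c : rel d b -> rel e c -> rel (d ** e) (b ** c).
Proof.
move=> [db db'] [ec ec']; rewrite /rel !starM; split=> H tau E rtau Ej E1.
  by apply: intertwinedM (db _ _ _ _ _ _) (ec _ _ _ _ _ _).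
by apply: intertwinedM (ec' _ _ _ _ _ _) (db' _ _ _ _ _ _).
Qed.

Let rel_star d b : rel d b -> rel (star d) (star b).
Proof. by move=> [db db']; split=> //; rewrite !starK. Qed.

Let rel_j s : S s -> rel (j s) s.
Proof.
move=> Ss; have h s' : S s' -> related (j s') s'.
  move=> Ss' H tau E rtau Ej E1 d k k'.
  exact: (kernel_multiplicative mPhi S1 jL j1 jpos rtau Ej E1 Ss').
split; first exact: h.
rewrite -(embed_star S1 SL SS jL j1 jpos Ss); exact/h/SS.
Qed.

Let rel_norm d b d' b' : rel d b -> rel d' b' -> rn (b - b') <= rn (d - d').
Proof.
move=> db db'; apply: related_norm.
have -> : d - d' = -1 *: d' + d by lmod.
have -> : b - b' = -1 *: b' + b by lmod.
exact: (proj1 (rel_lin _ db' db)).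
Qed.

Let rel_closed d b : (forall e : R, 0 < e -> exists d' b',
  [/\ rel d' b', rn (d - d') < e & rn (b - b') < e]) -> rel d b.
Proof.
move=> cl; split=> H tau E rtau Ej E1; apply: (intertwined_closed rtau E1) => e /cl [d' [b' [[r r'] dd bb]]].
  by exists d', b'; split=> //; exact: r.
exists (star d'), (star b'); rewrite -!starB !rn_star; split=> //; exact: r'.
Qed.

(** The elements with a partner form a C*-subalgebra containing j(S). It is closed because, by
    [rel_norm], the partners of a convergent sequence are Cauchy; the rate 2^-n suits
    [geom_cauchy]. *)
Let rel_total d : exists b, rel d b.
Proof.
suff : cstar_generated (j @` S) `<=` [set d | exists b, rel d b].
  by have [_ _ _ ->] := ext => /(_ d I).
apply: cstar_generated_sub => [|_ [s Ss <-]]; last by exists s; exact: rel_j.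
split.
- by exists 0.
- by move=> a x y [b xb] [c yc]; exists (a *: b + c); exact: rel_lin.
- by move=> x y [b xb] [c yc]; exists (b ** c); exact: relM.
- by move=> x [b xb]; exists (star b); exact: rel_star.
apply/closed_rn => v hv.
have h0 : 0 < 2^-1 :> R by rewrite invr_gt0.
have h1 : 2^-1 < 1 :> R by rewrite invf_lt1 ?ltr1n.
have /choice [p hp] : forall n : nat, exists p : D * B, rel p.1 p.2 /\ rn (v - p.1) < 2^-1 ^+ n.
  by move=> n; have [|x [b xb] vx] := hv (2^-1 ^+ n); rewrite ?exprn_gt0 //; exists (x, b).
have [n|b [hb _]] := @geom_cauchy R B (fun n => (p n).2) 2 2^-1 (ltW h0) h1.
  apply: le_trans (rel_norm (proj1 (hp n.+1)) (proj1 (hp n))) _.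
  apply: le_trans (rn_tri v _ _) _; rewrite rn_distC mulr_natl mulr2n.
  apply: lerD; last exact: ltW (proj2 (hp n)).
  apply: le_trans (ltW (proj2 (hp n.+1))) _; by rewrite exprS ler_piMl ?exprn_ge0 ?(ltW h1) ?(ltW h0).
exists b; apply: rel_closed => e e0.
have [N1 H1] := hb e e0; have [N2 H2] := @geom_small R 2^-1 1 e (ltW h0) h1 e0.
pose n := maxn N1 N2; exists (p n).1, (p n).2; split; first exact: (proj1 (hp n)).
  by apply: lt_trans (proj2 (hp n)) _; have := H2 n (leq_maxr _ _); rewrite mul1r.
exact: H1 (leq_maxl _ _).
Qed.

(** Surjective because the range contains [S] and, being closed, is a C*-subalgebra. *)
Lemma quotient_map : exists q : D -> B,
  [/\ unital_star_hom q, set_surj setT setT q & forall s, S s -> q (j s) = s].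
Proof.
have /choice [q hq] := rel_total.
have uniq d b : rel d b -> q d = b.
  move=> db; apply/eqP; rewrite -subr_eq0; apply/eqP/rn_eq0/eqP.
  by rewrite eq_le rn_ge0 andbT; apply: le_trans (rel_norm (hq d) db) _; rewrite subrr rn0.
have qj s : S s -> q (j s) = s by move=> Ss; apply: uniq; exact: rel_j.
have hom : unital_star_hom q.
  split; last by rewrite -j1 qj.
  split=> [a x y|x y|x]; apply: uniq.
  - exact: rel_lin.
  - exact: relM.
  - exact: rel_star.
exists q; split=> // b _.
suff : cstar_generated S `<=` range q by rewrite gen; exact.
apply: cstar_generated_sub => [|s Ss]; last by exists (j s) => //; exact: qj.
have [[lq qM qS] q1] := hom; split.
- by exists 0 => //; exact: lin0 lq.
- by move=> a x y [d _ <-] [e _ <-]; exists (a *: d + e); rewrite ?lq.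
- by move=> x y [d _ <-] [e _ <-]; exists (d ** e); rewrite ?qM.
- by move=> x [d _ <-]; exists (star d); rewrite ?qS.
- exact: star_hom_closed_range.
Qed.

End Quotient.

Lemma cstar_extension_id : cstar_extension S (id : B -> B).
Proof.
by split=> //; [move=> n X _; rewrite map_mx_id|rewrite image_id].
Qed.

(** [B] with the identity is an envelope. For any other, the map from [B] given by its universal
    property is onto, and injective because [quotient_map] composed with it fixes the generators. *)
Lemma slice_space_envelope : equals_cstar_envelope S.
Proof.
split.
  exists B, id; split; first exact: cstar_extension_id.
  by move=> D j ext; exact: quotient_map.
move=> E k [extk univ]; have [q1 [hom1 surj1 q1k]] := univ B id cstar_extension_id.
have [q2 [hom2 surj2 q2k]] := quotient_map extk.
have [[l1 M1 S1] u1] := hom1; have [[l2 M2 S2] u2] := hom2.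
have K b : q2 (q1 b) = b.
  suff : cstar_generated S `<=` [set b | q2 (q1 b) = b] by rewrite gen; exact.
  apply: cstar_generated_sub => [|s Ss]; last by rewrite /= q1k // q2k.
  split.
  - by rewrite /= (lin0 l1) (lin0 l2).
  - by move=> a x y xE yE; rewrite /= l1 l2 xE yE.
  - by move=> x y xE yE; rewrite /= M1 M2 xE yE.
  - by move=> x xE; rewrite /= S1 S2 xE.
  - apply/closed_rn => v hv; apply/eqP; rewrite -subr_eq0; apply/eqP.
    apply: (@rn_small R B _ 2) => e /hv [x xE vx].
    have -> : q2 (q1 v) - v = q2 (q1 (v - x)) - (v - x).
      by rewrite (linB l1) (linB l2) xE; lmod.
    apply: le_trans (rnB _ _) _.
    have := star_hom_bound (proj1 hom1) (v - x).
    have := star_hom_bound (proj1 hom2) (q1 (v - x)); lra.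
exists q1; split=> //; exists q2 => // e.
by have [b _ <-] := surj1 e I; rewrite K.
Qed.

End Envelope.

(** * Subalgebras as types *)

(* The unit need not be that of the ambient algebra, which may have none. *)
Record unital_subalgebra (R : realType) (A : cstarType R) := UnitalSubalgebra {
  sub_carrier : set A ;
  sub_unit : A ;
  sub_cstar : cstar_subalgebra sub_carrier ;
  sub_unit_in : sub_carrier sub_unit ;
  sub_mul1 : forall x, sub_carrier x -> sub_unit ** x = x ;
  sub_mulr1 : forall x, sub_carrier x -> x ** sub_unit = x
}.

Section SubalgebraType.
Context {R : realType} {A : cstarType R} (U : unital_subalgebra A).

Local Notation cU := (sub_carrier U).

Definition sub_pred : {pred A} := fun x => `[< cU x >].

Lemma sub_predP x : reflect (cU x) (x \in sub_pred).
Proof. exact: asboolP. Qed.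

Record subalgebra := SubAlgebra { subval : A ; subvalP : subval \in sub_pred }.

HB.instance Definition _ := [isSub for subval].
HB.instance Definition _ := [Choice of subalgebra by <:].

Fact sub_submod_closed : submod_closed sub_pred.
Proof.
have [U0 UL _ _ _] := sub_cstar U; split; first exact/sub_predP.
by move=> a x y /sub_predP Ux /sub_predP Uy; apply/sub_predP; exact: UL.
Qed.
HB.instance Definition _ := GRing.isSubmodClosed.Build R[i] A sub_pred sub_submod_closed.
HB.instance Definition _ := [SubChoice_isSubLmodule of subalgebra by <:].

Implicit Types x y : subalgebra.

Lemma subval_in x : cU (subval x). Proof. exact/sub_predP/subvalP. Qed.

Lemma subval_inj : injective subval. Proof. exact: val_inj. Qed.

Lemma subval_linear : linear subval. Proof. by []. Qed.

Let nrm x : R[i] := `|subval x|.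
Fact sub_normD x y : nrm (x + y) <= nrm x + nrm y. Proof. exact: ler_normD. Qed.
Fact sub_normZ (a : R[i]) x : nrm (a *: x) = `|a| * nrm x. Proof. exact: normrZ. Qed.
Fact sub_norm_eq0 x : nrm x = 0 -> x = 0.
Proof. by move=> /eqP; rewrite normr_eq0 => /eqP h; apply: val_inj. Qed.
HB.instance Definition _ := Lmodule_isNormed.Build R[i] subalgebra sub_normD sub_normZ sub_norm_eq0.

Lemma rn_subval x : rn (subval x) = rn x. Proof. by []. Qed.

Fact sub_complete (F : set_system subalgebra) : ProperFilter F -> cauchy F -> cvg F.
Proof.
move=> FF cF; apply: seq_complete => // u hu.
have [|l hl] := @cauchy_rn R A (fun n => subval (u n)); first exact: hu.
have lU : l \in sub_pred.
  have [_ _ _ _ /closed_rn cU] := sub_cstar U; apply/sub_predP/cU => e e0.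
  have [N hN] := hl e e0; exists (subval (u N)); [exact: subval_in|exact: hN].
by exists (SubAlgebra lU).
Qed.
HB.instance Definition _ := Uniform_isComplete.Build subalgebra sub_complete.

Fact sub_mul_in x y : subval x ** subval y \in sub_pred.
Proof. by have [_ _ h _ _] := sub_cstar U; apply/sub_predP/h; exact: subval_in. Qed.
Fact sub_star_in x : star (subval x) \in sub_pred.
Proof. by have [_ _ _ h _] := sub_cstar U; apply/sub_predP/h; exact: subval_in. Qed.

Let mul x y := SubAlgebra (sub_mul_in x y).
Let str x := SubAlgebra (sub_star_in x).

Fact sub_mulA : associative mul.
Proof. by move=> x y z; apply: val_inj; exact: amulA. Qed.
Fact sub_mulPl (a : R[i]) x y z : mul (a *: x + y) z = a *: mul x z + mul y z.
Proof. by apply: val_inj; exact: amulPl. Qed.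
Fact sub_mulPr (a : R[i]) x y z : mul z (a *: x + y) = a *: mul z x + mul z y.
Proof. by apply: val_inj; exact: amulPr. Qed.
Fact sub_starP (a : R[i]) x y : str (a *: x + y) = a^* *: str x + str y.
Proof. by apply: val_inj; exact: starP. Qed.
Fact sub_starK : involutive str.
Proof. by move=> x; apply: val_inj; exact: starK. Qed.
Fact sub_starM x y : str (mul x y) = mul (str y) (str x).
Proof. by apply: val_inj; exact: starM. Qed.
Fact sub_norm_mul x y : `|mul x y| <= `|x| * `|y|.
Proof. exact: norm_amul. Qed.
Fact sub_norm_star x : `|mul (str x) x| = `|x| ^+ 2.
Proof. exact: norm_star_amul. Qed.
HB.instance Definition _ := isCstarAlgebra.Build R subalgebra sub_mulA sub_mulPl sub_mulPr
  sub_starP sub_starK sub_starM sub_norm_mul sub_norm_star.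

Let one := SubAlgebra (introT (sub_predP _) (sub_unit_in U)).
Fact sub_mul1a : left_id one (amul : subalgebra -> subalgebra -> subalgebra).
Proof. by move=> x; apply: val_inj; exact: (sub_mul1 (subval_in x)). Qed.
Fact sub_mula1 : right_id one (amul : subalgebra -> subalgebra -> subalgebra).
Proof. by move=> x; apply: val_inj; exact: (sub_mulr1 (subval_in x)). Qed.
HB.instance Definition _ := isUnitalCstar.Build R subalgebra sub_mul1a sub_mula1.

End SubalgebraType.

(** * Finite-dimensional left factors *)

Section FiniteDimensional.
Context {R : realType} {P M : unitalCstarType R} (T : minTensor P M).
Implicit Types (p : P) (m : M) (t : T).

(** A functional is carried together with its slice map, since slice maps have been constructed for
    vector functionals only; the pairs are stable under linear combinations. *)
Definition sliceable (w : P -> R[i]^o) (s : T -> M) :=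
  bounded_functional w /\ slice_map w s.

Lemma sliceable_lin (a : R[i]) w s w' s' : sliceable w s -> sliceable w' s' ->
  sliceable (fun p => a *: w p + w' p) (fun t => a *: s t + s' t).
Proof.
move=> [[lw cw] [ls cs sE]] [[lw' cw'] [ls' cs' sE']].
have [K K0 hK] := continuous_bounded lw cw; have [K' K'0 hK'] := continuous_bounded lw' cw'.
have [L L0 hL] := continuous_bounded ls cs; have [L' L'0 hL'] := continuous_bounded ls' cs'.
have lww : linear (fun p => a *: w p + w' p) by move=> b x y; rewrite lw lw'; lmod.
have lss : linear (fun t => a *: s t + s' t) by move=> b x y; rewrite ls ls'; lmod.
split; split; [exact: lww| |exact: lss| |].
- apply: (@bounded_continuous R P R[i]^o _ (rn a * K + K') lww) => x.
  apply: le_trans (rnD _ _) _; rewrite mulrDl; apply: lerD (hK' x).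
  by rewrite rnZ -mulrA ler_wpM2l ?rn_ge0 ?hK.
- apply: (@bounded_continuous R T M _ (rn a * L + L') lss) => x.
  apply: le_trans (rnD _ _) _; rewrite mulrDl; apply: lerD (hL' x).
  by rewrite rnZ -mulrA ler_wpM2l ?rn_ge0 ?hL.
- by move=> p m; rewrite sE sE' scalerA scalerDl.
Qed.

Lemma sliceable0 : sliceable (fun=> 0) (fun=> 0).
Proof.
split; split.
- by move=> a x y; rewrite scaler0 addr0.
- by move=> x; exact: cvg_cst.
- by move=> a x y; rewrite scaler0 addr0.
- by move=> x; exact: cvg_cst.
- by move=> p m; rewrite scale0r.
Qed.

Lemma sliceable_sum n (a : 'I_n -> R[i]) w s : (forall i, sliceable (w i) (s i)) ->
  exists v r, sliceable v r /\ forall p, v p = \sum_i a i * (w i p : R[i]).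
Proof.
elim: n a w s => [|n ih] a w s ws.
  by exists (fun=> 0), (fun=> 0); split; [exact: sliceable0|move=> p; rewrite big_ord0].
have [v [r [vr vE]]] := ih (fun i => a (lift ord0 i)) (fun i => w (lift ord0 i))
  (fun i => s (lift ord0 i)) (fun i => ws _).
exists (fun p => a ord0 *: w ord0 p + v p), (fun t => a ord0 *: s ord0 t + r t).
by split; [exact: sliceable_lin|move=> p; rewrite big_ord_recl -vE].
Qed.

Lemma sliceable_separates p : p <> 0 -> exists w s, sliceable w s /\ w p <> 0.
Proof.
move=> p0; have [H [rho [xi [rrho _ _ h]]]] := gelfand_naimark p.
exists (fun c => hd H (rho c xi) (rho p xi)), (vslice rrho xi (rho p xi)); split.
  split; first exact: vector_functional_bounded.
  split; [exact: vslice_linear| |by move=> c m; rewrite vslice_tens].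
  exact: bounded_continuous (vslice_linear _ _ _) (vslice_bound _ _ _).
by move=> /(@hd_eq0 R H) h0; apply/p0/rn_eq0; rewrite -h h0 rn0.
Qed.

(** By induction on [l], adding a functional that is nonzero on the part of [f] not yet reproduced.
    All functionals come from vector functionals, which separate points, so their slice maps
    exist. *)
Lemma dual_system (l : seq P) : exists n (w : 'I_n -> P -> R[i]^o) (s : 'I_n -> T -> M)
    (e : 'I_n -> P), (forall i, sliceable (w i) (s i)) /\
  forall p, p \in l -> p = \sum_i (w i p : R[i]) *: e i.
Proof.
elim: l => [|f l [n [w [s [e [ws fix_]]]]]].
  by exists 0, (fun=> fun=> 0), (fun=> fun=> 0), (fun=> 0); split=> // -[].
pose q p := \sum_i (w i p : R[i]) *: e i; pose y := f - q f.
have [y0|y0] := pselect (y = 0).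
  exists n, w, s, e; split=> // p; rewrite inE => /orP[/eqP ->|/fix_ //].
  by apply/eqP; rewrite -subr_eq0 -/(q f) -/y y0.
have [v [r [vr vy]]] := sliceable_separates y0.
have [v2 [r2 [vr2 v2E]]] := sliceable_sum (fun i => v (e i) : R[i]) ws.
have lv : linear v by have [[]] := vr.
have v2q p : v2 p = v (q p).
  rewrite v2E (lin_sum lv); apply: eq_bigr => i _; rewrite (linZ lv); exact: mulrC.
pose c : R[i] := (v y)^-1.
(* v - v o q, divided by its value at [f]: it vanishes on what is already reproduced. The composite
   v o q is sliceable as the combination [v2] of the w_i. *)
pose v1 p : R[i]^o := c *: (-1 *: v2 p + v p) + 0.
pose r1 t := c *: (-1 *: r2 t + r t) + 0.
have vr1 : sliceable v1 r1 by exact: sliceable_lin (sliceable_lin _ vr2 vr) sliceable0.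
have v1E p : v1 p = c *: (v p - v2 p) by rewrite /v1 addr0 scaleN1r addrC.
exists n.+1, (fun i => if unlift ord0 i is Some k then w k else v1),
  (fun i => if unlift ord0 i is Some k then s k else r1),
  (fun i => if unlift ord0 i is Some k then e k else y); split.
  by move=> i; case: unlift.
move=> p; rewrite inE big_ord_recl unlift_none => pl.
under eq_bigr => i _ do rewrite liftK.
rewrite -/(q p); case/orP: pl => [/eqP ->|/fix_ pE].
  have -> : v1 f = 1 :> R[i].
    rewrite v1E v2q -(linB lv) -/y; exact: (mulVf (introN eqP vy)).
  by rewrite scale1r subrK.
have qp : q p = p := esym pE.
by rewrite v1E v2q qp subrr scaler0 scale0r add0r.
Qed.

Lemma dual_basis : finite_dimensional P -> exists n (w : 'I_n -> P -> R[i]^o)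
    (s : 'I_n -> T -> M) (e : 'I_n -> P), (forall i, sliceable (w i) (s i)) /\
  forall p, p = \sum_i (w i p : R[i]) *: e i.
Proof.
move=> [k [f hf]]; have [n [w [s [e [ws fix_]]]]] := dual_system [seq f i | i <- enum 'I_k].
exists n, w, s, e; split=> // p; have [a ->] := hf p.
rewrite [LHS](eq_bigr (fun l => \sum_i (a l * (w i (f l) : R[i])) *: e i)); last first.
  move=> l _; rewrite {1}(fix_ (f l)) ?map_f ?mem_enum // scaler_sumr.
  by apply: eq_bigr => i _; rewrite scalerA.
rewrite exchange_big; apply: eq_bigr => i _ /=.
have [[lw _] _] := ws i; rewrite (lin_sum lw) scaler_suml; apply: eq_bigr => l _.
by rewrite (linZ lw).
Qed.

Definition tens_one : T := tens T aone aone.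

Lemma tens_one_mull t : tens_one ** t = t.
Proof.
move: t; apply: (@tsum_ext R P M T T _ _ (rn tens_one) 1) => [s t|s t|z].
- by rewrite -amulBr rn_amul.
- by rewrite mul1r.
rewrite /tsum amul_sumr; apply: eq_bigr => x _.
by rewrite tensM !amul1a.
Qed.

Lemma star_tens_one : star tens_one = tens_one.
Proof. by rewrite /tens_one tens_star !star1. Qed.

Lemma tens_one_mulr t : t ** tens_one = t.
Proof. by rewrite -[t ** _]starK starM star_tens_one tens_one_mull starK. Qed.

End FiniteDimensional.

(** * Tensor products with a subalgebra *)

Section SubTensor.
Context {R : realType} {P M : unitalCstarType R} (T : minTensor P M).
Context {n : nat} {w : 'I_n -> P -> R[i]^o} {s : 'I_n -> T -> M} {e : 'I_n -> P}.
Hypotheses (ws : forall i, sliceable (w i) (s i))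
  (we : forall p, p = \sum_i (w i p : R[i]) *: e i).
Context {U : set M} (cU : cstar_subalgebra U) (U1 : U aone).

Let U0 : U 0. Proof. by have [h _ _ _ _] := cU. Qed.
Let UL (a : R[i]) x y : U x -> U y -> U (a *: x + y).
Proof. by have [_ h _ _ _] := cU; exact: h. Qed.
Let UMul x y : U x -> U y -> U (x ** y). Proof. by have [_ _ h _ _] := cU; exact: h. Qed.
Let US x : U x -> U (star x). Proof. by have [_ _ _ h _] := cU; exact: h. Qed.
Let Ucl : closed U. Proof. by have [_ _ _ _ h] := cU. Qed.

Let Usum I (r : seq I) (a : I -> R[i]) (x : I -> M) : (forall i, U (x i)) ->
  U (\sum_(i <- r) a i *: x i).
Proof.
move=> Ux; elim: r => [|i r ih]; first by rewrite big_nil.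
by rewrite big_cons; exact: UL.
Qed.

(** Finite dimension of [P] enters here: every element of the completed tensor product is a finite
    sum, with coefficients given by slices. It holds on finite sums, and both sides are
    continuous. *)
Lemma tens_decomposition (t : T) : t = \sum_i tens T (e i) (s i t).
Proof.
have [K hK] : exists K : R, forall t : T, rn (\sum_i tens T (e i) (s i t)) <= K * rn t.
  have /choice [L hL] : forall i, exists K : R, forall t, rn (s i t) <= K * rn t.
    by move=> i; have [_ [ls cs _]] := ws i; have [K _ h] := continuous_bounded ls cs; exists K.
  exists (\sum_i rn (e i) * L i) => x; apply: le_trans (rn_sum _ _) _.
  rewrite mulr_suml; apply: ler_sum => i _; apply: le_trans (rn_tens _ _ _) _.
  by rewrite -mulrA ler_wpM2l ?rn_ge0.
have lsum : linear (fun t : T => \sum_i tens T (e i) (s i t)).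
  move=> a x y; rewrite scaler_sumr -big_split; apply: eq_bigr => i _ /=.
  by have [_ [ls _ _]] := ws i; rewrite ls tensPr.
move: t; apply: (@tsum_ext R P M T T id _ 1 K) => [x y|x y|z].
- by rewrite mul1r.
- exact: (lin_lip lsum hK).
rewrite (lin_sum lsum); apply: eq_bigr => -[p m] _ /=.
rewrite {1}(we p) (lin_sum (tensPl T m)); apply: eq_bigr => i _.
by have [_ [_ _ sE]] := ws i; rewrite sE (linZ (tensPl T m)) (linZ (tensPr T _)).
Qed.

(** The tensor product of [P] with [U], described inside [T] by slices so that it is visibly closed;
    [tens_decomposition] shows that it is an algebra. *)
Definition slices_in : set T := [set t | forall v r, sliceable v r -> U (r t)].

Lemma slices_in_tens p m : U m -> slices_in (tens T p m).
Proof.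
move=> Um v r [_ [_ _ rE]]; rewrite rE -[_ *: _]addr0; exact: UL.
Qed.

Lemma slices_in_s t i : slices_in t -> U (s i t).
Proof. by apply; exact: ws. Qed.

Lemma slices_in_cstar : cstar_subalgebra slices_in.
Proof.
have lr (v : P -> R[i]^o) (r : T -> M) : sliceable v r -> linear r by move=> [_ []].
have sumP I (l : seq I) (x : I -> T) : (forall i, slices_in (x i)) -> slices_in (\sum_(i <- l) x i).
  move=> hx v r vr; rewrite (lin_sum (lr _ _ vr)).
  have := @Usum I l (fun=> 1) (fun i => r (x i)) (fun i => hx i v r vr).
  by congr U; apply: eq_bigr => i _; rewrite scale1r.
split.
- by move=> v r vr; rewrite (lin0 (lr _ _ vr)).
- by move=> a x y hx hy v r vr; rewrite (lr _ _ vr); apply: UL; [exact: hx vr|exact: hy vr].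
- move=> x y hx hy; rewrite (tens_decomposition x) amul_suml; apply: (sumP) => i.
  rewrite (tens_decomposition y) amul_sumr; apply: (sumP) => k.
  by rewrite tensM; apply/slices_in_tens/UMul; exact: slices_in_s.
- move=> x hx; rewrite (tens_decomposition x) star_sum; apply: (sumP) => i.
  by rewrite tens_star; apply/slices_in_tens/US; exact: slices_in_s.
- apply/closed_rn => v hv u r ur; move/closed_rn: Ucl; apply => d d0.
  have [_ [lr' cr _]] := ur; have [K K0 hK] := continuous_bounded lr' cr.
  have [|x hx vx] := hv (d / K); first by rewrite divr_gt0.
  exists (r x); first exact: hx ur.
  by rewrite -(linB lr'); apply: le_lt_trans (hK _) _; rewrite mulrC -ltr_pdivlMr.
Qed.

Definition sub_right : unital_subalgebra M :=
  UnitalSubalgebra cU U1 (fun x _ => amul1a x) (fun x _ => amula1 x).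

Definition sub_tensor : unital_subalgebra T :=
  UnitalSubalgebra slices_in_cstar (slices_in_tens aone U1)
    (fun x _ => tens_one_mull x) (fun x _ => tens_one_mulr x).

Local Notation M0 := (subalgebra sub_right).
Local Notation T0 := (subalgebra sub_tensor).

Fact sub_tens_in p (m : M0) : tens T p (subval m) \in sub_pred sub_tensor.
Proof. by apply/sub_predP/slices_in_tens; exact: (subval_in m). Qed.
Definition sub_tens p (m : M0) : T0 := SubAlgebra (sub_tens_in p m).

Fact sub_slice_in i (t : T0) : s i (subval t) \in sub_pred sub_right.
Proof. by apply/sub_predP/slices_in_s; exact: (subval_in t). Qed.
Definition sub_slice i (t : T0) : M0 := SubAlgebra (sub_slice_in i t).

Lemma sub_slice_linear i : linear (sub_slice i).
Proof.
by move=> a x y; apply: val_inj; have [_ [ls _ _]] := ws i; exact: ls.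
Qed.

Fact sub_tensPl m : linear (sub_tens^~ m).
Proof. by move=> a x y; apply: val_inj; exact: tensPl. Qed.
Fact sub_tensPr p : linear (sub_tens p).
Proof. by move=> a x y; apply: val_inj; exact: tensPr. Qed.
Fact sub_tensM p p' m m' : sub_tens p m ** sub_tens p' m' = sub_tens (p ** p') (m ** m').
Proof. by apply: val_inj; exact: tensM. Qed.
Fact sub_tens_star p m : star (sub_tens p m) = sub_tens (star p) (star m).
Proof. by apply: val_inj; exact: tens_star. Qed.

Lemma sub_tens_decomposition (t : T0) : t = \sum_i sub_tens (e i) (sub_slice i t).
Proof.
apply: subval_inj; rewrite (lin_sum (@subval_linear R T sub_tensor)).
exact: tens_decomposition.
Qed.

Fact sub_tens_dense : closed_span [set t | exists p m, t = sub_tens p m] = setT.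
Proof.
apply/seteqP; split=> // t _; apply: subset_closure.
exists n, (fun=> 1), (fun i => sub_tens (e i) (sub_slice i t)); split.
  by move=> i; exists (e i), (sub_slice i t).
by rewrite {1}(sub_tens_decomposition t); apply: eq_bigr => i _; rewrite scale1r.
Qed.

Section SpatialNorm.
Context {H K : hilbertType R} {tau : P -> H -> H} {rho : M0 -> K -> K}.
Context (rtau : representation tau) (rrho : representation rho) (u : seq (H * K)).

Let F (t : T0) : R[i] := \sum_i \sum_(p <- u) \sum_(q <- u)
  hd H (tau (e i) p.1) q.1 * hd K (rho (sub_slice i t) p.2) q.2.

Let F_linear (a : R[i]) x y : F (a *: x + y) = a * F x + F y.
Proof.
rewrite /F mulr_sumr -big_split; apply: eq_bigr => i _ /=.
rewrite mulr_sumr -big_split; apply: eq_bigr => p _ /=.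
rewrite mulr_sumr -big_split; apply: eq_bigr => q _ /=.
by rewrite (sub_slice_linear i) (rep_linl rrho) !hdotE sdotPl; ring.
Qed.

Let F_tens c m : F (sub_tens c m) = \sum_(p <- u) \sum_(q <- u)
  hd H (tau c p.1) q.1 * hd K (rho m p.2) q.2.
Proof.
rewrite /F exchange_big; apply: eq_bigr => p _; rewrite exchange_big; apply: eq_bigr => q _ /=.
rewrite {2}(we c) (lin_sum (rep_linl rtau _)) !hdotE sdot_suml mulr_suml; apply: eq_bigr => i _.
have -> : sub_slice i (sub_tens c m) = (w i c : R[i]) *: m.
  by apply: val_inj; have [_ [_ _ sE]] := ws i; exact: sE.
by rewrite (linZ (rep_linl rrho _)) (linZ (rep_linl rtau _)) !hdotE !sdotZl; ring.
Qed.

Let F_sqr (z : seq (P * M0)) (t : T0) : t = \sum_(c <- z) sub_tens c.1 c.2 ->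
  F (star t ** t) = tensor_dot (tensor_act tau rho z u) (tensor_act tau rho z u).
Proof.
move=> ->; rewrite star_sum amul_suml (lin_sum (F_linear : linear (F : T0 -> R[i]^o))).
under eq_bigr => a _ do rewrite amul_sumr (lin_sum (F_linear : linear (F : T0 -> R[i]^o))).
rewrite exchange_big /= /tensor_dot big_allpairs_dep; apply: eq_bigr => c _ /=.
under [RHS]eq_bigr => p _ do rewrite big_allpairs_dep /=.
rewrite [RHS]exchange_big /=; apply: eq_bigr => a _.
rewrite sub_tens_star sub_tensM F_tens; apply: eq_bigr => p _; apply: eq_bigr => q _.
by rewrite (repM rtau) (repM rrho) (rep_star rtau) (rep_star rrho).
Qed.

(** A representation of the subalgebra need not extend to [M], so the norm of [T] says nothing about
    it directly. But [F] is a positive functional on the C*-algebra [T0], and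
    [positive_functional_bound] compares its value at t^* t with its value at 1. *)
Lemma sub_tensor_bound (z : seq (P * M0)) :
  complex.Re (tensor_dot (tensor_act tau rho z u) (tensor_act tau rho z u)) <=
  rn (\sum_(c <- z) sub_tens c.1 c.2) ^+ 2 * complex.Re (tensor_dot u u).
Proof.
set t := \sum_(c <- z) _; rewrite -(F_sqr (erefl t)).
have one : (aone : T0) = \sum_(c <- [:: (aone : P, aone : M0)]) sub_tens c.1 c.2.
  by rewrite big_seq1; apply: val_inj.
have pos y : 0 <= F (star y ** y).
  rewrite (@F_sqr [seq (e i, sub_slice i y) | i <- enum 'I_n]) ?tensor_dot_ge0 //.
  by rewrite big_map big_enum /=; exact: sub_tens_decomposition.
have := @positive_functional_bound R T0 F t aone F_linear pos.
rewrite amula1 => /le_trans; apply; apply: ler_wpM2l; first exact: sqr_ge0.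
rewrite (F_sqr one) /tensor_act /= cats0.
have -> : [seq (tau aone p.1, rho aone p.2) | p <- u] =
    [seq (tau aone p.1, p.2) | p <- [seq (p.1, rho aone p.2) | p <- u]] by rewrite -map_comp.
have b1 := tensor_map_left [seq (p.1, rho aone p.2) | p <- u] (rep_lin rtau aone)
  (fun x => le_trans (rn_rep rtau aone x) (ler_wpM2r (rn_ge0 x) (rn_aone P))).
have b2 := tensor_map_right u (rep_lin rrho aone)
  (fun x => le_trans (rn_rep rrho aone x) (ler_wpM2r (rn_ge0 x) (rn_aone M0))).
rewrite !expr1n !mul1r in b1 b2; have := le_trans b1 b2.
by rewrite lecE => /andP[].
Qed.

End SpatialNorm.

(** The norm inherited from [T] is again spatial: one direction is [sub_tensor_bound], the other
    restricts representations of [M] to the subalgebra. *)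
Fact sub_tens_norm (z : seq (P * M0)) (r : R) : 0 <= r ->
  `|\sum_(p <- z) sub_tens p.1 p.2| <= r%:C <-> spatial_norm_le z r.
Proof.
move=> r0; rewrite rn_le; split=> [zr H K tau rho rtau rrho u|zr].
  have := sub_tensor_bound rtau rrho u z.
  have d0 := tensor_dot_ge0 u; have := tensor_dot_ge0 (tensor_act tau rho z u).
  move=> /ReP -> h; rewrite [X in _ * X](ReP d0) -rmorphXn -rmorphM /= lecR.
  apply: le_trans h _; apply: ler_wpM2r; first exact: Re_ge0.
  by rewrite ler_pXn2r ?nnegrE ?rn_ge0.
rewrite -rn_subval (lin_sum (@subval_linear R T sub_tensor)) /= -rn_le.
have := tens_norm T [seq (p.1, subval p.2) | p <- z] r0; rewrite big_map /= => -[_]; apply.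
move=> H K tau rho rtau rrho u.
have rrho' : representation (fun m : M0 => rho (subval m)).
  have [r1 r2 r3 r4] := rrho; split=> [b|a b c x|b c x|b x y].
  - exact: r1.
  - exact: r2.
  - exact: r3.
  - exact: r4.
have := zr H K tau _ rtau rrho' u; congr (tensor_dot _ _ <= _);
  by rewrite /tensor_act -map_comp.
Qed.

Definition sub_minTensor : minTensor P M0 :=
  MinTensor sub_tensPl sub_tensPr sub_tensM sub_tens_star sub_tens_dense sub_tens_norm.

End SubTensor.

(** * Mapping spaces *)

Section UnitalMultipliers.
Context {R : realType} {A T : cstarType R} {u : A} {one : T}.
Hypotheses (u_l : left_id u (amul : A -> A -> A)) (one_l : left_id one (amul : T -> T -> T)).

Lemma multiplier_ext (m m' : multiplier T) : (forall t, mleft m t = mleft m' t) -> m = m'.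
Proof.
case: m m' => [l r p] [l' r' p'] /= hl; have e : l = l' by apply/funext.
have e' : r = r'.
  apply/funext => x; apply/eqP; rewrite -subr_eq0; apply/eqP/rn_eq0/eqP.
  by rewrite -sqrf_eq0 -rn_amul_star amulBl -p -p' hl subrr rn0.
by move: p p'; rewrite e e' => p p'; congr Multiplier; exact: Prop_irrelevance.
Qed.

Lemma in_multiplier_Mor (f : A -> T) : star_hom f -> f u = one ->
  cstar_Mor (fun a => in_multiplier (f a)).
Proof.
move=> [lf fM fS] f1; split=> [a x y|x y|x|].
- by apply: multiplier_ext => t /=; rewrite lf amulPl.
- by apply: multiplier_ext => t /=; rewrite fM amulA.
- by apply: multiplier_ext => t /=; rewrite fS starM starK.
- apply/seteqP; split=> // t _; apply: closed_span_mem.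
  by exists u, t; rewrite /= f1 one_l.
Qed.

Lemma Mor_star_hom (L : A -> multiplier T) : cstar_Mor L ->
  star_hom (fun a => mleft (L a) one) /\ mleft (L u) one = one.
Proof.
move=> mL; split; last exact: Mor_unit mL _.
have one1 : star one = one.
  have : star (one ** star one) = one ** star one by rewrite starM starK.
  by rewrite one_l starK.
split=> [a x y|x y|x].
- exact: (Mor_linear mL).
- by rewrite (MorM mL) -[in LHS](one_l (mleft (L y) one)) mleftM.
- have one_r t : t ** one = t by rewrite -[LHS]starK starM one1 one_l starK.
  by rewrite -[RHS]one_r (Mor_star mL) one1 one_l.
Qed.

End UnitalMultipliers.

Lemma cstar_generated_cstar (R : realType) (B : cstarType R) (S : set B) :
  cstar_subalgebra (cstar_generated S).
Proof.
split=> [D [[h _ _ _ _] _] //|a x y hx hy D hD|x y hx hy D hD|x hx D hD|].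
- by have := hx D hD; have := hy D hD; have [[_ h _ _ _] _] := hD => Dy Dx; exact: h.
- by have := hx D hD; have := hy D hD; have [[_ _ h _ _] _] := hD => Dy Dx; exact: h.
- by have := hx D hD; have [[_ _ _ h _] _] := hD; exact: h.
- apply/closed_rn => v hv D hD; have [[_ _ _ _ /closed_rn h] _] := hD.
  by apply: h => e /hv [x hx vx]; exists x => //; exact: hx.
Qed.

Lemma cstar_generated_mem (R : realType) (B : cstarType R) (S : set B) : S `<=` cstar_generated S.
Proof. by move=> x Sx D [_]; apply. Qed.

Lemma star_hom_subval (R : realType) (A B : cstarType R) (U : unital_subalgebra B)
  (f : A -> subalgebra U) : star_hom f -> star_hom (fun a => subval (f a)).
Proof.
move=> [lf fM fS]; split=> [a x y|x y|x].
- exact: (congr1 (@subval R B U) (lf a x y)).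
- exact: (congr1 (@subval R B U) (fM x y)).
- exact: (congr1 (@subval R B U) (fS x)).
Qed.

Section MappingSpaces.
Context {R : realType} {P O M : unitalCstarType R} {T : minTensor P M} {Phi : O -> T}.
Hypotheses (hPhi : star_hom Phi) (Phi1 : Phi aone = tens T aone aone).

Let Phi' a := in_multiplier (Phi a).

Lemma mapping_Mor : cstar_Mor Phi'.
Proof. exact: (@in_multiplier_Mor R O T aone (tens_one T) (@tens_one_mull R P M T) Phi hPhi Phi1). Qed.

(** The tensor product has a unit, so a slice map extends to multipliers by slicing m 1; this brings
    the finite case under the general one with C = P. *)
Lemma mapping_slice_spaceE : slice_space Phi' = mapping_slice_space Phi.
Proof.
congr closed_span; apply/seteqP; split=> y.
  move=> [w [f [x [bw [_ [s [ss fs]]] ->]]]]; exists w, s, x; split=> //; exact: fs.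
move=> [w [s [x [bw ss ->]]]]; exists w, (fun m => s (mleft m (tens_one T))), x.
have sE t : s (mleft (in_multiplier t) (tens_one T)) = s t by rewrite /= tens_one_mulr.
split; [exact: bw| |by rewrite sE].
split; last by exists s.
move=> F m FF Fm; have [Fl _] := Fm (tens_one T).
have [_ cs _] := ss; exact: continuous_cvg (cs _) Fl.
Qed.

Hypotheses (fdP : finite_dimensional P) (P1 : (aone : P) <> 0).
Local Notation S := (mapping_slice_space Phi).

Lemma mapping_slice_space_one : S aone.
Proof.
have [v [r [[bv sv] v1]]] := sliceable_separates T P1.
have : S (r (Phi aone)) by apply: closed_span_mem; exists v, r, aone.
have [_ _ rE] := sv; rewrite Phi1 rE => h.
have -> : (aone : M) = (v aone : R[i])^-1 *: ((v aone : R[i]) *: aone) + 0.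
  by rewrite addr0 scalerA mulVf ?scale1r //; apply/eqP.
by apply: closed_span_lin h _; exact: closed_span0.
Qed.

Hypothesis univ : forall (X : cstarType R) (T' : minTensor P X) (Psi : O -> multiplier T'),
  cstar_Mor Psi -> exists! L : M -> multiplier X, cstar_Mor L /\
    exists L' : T -> multiplier T', id_tensor L L' /\ forall a, Psi a = L' (Phi a).

(* [Phi] corestricts to the tensor product of [P] with the subalgebra generated by the slices;
   uniqueness of the factorization through [M] forces that subalgebra to be [M]. *)
Lemma mapping_slice_space_generates : cstar_generated S = setT.
Proof.
apply/seteqP; split=> // m _.
have [n [w [s [e [ws we]]]]] := dual_basis T fdP.
have cU := cstar_generated_cstar S.
have U1 : cstar_generated S aone by apply: cstar_generated_mem; exact: mapping_slice_space_one.
pose M0 := subalgebra (sub_right cU U1); pose T0 := sub_minTensor ws we cU U1.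
have Phi0_in a : Phi a \in sub_pred (sub_tensor ws we cU U1).
  suff h : @slices_in R P M T (cstar_generated S) (Phi a) by exact/sub_predP.
  move=> v r [bv sr]; apply: cstar_generated_mem.
  by apply: closed_span_mem; exists v, r, a.
pose Phi0 a : T0 := SubAlgebra (Phi0_in a).
have hPhi0 : star_hom Phi0.
  have [h1 h2 h3] := hPhi; split=> [a x y|x y|x]; apply: val_inj; [exact: h1|exact: h2|exact: h3].
pose one0 : T0 := SubAlgebra (introT (sub_predP _ _) (sub_unit_in (sub_tensor ws we cU U1))).
have one0_l : left_id one0 (amul : T0 -> T0 -> T0) by move=> t; apply: val_inj; exact: tens_one_mull.
have Phi01 : Phi0 aone = one0 by apply: val_inj; exact: Phi1.
have mPhi0 := in_multiplier_Mor one0_l hPhi0 Phi01.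
have [L [[mL [L' [[mL' idL] LE]]] _]] := univ mPhi0.
have [L1 [_ uniq]] := univ mapping_Mor.
have [hl l1] := Mor_star_hom (@amul1a R M) (@amul1a R M0) mL.
have [hl' l1'] := Mor_star_hom (@tens_one_mull R P M T) one0_l mL'.
(* [k] is the composite of [L] with the inclusion of the subalgebra into [M], and [k'] plays the
   part of id (x) k. *)
pose k (m : M) : M := subval (mleft (L m) aone).
pose k' (t : T) : T := subval (mleft (L' t) one0).
have hk : star_hom k := star_hom_subval hl.
have hk' : star_hom k' := star_hom_subval hl'.
have k1 : k aone = aone by rewrite /k l1.
have k1' : k' (tens_one T) = tens_one T by rewrite /k' l1'.
have mk := in_multiplier_Mor (@amul1a R M) hk k1.
have mk' := in_multiplier_Mor (@tens_one_mull R P M T) hk' k1'.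
have id1 : L1 = @in_multiplier R M.
  apply: uniq; split.
    by apply: (in_multiplier_Mor (u := aone) (@amul1a R M) (f := id)).
  exists (@in_multiplier R T); split=> //; split=> [|p x q y].
    by apply: (in_multiplier_Mor (u := tens_one T) (@tens_one_mull R P M T) (f := id)).
  exact: tensM.
(* The identity and [k] both factor [Phi] through itself, so they coincide: every [m] equals k(m),
   which lies in the subalgebra. *)
have id2 : L1 = fun m => in_multiplier (k m).
  apply: uniq; split=> //; exists (fun t => in_multiplier (k' t)); split; first split=> //.
    move=> p x q y /=; rewrite /k'.
    have -> : one0 = tens T0 aone aone by apply: val_inj.
    by rewrite idL /= amula1 tensM.
  move=> a; congr in_multiplier; rewrite /k' -LE.
  by rewrite /= tens_one_mulr.
have := congr1 (fun f : M -> multiplier M => mleft (f m) aone) id2.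
rewrite id1 /= !amula1 => ->; exact: (subval_in (mleft (L m) aone)).
Qed.

End MappingSpaces.

Theorem theorem3p8 (R : realType) :
  (forall (A B : unitalCstarType R) (C : cstarType R) (T : minTensor C B)
          (Phi : A -> multiplier T),
     cstar_Mor Phi ->
     cstar_generated (slice_space Phi) = setT ->
     [/\ operator_system (slice_space Phi),
         hyperrigid (slice_space Phi) &
         equals_cstar_envelope (slice_space Phi)])
  /\
  (forall (P O M : unitalCstarType R) (T : minTensor P M) (Phi : O -> T),
     finite_dimensional P -> (aone : P) <> 0 ->
     mapping_space Phi ->
     [/\ operator_system (mapping_slice_space Phi),
         hyperrigid (mapping_slice_space Phi) &
         equals_cstar_envelope (mapping_slice_space Phi)]).
Proof.
have part1 (A B : unitalCstarType R) (C : cstarType R) (T : minTensor C B)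
    (Phi : A -> multiplier T) : cstar_Mor Phi -> cstar_generated (slice_space Phi) = setT ->
    [/\ operator_system (slice_space Phi), hyperrigid (slice_space Phi) &
        equals_cstar_envelope (slice_space Phi)].
  move=> mPhi gen; split; first exact: slice_space_operator_system.
    exact: slice_space_hyperrigid.
  exact: slice_space_envelope.
split=> // P O M T Phi fdP P1 [hPhi Phi1 univ].
rewrite -mapping_slice_spaceE; apply: part1; first exact: mapping_Mor.
by rewrite mapping_slice_spaceE; exact: mapping_slice_space_generates.
Qed.
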